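(* Let $N$ be a positive integer and let $\sharp\in\{\mathrm{sh},\ast\}$. Then for all $a,b\in\mathbb{Z}/N\mathbb{Z}$ and all integers $r,s\ge 1$ with $(r,s)\neq(1,1)$, we have $$\tilde G_{r;\sharp}^a(q)\,\tilde G_{s;\sharp}^b(q)=\tilde G^{a,b}_{r,s;\ast}(q)+\tilde G^{b,a}_{s,r;\ast}(q)+\delta_{a,b}\,\tilde G^{a}_{r+s;\sharp}(q)+\frac{\delta_{s,1}\tilde g^{a}_{r}(q)+\delta_{r,1}\tilde g^{b}_{s}(q)}{2N}$$ and $$\tilde G_{r;\sharp}^a(q)\,\tilde G_{s;\sharp}^b(q)=\sum_{\substack{i+j=r+s\\ i,j\ge 1}}\left(\binom{i-1}{r-1}\tilde G_{i,j;\mathrm{sh}}^{a+b,b}(q)+\binom{i-1}{s-1}\tilde G_{i,j;\mathrm{sh}}^{a+b,a}(q)\right)+f_{r,s}^{a,b}(q),$$ where, with $k=r+s$, $f_{r,s}^{a,b}(q)=\frac1N\binom{k-2}{s-1}\big((\tilde g^{a+b}_{k-2})'(q)+\tilde g^{a+b}_{k-1}(q)\big)$. Moreover, for all $a,b\in\mathbb{Z}/N\mathbb{Z}$, $$\tilde G_{1;\sharp}^{a}(q)\tilde G_{1;\sharp}^{b}(q)=\tilde G_{1,1;\mathrm{sh}}^{a+b,b}(q)+\tilde G_{1,1;\mathrm{sh}}^{a+b,a}(q)+\frac12\big(f_2^a(q)+f_2^b(q)\big)+\frac1{2N}\Big(2(\tilde g^{a+b}_0)'(q)+2\tilde g^{a+b}_1(q)-(\tilde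 g^{a}_0)'(q)-(\tilde g^{b}_0)'(q)\Big).$$
   Context: Fix $N\ge1$, put $\eta=e^{2\pi i/N}$, let $\delta_{x,y}$ be the Kronecker symbol, $\binom{0}{0}=1$, and let $T$ be a formal variable. All identities are between power series in $q$ with coefficients in $\mathbb{C}[T]$. Superscripts $a,b$ are residue classes modulo $N$. **Polylogarithms and level $N$ zeta values.** $Li_s(x)=\sum_{n>0}x^n/n^s$ and $Li_{r,s}(x,y)=\sum_{m>n>0}x^my^n/(m^rn^s)$ (for roots of unity $x,y$, with $x\neq1$ when the first index is $1$; conditionally convergent sums are summed in the natural order). For $r\ge2$, $s\ge 1$: $\zeta_N^a(r)=\sum_{n>0,\,n\equiv a\,(N)}n^{-r}$ and $\zeta_N^{a,b}(r,s)=\sum_{m>n>0,\,m\equiv a,\,n\equiv b\,(N)}m^{-r}n^{-s}$. **Regularized values.** For $r\ge2,s\ge1$ and $\sharp\in\{\mathrm{sh},\ast\}$ (the shuffle, resp. stuffle, regularization), $\zeta^a_{N;\sharp}(r)=\zeta_N^a(r)$ and $\zeta^{a,b}_{N;\sharp}(r,s)=\zeta^{a,b}_N(r,s)$. Further $$\zeta_{N;\ast}^a(1)=\zeta_{N;\mathrm{sh}}^a(1)=\frac1N\Big(T+\sum_{\alpha=1}^{N-1}\eta^{-a\alpha}Li_1(\eta^\alpha)\Big),$$ for $s\ge2$: $\zeta_{N;\ast}^{a,b}(1,s)=\zeta_{N;\ast}^a(1)\,\zeta_N^b(s)-\zeta_N^{b,a}(s,1)-\delta_{a,b}\zeta_N^a(s+1)$,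 and for $s\ge1$: $$\zeta_{N;\mathrm{sh}}^{a,b}(1,s)=\frac1{N^2}\sum_{\alpha=1}^N\sum_{\beta=1}^N\eta^{-\alpha(a-b)-\beta b}Li^{\mathrm{sh}}_{1,s}(\eta^\alpha,\eta^{\beta-\alpha}),$$ where $Li^{\mathrm{sh}}_{1,1}(1,1)=\frac12T^2$; $Li^{\mathrm{sh}}_{1,s}(\eta^\alpha,\eta^{\beta-\alpha})=Li_{1,s}(\eta^\alpha,\eta^{\beta-\alpha})$ if $\alpha\not\equiv0\pmod N$; and $Li^{\mathrm{sh}}_{1,s}(1,\eta^\beta)=T\,Li_s(\eta^\beta)-\sum_{t=2}^sLi_{t,s+1-t}(1,\eta^\beta)-Li_{s,1}(\eta^\beta,\eta^{-\beta})$ for $(s,\beta)\ne(1,\bar0)$. **$q$-series.** For $r,s\ge1$, $$\tilde g^a_s(q)=\frac{(-1)^s}{N^s(s-1)!}\sum_{u,v\ge1}\eta^{av}v^{s-1}q^{uv},$$ $$\tilde g^{a,b}_{r,s}(q)=\frac{(-1)^{r+s}}{N^{r+s}(r-1)!(s-1)!}\sum_{\substack{u_1>u_2>0\\ v_1,v_2\ge1}}\eta^{av_1+bv_2}v_1^{r-1}v_2^{s-1}q^{u_1v_1+u_2v_2}.$$ For $k\ge0$, $(\tilde g^a_k)'(q)=\frac{(-1)^k}{N^{k+1}k!}\sum_{n,v\ge1}n\,v^k\eta^{av}q^{nv}$ (for $k\ge1$ this is $\frac{q}{Nk}\frac{d}{dq}\tilde g_k^a(q)$). Also $f_2^a(q)=\frac1{N^2}\sum_{n,u\ge1}\eta^{au}n\,q^{nu}$.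 **(Regularized, normalized) Eisenstein series of level $N$.** For $r,s\ge1$, put $\tilde\zeta^a_{N;\sharp}(r)=(2\pi i)^{-r}\zeta^a_{N;\sharp}(r)$, $\tilde\zeta^{a,b}_{N;\sharp}(r,s)=(2\pi i)^{-r-s}\zeta^{a,b}_{N;\sharp}(r,s)$, and $$\tilde G^a_{s;\sharp}(q)=\tilde\zeta^a_{N;\sharp}(s)+\tilde g^a_s(q),$$ $$\tilde G^{a,b}_{r,s;\sharp}(q)=\tilde\zeta^{a,b}_{N;\sharp}(r,s)+\tilde g^a_r(q)\tilde\zeta^b_{N;\sharp}(s)+\tilde g^{a,b}_{r,s}(q)+\sum_{\substack{h+p=r+s\\ h\ge1,\,p\ge\min\{r,s\}}}\tilde\zeta^{a-b}_{N;\sharp}(p)\left[(-1)^s\binom{p-1}{s-1}\tilde g^a_h(q)+(-1)^{p-r}\binom{p-1}{r-1}\tilde g^b_h(q)\right].$$ ($\tilde G^a_{s;\sharp}$ does not depend on $\sharp$.) *)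

(* Defs.v *)
From HB Require Import structures.
From mathcomp Require Import all_boot all_order all_algebra.
From mathcomp Require Import all_classical all_reals all_analysis.
From mathcomp Require Import complex.

Set Implicit Arguments.
Unset Strict Implicit.
Unset Printing Implicit Defensive.

Import Order.TTheory GRing.Theory Num.Theory.
Import numFieldNormedType.Exports.

Local Open Scope ring_scope.
Local Open Scope complex_scope.

(** Formal power series in [q] over a commutative ring [K], as a commutative
    [K]-algebra for the Cauchy product.  The record wrapper keeps this product
    apart from the pointwise one on functions. *)
Record pser (K : Type) := PSer { pcoef :> nat -> K }.

Section PowerSeries.
Variable K : comNzRingType.
Implicit Types f g h : pser K.

HB.instance Definition _ := gen_eqMixin (pser K).
HB.instance Definition _ := gen_choiceMixin (pser K).

Lemma pserP f g : (forall n, f n = g n) -> f = g.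
Proof. by case: f g => f [g] /= /funext ->. Qed.

Definition pser_zero : pser K := PSer (fun=> 0).
Definition pser_opp f : pser K := PSer (fun n => - f n).
Definition pser_add f g : pser K := PSer (fun n => f n + g n).

Fact pser_addA : associative pser_add.
Proof. by move=> f g h; apply: pserP => n /=; rewrite addrA. Qed.
Fact pser_addC : commutative pser_add.
Proof. by move=> f g; apply: pserP => n /=; rewrite addrC. Qed.
Fact pser_add0 : left_id pser_zero pser_add.
Proof. by move=> f; apply: pserP => n /=; rewrite add0r. Qed.
Fact pser_addN : left_inverse pser_zero pser_opp pser_add.
Proof. by move=> f; apply: pserP => n /=; rewrite addNr. Qed.

HB.instance Definition _ :=
  GRing.isZmodule.Build (pser K) pser_addA pser_addC pser_add0 pser_addN.

Definition pser_one : pser K := PSer (fun n => (n == 0%N)%:R).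
Definition pser_mul f g : pser K :=
  PSer (fun n => \sum_(i < n.+1) f i * g (n - i)%N).

Let trunc m f : {poly K} := \poly_(i < m) f i.

Let trunc_mul m f g n : (n < m)%N -> (trunc m f * trunc m g)`_n = pser_mul f g n.
Proof.
move=> nm; rewrite coefM; apply: eq_bigr => i _.
rewrite !coef_poly (leq_ltn_trans _ nm) 1?(leq_ltn_trans _ nm) ?leq_subr //.
by rewrite -ltnS.
Qed.

Fact pser_mulA : associative pser_mul.
Proof.
move=> f g h; apply: pserP => n.
transitivity ((trunc n.+1 f * (trunc n.+1 g * trunc n.+1 h))`_n).
  rewrite coefM; apply: eq_bigr => i _.
  by rewrite coef_poly ltn_ord trunc_mul // ltnS leq_subr.
rewrite mulrA coefM; apply: eq_bigr => i _.
by rewrite coef_poly ltnS leq_subr trunc_mul.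
Qed.

Fact pser_mulC : commutative pser_mul.
Proof.
move=> f g; apply: pserP => n.
by rewrite -(@trunc_mul n.+1) // -[RHS](@trunc_mul n.+1) // mulrC.
Qed.

Fact pser_mul1 : left_id pser_one pser_mul.
Proof.
move=> f; apply: pserP => n /=.
rewrite big_ord_recl /= subn0 mul1r big1 ?addr0 // => i _.
by rewrite /= mul0r.
Qed.

Fact pser_mulDl : left_distributive pser_mul pser_add.
Proof.
move=> f g h; apply: pserP => n /=; rewrite -big_split /=.
by apply: eq_bigr => i _; rewrite mulrDl.
Qed.

Fact pser_one_neq0 : pser_one != 0.
Proof.
by apply/eqP => /(congr1 (fun f : pser K => f 0%N)) /= /eqP; rewrite oner_eq0.
Qed.

HB.instance Definition _ := GRing.Zmodule_isComNzRing.Build (pser K)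
  pser_mulA pser_mulC pser_mul1 pser_mulDl pser_one_neq0.

Definition pser_scale (c : K) f : pser K := PSer (fun n => c * f n).

Fact pser_scaleA c d f : pser_scale c (pser_scale d f) = pser_scale (c * d) f.
Proof. by apply: pserP => n /=; rewrite mulrA. Qed.
Fact pser_scale1 : left_id 1 pser_scale.
Proof. by move=> f; apply: pserP => n /=; rewrite mul1r. Qed.
Fact pser_scaleDr : right_distributive pser_scale +%R.
Proof. by move=> c f g; apply: pserP => n /=; rewrite mulrDr. Qed.
Fact pser_scaleDl f : {morph pser_scale^~ f : c d / c + d}.
Proof. by move=> c d; apply: pserP => n /=; rewrite mulrDl. Qed.

HB.instance Definition _ := GRing.Zmodule_isLmodule.Build K (pser K)
  pser_scaleA pser_scale1 pser_scaleDr pser_scaleDl.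

Fact pser_scaleAl (c : K) f g : c *: (f * g) = (c *: f) * g.
Proof.
apply: pserP => n /=; rewrite mulr_sumr.
by apply: eq_bigr => i _; rewrite mulrA.
Qed.

HB.instance Definition _ :=
  GRing.Lmodule_isLalgebra.Build K (pser K) pser_scaleAl.

End PowerSeries.

Variant regularization := Sh | Ast.

Section Level.
Variables (R : realType) (n : nat).
Local Notation C := R[i].

(* The level is [n.+1], so that ['I_N] is the additive group Z/NZ for every
   positive [N] (['Z_1] is Z/2Z). *)
Local Notation N := n.+1.

Definition eta : C := cos (2 * pi / N%:R) +i* sin (2 * pi / N%:R).

Definition twopii : C := 0 +i* (2 * pi).

(* Sum over [m >= 1] in the natural order; [R[i]^o] carries the usual topology
   of the complex numbers. *)
Definition csum (F : nat -> C) : C :=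
  limn (fun M => \sum_(1 <= m < M) F m : C^o).

Definition Li (s : nat) (x : C) : C := csum (fun m => x ^+ m / m%:R ^+ s).

Definition Li2 (r s : nat) (x y : C) : C :=
  csum (fun m => x ^+ m / m%:R ^+ r * \sum_(1 <= l < m) y ^+ l / l%:R ^+ s).

Definition zetaN (a : 'I_N) (r : nat) : C :=
  csum (fun m => (m == a %[mod N])%:R / m%:R ^+ r).

Definition zetaN2 (a b : 'I_N) (r s : nat) : C :=
  csum (fun m => (m == a %[mod N])%:R / m%:R ^+ r *
    \sum_(1 <= l < m | (l == b %[mod N])%N) (l%:R ^+ s)^-1).

(* The formal variable [T] is ['X : {poly C}]. *)

(* For [r >= 1]; both regularizations give the same value. *)
Definition zeta_reg (sharp : regularization) (a : 'I_N) (r : nat) : {poly C} :=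
  if r == 1%N then
    N%:R^-1 *:
      ('X + (\sum_(1 <= alpha < N) eta ^- (a * alpha) * Li 1 (eta ^+ alpha))%:P)
  else (zetaN a r)%:P.

(* Li^sh_{1,s}(eta^alpha, eta^(beta - alpha)). *)
Definition Li_sh (s alpha beta : nat) : {poly C} :=
  if ~~ (N %| alpha)%N then
    (Li2 1 s (eta ^+ alpha) (eta ^+ beta / eta ^+ alpha))%:P
  else if (s == 1%N) && (N %| beta)%N then 2^-1 *: 'X^2
  else Li s (eta ^+ beta) *: 'X
       - (\sum_(2 <= t < s.+1) Li2 t (s.+1 - t) 1 (eta ^+ beta))%:P
       - (Li2 s 1 (eta ^+ beta) (eta ^- beta))%:P.

(* For [r, s >= 1].  The value at [Ast] and [(r, s) = (1, 1)] is meaningless: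
   it involves a divergent sum. *)
Definition zeta_reg2 (sharp : regularization) (a b : 'I_N) (r s : nat) :
    {poly C} :=
  if r == 1%N then
    match sharp with
    | Ast => zeta_reg Ast a 1 * (zetaN b s)%:P - (zetaN2 b a s 1)%:P
             - (zetaN a s.+1)%:P *+ (a == b)
    | Sh => (N%:R ^+ 2)^-1 *:
        \sum_(1 <= alpha < N.+1) \sum_(1 <= beta < N.+1)
          eta ^- (alpha * (a - b)%R + beta * b) *: Li_sh s alpha beta
    end
  else (zetaN2 a b r s)%:P.

Definition tzeta (sharp : regularization) (a : 'I_N) (r : nat) : {poly C} :=
  twopii ^- r *: zeta_reg sharp a r.

Definition tzeta2 (sharp : regularization) (a b : 'I_N) (r s : nat) :
    {poly C} :=
  twopii ^- (r + s) *: zeta_reg2 sharp a b r s.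

(* In the coefficient of [q ^ m] below, every summation index is at most [m]. *)

Definition tg (a : 'I_N) (s : nat) : pser {poly C} := PSer (fun m =>
  ((-1) ^+ s / (N%:R ^+ s * (s.-1)`!%:R) *
   \sum_(1 <= u < m.+1) \sum_(1 <= v < m.+1 | (u * v == m)%N)
     eta ^+ (a * v) * v%:R ^+ s.-1)%:P).

Definition tg2 (a b : 'I_N) (r s : nat) : pser {poly C} := PSer (fun m =>
  ((-1) ^+ (r + s) / (N%:R ^+ (r + s) * (r.-1)`!%:R * (s.-1)`!%:R) *
   \sum_(1 <= u1 < m.+1) \sum_(1 <= u2 < u1)
   \sum_(1 <= v1 < m.+1) \sum_(1 <= v2 < m.+1 | (u1 * v1 + u2 * v2 == m)%N)
     eta ^+ (a * v1 + b * v2) * v1%:R ^+ r.-1 * v2%:R ^+ s.-1)%:P).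

(* The series denoted (g~_k^a)'. *)
Definition dtg (a : 'I_N) (k : nat) : pser {poly C} := PSer (fun m =>
  ((-1) ^+ k / (N%:R ^+ k.+1 * k`!%:R) *
   \sum_(1 <= u < m.+1) \sum_(1 <= v < m.+1 | (u * v == m)%N)
     u%:R * v%:R ^+ k * eta ^+ (a * v))%:P).

Definition f2 (a : 'I_N) : pser {poly C} := PSer (fun m =>
  ((N%:R ^+ 2)^-1 *
   \sum_(1 <= l < m.+1) \sum_(1 <= u < m.+1 | (l * u == m)%N)
     eta ^+ (a * u) * l%:R)%:P).

Definition frs (a b : 'I_N) (r s : nat) : pser {poly C} :=
  (N%:R^-1 *: ('C(r + s - 2, s - 1)%:R)%:P : {poly C}) *:
    (dtg (a + b) (r + s - 2) + tg (a + b) (r + s - 1)).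

Definition tG (sharp : regularization) (a : 'I_N) (s : nat) : pser {poly C} :=
  (tzeta sharp a s)%:A + tg a s.

(* [h = r + s - p]; the sign (-1)^(p - r) is written (-1)^(p + r). *)
Definition tG2 (sharp : regularization) (a b : 'I_N) (r s : nat) :
    pser {poly C} :=
  (tzeta2 sharp a b r s)%:A + tzeta sharp b s *: tg a r + tg2 a b r s
  + \sum_(minn r s <= p < r + s)
      tzeta sharp (a - b) p *:
        (((-1) ^+ s * 'C(p - 1, s - 1)%:R) *: tg a (r + s - p)
         + ((-1) ^+ (p + r) * 'C(p - 1, r - 1)%:R) *: tg b (r + s - p)).

End Level.

(* Main.v *)
(** Each product is expanded into constant, linear and quadratic parts in the
    series [tg].

    Constant part: the stuffle relation comes from splitting the double sum at
    the diagonal; the shuffle relation comes from partial fractions, first for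
    polylogarithms at roots of unity, where the triangular partial sums are
    compared with the square ones by Abel summation, and then for the
    regularized values by a finite Fourier transform.

    Quadratic part, shuffle: the terms with [v1 < v2] are rearranged by
    [(u1, u2, v1, v2) -> (u1 + u2, u2, v1, v2 - v1)], and those with [v1 = v2]
    yield [frs].

    Quadratic part, stuffle: the terms with [u1 = u2] involve the sums over
    [v1 + v2 = w] of [eta^(a v1 + b v2) v1^(r-1) v2^(s-1)].  A twisted
    Euler-Maclaurin summation expresses them by the coefficients of
    [e^t / (e^t - eta^c)], where [c = a - b].  These coefficients are values of
    [zeta(c; p) + (-1)^p zeta(-c; p)]: both are limits of the power sums of
    [(M (1 - y))^-1] over the [M]-th roots [y] of [eta^c].

    The linear parts in the shuffle relation cancel by an inversion formula for
    binomial coefficients. *)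

Require Import Defs.
From HB Require Import structures.
From mathcomp Require Import all_boot all_order all_algebra.
From mathcomp Require Import all_classical all_reals all_analysis.
From mathcomp Require Import complex.
From mathcomp Require Import ring lra zify.

Set Implicit Arguments.
Unset Strict Implicit.
Unset Printing Implicit Defensive.

Import Order.TTheory GRing.Theory Num.Theory.
Import numFieldNormedType.Exports.
Import ComplexField.Normc.

Local Open Scope ring_scope.
Local Open Scope complex_scope.

(** * Conditionally convergent sums *)

Section ComplexLimits.
Local Open Scope classical_set_scope.
Variable R : realType.
Local Notation C := R[i].
Implicit Types (u v e z : nat -> C) (l : C).

(** Convergence in [R[i]] is expressed by the real-valued norm, so that real estimates and squeezing
    apply directly; [climE] identifies it with the topology behind [csum]. *)
Definition clim u l := (fun M => normc (u M - l)) @ \oo --> (0 : R).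

Lemma climE u l : clim u l <-> ((u : nat -> C^o) @ \oo --> (l : C^o)).
Proof.
split=> [/cvgrPdist_lt ul|/cvgrPdist_lt ul].
  apply/cvgrPdist_lt => eps eps0.
  have /complex_realP [e eE] : eps \is Num.real by apply: gtr0_real.
  move: eps0; rewrite eE ltcR => e0; have := ul e e0.
  apply: filterS => M; rewrite sub0r normrN => h.
  rewrite distrC -[X in X < _]/((normc (u M - l))%:C) ltcR.
  by apply: le_lt_trans h; apply: ler_norm.
apply/cvgrPdist_lt => e e0.
have := ul e%:C; rewrite ltcR => /(_ e0).
apply: filterS => M; rewrite sub0r normrN distrC.
rewrite -[X in X < _ -> _]/((normc (u M - l))%:C) ltcR.
by rewrite ger0_norm //; case: (u M - l) => a b /=; rewrite sqrtr_ge0.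
Qed.

Lemma normc_ge0 (x : C) : 0 <= normc x.
Proof. by case: x => a b; rewrite sqrtr_ge0. Qed.

Lemma normc_real (x : R) : normc x%:C = `|x|.
Proof. by rewrite /= expr0n addr0 sqrtr_sqr. Qed.

Lemma normc_nat k : normc (k%:R : C) = k%:R.
Proof. by rewrite -(rmorph_nat (real_complex R)) normc_real normr_nat. Qed.

Lemma normcX (x : C) k : normc (x ^+ k) = normc x ^+ k.
Proof.
elim: k => [|k IH]; first by rewrite !expr0 normc1.
by rewrite !exprS normcM IH.
Qed.

Lemma normc_sum (I : Type) (r : seq I) (P : pred I) (F : I -> C) :
  normc (\sum_(i <- r | P i) F i) <= \sum_(i <- r | P i) normc (F i).
Proof.
elim/big_ind2: _ => [|x y x' y' h h'|//]; first by rewrite normc0.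
by apply: le_trans (le_normcD _ _) _; rewrite lerD.
Qed.

Lemma clim_lim u l : clim u l -> limn (u : nat -> C^o) = l.
Proof. by move=> /climE ul; apply: cvg_lim. Qed.

Lemma clim_unique u l l' : clim u l -> clim u l' -> l = l'.
Proof. by move=> /clim_lim <- /clim_lim <-. Qed.

Lemma clim_cst l : clim (fun=> l) l.
Proof. by apply/climE; apply: cvg_cst. Qed.

Lemma climD u v l l' : clim u l -> clim v l' -> clim (fun M => u M + v M) (l + l').
Proof. by move=> /climE ul /climE vl; apply/climE; exact: (@cvgD C C^o _ _ _ u v _ _ ul vl). Qed.

Lemma climM u v l l' : clim u l -> clim v l' -> clim (fun M => u M * v M) (l * l').
Proof. by move=> /climE ul /climE vl; apply/climE; exact: (@cvgM C _ _ _ u v _ _ ul vl). Qed.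

Lemma climMl c u l : clim u l -> clim (fun M => c * u M) (c * l).
Proof. exact/climM/clim_cst. Qed.

Lemma climN u l : clim u l -> clim (fun M => - u M) (- l).
Proof.
by move=> /(climMl (-1)); rewrite mulN1r; under eq_fun do rewrite mulN1r.
Qed.

Lemma climB u v l l' : clim u l -> clim v l' -> clim (fun M => u M - v M) (l - l').
Proof. by move=> ul /climN; apply: climD. Qed.

Lemma clim_sum (I : Type) (r : seq I) (P : pred I) (F : I -> nat -> C) (L : I -> C) :
  (forall i, P i -> clim (F i) (L i)) ->
  clim (fun M => \sum_(i <- r | P i) F i M) (\sum_(i <- r | P i) L i).
Proof.
move=> FL; elim: r => [|i r IH].
  by rewrite big_nil; under eq_fun do rewrite big_nil; apply: clim_cst.
rewrite big_cons; under eq_fun do rewrite big_cons.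
by case: ifPn => // Pi; apply: climD (FL i Pi) IH.
Qed.

Lemma climX u l k : clim u l -> clim (fun M => u M ^+ k) (l ^+ k).
Proof.
move=> ul; elim: k => [|k IH]; first exact: clim_cst.
by under eq_fun do rewrite exprS; rewrite exprS; apply: climM.
Qed.

Lemma climV u l : l != 0 -> clim u l -> clim (fun M => (u M)^-1) l^-1.
Proof. by move=> l0 /climE ul; apply/climE; exact: (@cvgV C _ _ _ u _ l0 ul). Qed.

Lemma squeeze0 (f g : nat -> R) :
  (\forall M \near \oo, 0 <= f M <= g M) -> g @ \oo --> (0 : R) ->
  f @ \oo --> (0 : R).
Proof. by move=> h; apply: (@squeeze_cvgr _ \oo _ R (fun=> 0) g f h); apply: cvg_cst. Qed.

Lemma clim_le u l (g : nat -> R) :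
  (forall M, (0 < M)%N -> normc (u M - l) <= g M) -> g @ \oo --> (0 : R) ->
  clim u l.
Proof.
move=> h; apply: squeeze0; exists 1%N => // M /= M0.
by rewrite normc_ge0 h.
Qed.

Lemma clim_near u v l (K : nat) :
  (forall M, (K <= M)%N -> u M = v M) -> clim u l -> clim v l.
Proof.
move=> uv; apply: cvg_trans; apply: near_eq_cvg; exists K => // M /= KM.
by rewrite uv.
Qed.

Lemma cst_div_cvg (K : R) : (fun M => K / M%:R) @ \oo --> (0 : R).
Proof.
rewrite -[X in _ --> X](mulr0 K); apply: cvgMr.
rewrite -(cvg_shiftS (fun M => M%:R^-1 : R)).
exact: cvg_harmonic.
Qed.

Lemma harmonic_div_cvg :
  (fun M => (\sum_(1 <= k < M) k%:R^-1) / M%:R) @ \oo --> (0 : R).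
Proof.
have /cesaro h : (harmonic : nat -> R) @ \oo --> (0 : R) by apply: cvg_harmonic.
rewrite -(cvg_shiftS (fun M => (\sum_(1 <= k < M) k%:R^-1) / M%:R : R)) /=.
have {}h : arithmetic_mean (harmonic : nat -> R) @ \oo --> (0 : R) by [].
apply: squeeze0 h; near=> M; apply/andP; split.
  by rewrite divr_ge0 // sumr_ge0 // => i _; rewrite invr_ge0.
rewrite /arithmetic_mean /series /= mulrC ler_wpM2l ?invr_ge0 //.
by rewrite big_add1 /= big_nat_recr //= lerDl invr_ge0.
Unshelve. all: by end_near. Qed.

Lemma cvg_0MlD (K : R) (f g : nat -> R) :
  f @ \oo --> (0 : R) -> g @ \oo --> (0 : R) ->
  (fun M => K * (f M + g M)) @ \oo --> (0 : R).
Proof.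
move=> f0 g0; rewrite -[X in _ --> X](mulr0 K); apply: cvgMr.
by rewrite -[X in _ --> X](addr0 0); apply: cvgD.
Qed.

Lemma real_cauchy (u : nat -> R) (g : nat -> R) :
  (forall A B, (0 < A <= B)%N -> `|u B - u A| <= g A) ->
  g @ \oo --> (0 : R) -> exists l : R, u @ \oo --> l.
Proof.
move=> h /cvgrPdist_lt g0; apply/cvg_ex/cauchy_cvgP/cauchyP => eps eps0.
have [K _ hK] := g0 eps eps0.
exists (u K.+1), K.+1 => // M /= KM; rewrite /ball /= distrC.
apply: le_lt_trans (h _ _ _) _; first by rewrite KM.
have := hK K.+1 (leqnSn K); rewrite /= sub0r normrN.
exact/le_lt_trans/ler_norm.
Qed.

Lemma clim_cauchy u (g : nat -> R) :
  (forall A B, (0 < A <= B)%N -> normc (u B - u A) <= g A) ->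
  g @ \oo --> (0 : R) -> exists l, clim u l.
Proof.
move=> h g0.
have reim (x : C) : `|complex.Re x| <= normc x /\ `|complex.Im x| <= normc x.
  case: x => a b /=; rewrite -!sqrtr_sqr.
  by split; rewrite ler_wsqrtr // ?lerDl ?lerDr sqr_ge0.
have reB x y : complex.Re (x - y) = complex.Re x - complex.Re y :> R.
  by case: x y => ? ? [].
have imB x y : complex.Im (x - y) = complex.Im x - complex.Im y :> R.
  by case: x y => ? ? [].
have [a ua] : exists a : R, (fun M => complex.Re (u M)) @ \oo --> a.
  apply: (@real_cauchy (fun M => complex.Re (u M)) g _ g0) => A B AB; apply: le_trans (h A B AB).
  by rewrite -reB; apply: (reim _).1.
have [b ub] : exists b : R, (fun M => complex.Im (u M)) @ \oo --> b.
  apply: (@real_cauchy (fun M => complex.Im (u M)) g _ g0) => A B AB; apply: le_trans (h A B AB).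
  by rewrite -imB; apply: (reim _).2.
exists (a +i* b).
apply: (@squeeze0 _ (fun M => `|complex.Re (u M) - a| + `|complex.Im (u M) - b|)).
  near=> M; rewrite normc_ge0 /=.
  have -> : u M - (a +i* b) = (complex.Re (u M) - a)%:C + (0 +i* (complex.Im (u M) - b)).
    by case: (u M) => x y /=; apply/eqP; rewrite eq_complex /= addr0 add0r !eqxx.
  apply: le_trans (le_normcD _ _) _; rewrite normc_real lerD2l.
  by rewrite /= expr0n add0r sqrtr_sqr.
have norm0 (w : nat -> R) c : w @ \oo --> c -> (fun M => `|w M - c|) @ \oo --> (0 : R).
  by move=> wc; rewrite -[X in _ --> X](@normr0 R R) -(subrr c); apply: cvg_norm; apply: cvgB => //; apply: cvg_cst.
by rewrite -[X in _ --> X](addr0 0); apply: cvgD; apply: norm0.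
Unshelve. all: by end_near. Qed.

End ComplexLimits.

Section Tails.
Variable R : realType.
Local Open Scope classical_set_scope.
Local Notation C := R[i].
Implicit Types (e z : nat -> C) (K : R).

(** Decay 1/A of the tails holds both for exponents at least 2 and for the conditionally convergent
    series at exponent 1. It is strong enough for double sums, whose inner sums grow at most like
    [harm A], because [harm A / A] tends to 0. *)
Definition tail_bounded e K :=
  forall A B, (0 < A)%N -> normc (\sum_(A <= m < B) e m) <= K / A%:R.

Lemma tail_bounded_ge0 e K : tail_bounded e K -> 0 <= K.
Proof.
by move=> h; have := h 1%N 1%N isT; rewrite big_geq // normc0 divr1.
Qed.

Lemma sum_sub (V : zmodType) (F : nat -> V) A B : (0 < A <= B)%N ->
  \sum_(1 <= m < B) F m - \sum_(1 <= m < A) F m = \sum_(A <= m < B) F m.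
Proof.
case/andP=> A0 AB; rewrite (big_cat_nat (n := A)) //=.
by rewrite addrAC subrr add0r.
Qed.

Lemma sum_nat_triangle (V : zmodType) (F : nat -> nat -> V) A B :
  \sum_(A <= l < B) \sum_(l.+1 <= m < B) F l m =
  \sum_(A <= m < B) \sum_(A <= l < m) F l m.
Proof.
transitivity (\sum_(A <= l < B) \sum_(A <= m < B | (l < m)%N) F l m).
  apply: eq_big_nat => l /andP[Al lB].
  by rewrite (big_nat_widenl _ A) //; exact: leqW.
rewrite (exchange_big_dep_nat xpredT) //=; apply: eq_big_nat => m /andP[Am mB].
by rewrite [RHS](big_nat_widen _ _ B) // ltnW.
Qed.

Lemma tail_bounded_cvg e K : tail_bounded e K ->
  exists l, clim (fun M => \sum_(1 <= m < M) e m) l.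
Proof.
move=> h; apply: (@clim_cauchy _ _ (fun A => K / A%:R)); last exact: cst_div_cvg.
by move=> A B AB; rewrite sum_sub // h //; case/andP: AB.
Qed.

Lemma dirichlet_test e (g : nat -> R) K A B :
  (forall n, (A <= n <= B)%N -> normc (\sum_(A <= m < n) e m) <= K) ->
  (forall m, (A <= m < B)%N -> 0 <= g m) ->
  (forall m, (A <= m)%N -> (m.+1 < B)%N -> g m.+1 <= g m) ->
  (A < B)%N ->
  normc (\sum_(A <= m < B) e m * (g m)%:C) <= K * g A.
Proof.
move=> he g0 gd AB.
pose S n := \sum_(A <= m < n) e m * (g m)%:C; pose E n := \sum_(A <= m < n) e m.
(* Abel summation as an invariant: the partial sum minus its boundary term is bounded by [K] times
   the total decrease of [g] so far. *)
have key n : (A + n < B)%N ->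
    normc (S (A + n).+1 - E (A + n).+1 * (g (A + n)%N)%:C) <= K * (g A - g (A + n)%N).
  elim: n => [|n IH] ltB.
    by rewrite addn0 /S /E !big_nat1 !subrr normc0 mulr0.
  rewrite addnS in ltB *; have {}IH := IH (ltnW ltB).
  have -> : S (A + n).+2 - E (A + n).+2 * (g (A + n).+1)%:C =
      (S (A + n).+1 - E (A + n).+1 * (g (A + n)%N)%:C)
      + E (A + n).+1 * (g (A + n)%N - g (A + n).+1)%:C.
    rewrite /S /E !(@big_nat_recr _ _ _ (A + n).+1) /=; last 2 first.
    - by rewrite -addnS leq_addr.
    - by rewrite -addnS leq_addr.
    by rewrite rmorphB /=; ring.
  apply: le_trans (le_normcD _ _) _.
  have -> : g A - g (A + n).+1 = (g A - g (A + n)%N) + (g (A + n)%N - g (A + n).+1).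
    by ring.
  rewrite mulrDr lerD // normcM normc_real ger0_norm; last first.
    by rewrite subr_ge0 gd // leq_addr.
  rewrite ler_wpM2r ?subr_ge0 ?gd ?leq_addr // he //.
  by rewrite -addnS leq_addr addnS ltnW.
have BE : B = (A + (B.-1 - A)).+1 by lia.
have ltB : (A + (B.-1 - A) < B)%N by lia.
have := key _ ltB; rewrite -BE => h.
have -> : \sum_(A <= m < B) e m * (g m)%:C =
   (S B - E B * (g (A + (B.-1 - A))%N)%:C) + E B * (g (A + (B.-1 - A))%N)%:C.
  by rewrite subrK.
apply: le_trans (le_normcD _ _) _.
apply: le_trans (lerD h (lexx _)) _.
rewrite mulrBr -addrA -[leRHS]addr0 lerD2l addrC subr_le0.
have g0' : 0 <= g (A + (B.-1 - A))%N by apply: g0; lia.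
rewrite normcM normc_real ger0_norm //.
by apply: ler_wpM2r => //; apply: he; rewrite ltnW //=.
Qed.

Lemma sum_inv_mulS A B : (0 < A)%N ->
  \sum_(A <= m < B) (m%:R * m.+1%:R)^-1 <= A%:R^-1 :> R.
Proof.
move=> A0; have [BA|AB] := leqP B A; first by rewrite big_geq // invr_ge0.
have -> : \sum_(A <= m < B) (m%:R * m.+1%:R)^-1 =
          \sum_(A <= m < B) (- (m.+1%:R)^-1 - - (m%:R)^-1) :> R.
  apply: eq_big_nat => m /andP[Am mB].
  have m0 : (m%:R : R) != 0 by rewrite pnatr_eq0 -lt0n (leq_trans A0).
  have m1 : (m.+1%:R : R) != 0 by rewrite pnatr_eq0.
  by rewrite opprK -[m.+1]addn1 natrD in m1 *; field; rewrite m0 m1.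
rewrite telescope_sumr ?(ltnW AB) // opprK addrC gerDl oppr_le0 invr_ge0 //.
Qed.

Lemma le_inv_sqr m : (0 < m)%N -> m%:R ^- 2 <= 2 * (m%:R * m.+1%:R)^-1 :> R.
Proof.
move=> m0; have m0' : (0 : R) < m%:R by rewrite ltr0n.
rewrite -lef_pV2 ?posrE ?invr_gt0 ?exprn_gt0 ?mulr_gt0 ?invr_gt0 ?mulr_gt0 ?ltr0n //.
rewrite invrK invfM invrK.
rewrite expr2 mulrCA ler_wpM2l // -[m.+1]addn1 natrD.
have : (1 : R) <= m%:R by rewrite ler1n.
lra.
Qed.

Lemma tail_bounded_sqr e K : 0 <= K ->
  (forall m, (0 < m)%N -> normc (e m) <= K / m%:R ^+ 2) -> tail_bounded e (2 * K).
Proof.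
move=> K0 h A B A0; apply: le_trans (normc_sum _ _ _) _.
apply: (@le_trans _ _ (\sum_(A <= m < B) (2 * K) * (m%:R * m.+1%:R)^-1)).
  apply: ler_sum_nat => m /andP[Am mB]; have m0 := leq_trans A0 Am.
  apply: le_trans (h _ m0) _; rewrite [2 * K]mulrC -mulrA.
  by rewrite ler_wpM2l //; apply: le_inv_sqr.
by rewrite -mulr_sumr ler_wpM2l ?mulr_ge0 // sum_inv_mulS.
Qed.

Lemma tail_bounded_dirichlet e K :
  (forall A B, normc (\sum_(A <= m < B) e m) <= K) ->
  tail_bounded (fun m => e m / m%:R) K.
Proof.
move=> h A B A0; have [BA|AB] := leqP B A.
  rewrite big_geq // normc0 divr_ge0 //.
  by apply: le_trans (h 0%N 0%N); apply: normc_ge0.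
have -> : \sum_(A <= m < B) e m / m%:R = \sum_(A <= m < B) e m * (m%:R^-1 : R)%:C.
  by apply: eq_bigr => m _; rewrite fmorphV rmorph_nat.
apply: (@dirichlet_test e (fun m => m%:R^-1)) => // m Am _.
by rewrite lef_pV2 ?posrE ?ltr0n // ?ler_nat //; lia.
Qed.

Lemma geom_sum_bounded (x : C) A B : normc x = 1 -> x != 1 ->
  normc (\sum_(A <= m < B) x ^+ m) <= 2 / normc (x - 1).
Proof.
move=> x1 nx1.
have nx0 : 0 < normc (x - 1).
  rewrite lt_def normc_ge0 andbT; apply: contra nx1 => /eqP /eq0_normc /eqP.
  by rewrite subr_eq0.
have [BA|AB] := leqP B A; first by rewrite big_geq // normc0 divr_ge0 // ltW.
rewrite ler_pdivlMr // -normcM mulr_suml.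
have -> : \sum_(A <= m < B) x ^+ m * (x - 1) = \sum_(A <= m < B) (x ^+ m.+1 - x ^+ m).
  by apply: eq_bigr => m _; rewrite mulrBr mulr1 exprSr.
rewrite telescope_sumr ?(ltnW AB) //.
apply: le_trans (le_normcD _ _) _.
by rewrite normcN !normcX x1 !expr1n.
Qed.

Lemma tail_bounded_geom (x : C) : normc x = 1 -> x != 1 ->
  tail_bounded (fun m => x ^+ m / m%:R) (2 / normc (x - 1)).
Proof. by move=> x1 nx1; apply: tail_bounded_dirichlet => A B; exact: geom_sum_bounded. Qed.

Lemma tail_bounded_unit (x : C) r : normc x = 1 -> (2 <= r)%N ->
  tail_bounded (fun m => x ^+ m / m%:R ^+ r) (2 * 1).
Proof.
move=> x1 r2; apply: tail_bounded_sqr => // m m0.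
rewrite normcM normcV !normcX x1 expr1n normc_nat !mul1r.
by rewrite lef_pV2 ?posrE ?exprn_gt0 ?ltr0n // ler_weXn2l // ler1n.
Qed.

Definition harm A : R := \sum_(1 <= l < A) l%:R^-1.

(** Between [A] and [B] the double sum is cut at [l = A]. The indices [l < A] all meet the same tail
    of [e], which gives [harm A] times K/A; an index [l >= A] meets the tail from [l.+1], which
    gives the telescoping sum of K/(l(l+1)). *)
Lemma clim_nested e z K : tail_bounded e K ->
  (forall l, (0 < l)%N -> normc (z l) <= l%:R^-1) ->
  exists l, clim (fun M => \sum_(1 <= m < M) e m * \sum_(1 <= l < m) z l) l.
Proof.
move=> he hz; have K0 := tail_bounded_ge0 he.
apply: (@clim_cauchy _ _ (fun A => K * (harm A / A%:R + 1 / A%:R))); last first.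
  by apply: cvg_0MlD; [exact: harmonic_div_cvg|exact: cst_div_cvg].
move=> A B AB; rewrite sum_sub //; case/andP: AB => A0 AB.
have -> : \sum_(A <= m < B) e m * \sum_(1 <= l < m) z l =
   \sum_(1 <= l < A) z l * \sum_(A <= m < B) e m
   + \sum_(A <= l < B) z l * \sum_(l.+1 <= m < B) e m.
  rewrite -mulr_suml mulrC mulr_suml.
  have -> : \sum_(A <= l < B) z l * \sum_(l.+1 <= m < B) e m =
     \sum_(A <= m < B) e m * \sum_(A <= l < m) z l.
    under eq_bigr do rewrite mulr_sumr.
    under [RHS]eq_bigr do rewrite mulr_sumr.
    rewrite sum_nat_triangle; apply: eq_bigr => m _.
    by apply: eq_bigr => l _; rewrite mulrC.
  rewrite -big_split /=; apply: eq_big_nat => m /andP[Am mB].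
  by rewrite -mulrDr -big_cat_nat.
apply: le_trans (le_normcD _ _) _; rewrite mulrDr; apply: lerD.
  apply: le_trans (normc_sum _ _ _) _.
  rewrite mulrA mulrAC -[K / _ * _]mulrC mulr_suml.
  apply: ler_sum_nat => l /andP[l0 lA]; rewrite normcM.
  by apply: ler_pM => //; [exact: normc_ge0|exact: normc_ge0|exact: hz|exact: he].
apply: le_trans (normc_sum _ _ _) _.
apply: (@le_trans _ _ (\sum_(A <= l < B) K * (l%:R * l.+1%:R)^-1)).
  apply: ler_sum_nat => l /andP[Al lB]; rewrite normcM.
  rewrite invfM mulrCA.
  apply: ler_pM; [exact: normc_ge0|exact: normc_ge0| |exact: he].
  by apply: hz; exact: leq_trans Al.
by rewrite -mulr_sumr mul1r ler_wpM2l // sum_inv_mulS.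
Qed.

(** The square sum exceeds the triangular one by blocks of [e] from [M - l] to [M], each at most
    K/(M - l). Since 1/(l(M - l)) = (1/l + 1/(M - l))/M, the total is at most 2 K [harm M] / M. *)
Lemma clim_triangle e z K le lz : tail_bounded e K ->
  (forall l, (0 < l)%N -> normc (z l) <= l%:R^-1) ->
  clim (fun M => \sum_(1 <= m < M) e m) le ->
  clim (fun M => \sum_(1 <= l < M) z l) lz ->
  clim (fun M => \sum_(1 <= l < M) z l * \sum_(1 <= m < M - l) e m) (le * lz).
Proof.
move=> he hz cle clz; have K0 := tail_bounded_ge0 he.
have h0 : clim (fun M => \sum_(1 <= l < M) z l * \sum_(M - l <= m < M) e m) 0.
  apply: (@clim_le _ _ _ (fun M => K * (harm M / M%:R + harm M / M%:R))); last first.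
    by apply: cvg_0MlD; exact: harmonic_div_cvg.
  move=> M M0; rewrite subr0; apply: le_trans (normc_sum _ _ _) _.
  apply: (@le_trans _ _ (\sum_(1 <= l < M) l%:R^-1 * (K / (M - l)%:R))).
    apply: ler_sum_nat => l /andP[l0 lM]; rewrite normcM.
    apply: ler_pM; [exact: normc_ge0|exact: normc_ge0| exact: hz|apply: he].
    by rewrite subn_gt0.
  have -> : \sum_(1 <= l < M) l%:R^-1 * (K / (M - l)%:R) =
     \sum_(1 <= l < M) (K / M%:R * (l%:R^-1 + (M - l)%:R^-1)).
    apply: eq_big_nat => l /andP[l0 lM].
    have n0 : ((M - l)%N%:R : R) != 0 by rewrite pnatr_eq0 subn_eq0 -ltnNge.
    have l0' : (l%:R : R) != 0 by rewrite pnatr_eq0 -lt0n.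
    have s0 : ((M - l)%N%:R + l%:R : R) != 0 by rewrite -natrD pnatr_eq0; lia.
    have -> : (M%:R : R) = (M - l)%N%:R + l%:R by rewrite -natrD subnK // ltnW.
    by field; rewrite n0 l0' s0.
  rewrite -mulr_sumr big_split /=.
  have -> : \sum_(1 <= l < M) (M - l)%:R^-1 = harm M :> R.
    rewrite big_nat_rev /=; apply: eq_big_nat => l /andP[l0 lM].
    by congr (_%:R^-1); lia.
  by rewrite -/(harm M) -mulrA [M%:R^-1 * _]mulrC mulrDl.
have := climB (climM cle clz) h0; rewrite subr0.
apply: (@clim_near _ _ _ _ 1) => M M0.
rewrite mulr_sumr -sumrB; apply: eq_big_nat => l /andP[l0 lM].
rewrite mulrC -mulrBr; congr (_ * _).
rewrite (@big_cat_nat _ _ _ (M - l)%N 1 M) /= ?subn_gt0 ?leq_subr //.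
by rewrite addrK.
Qed.

End Tails.

(** * Partial fractions and the shuffle product of polylogarithms *)

Section PartialFractions.
Variable K : comNzRingType.

(** Meant for a = 1/m, b = 1/l, c = 1/(m + l), but stated without inverses. Replacing one factor ab
    by c(a + b) gives a recursion in [r] and [s] for the left side; the right side [F] obeys the
    same recursion by Pascal's rule. *)
Lemma partial_fraction (a b c : K) r s : a * b = c * (a + b) ->
  a ^+ r.+1 * b ^+ s.+1 =
  \sum_(i < (r + s).+1) c ^+ i.+1 *
    (b ^+ ((r + s).+1 - i) *+ 'C(i, r) + a ^+ ((r + s).+1 - i) *+ 'C(i, s)).
Proof.
move=> abc.
pose F r s (a b : K) := \sum_(i < (r + s).+1) c ^+ i.+1 *
    (b ^+ ((r + s).+1 - i) *+ 'C(i, r) + a ^+ ((r + s).+1 - i) *+ 'C(i, s)).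
have F0 s' (a' b' : K) : F 0%N s'.+1 a' b' = c * (F 0%N s' a' b' + b' ^+ s'.+2).
  rewrite /F big_ord_recl /= bin0 bin0n add0n mulr0n addr0 subn0 mulr1n expr1.
  rewrite mulrDr mulr_sumr addrC; congr (_ + _); apply: eq_bigr => i _.
  rewrite /bump leq0n add1n !bin0 subSS exprS -!mulrA binS (bin_small (ltn_ord i)).
  by rewrite add0n.
have FS r' s' (a' b' : K) :
    F r'.+1 s'.+1 a' b' = c * (F r'.+1 s' a' b' + F r' s'.+1 a' b').
  rewrite /F big_ord_recl /= !bin0n !mulr0n addr0 mulr0 add0r.
  rewrite addSn addnS mulrDr !mulr_sumr -big_split; apply: eq_bigr => i _ /=.
  rewrite /bump leq0n add1n subSS !binS !mulrnDr exprS; ring.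
have Fsym r' s' (a' b' : K) : F r' s' a' b' = F s' r' b' a'.
  by rewrite /F addnC; apply: eq_bigr => i _; rewrite addrC.
rewrite -/(F r s a b).
suff H n r' s' (a' b' : K) : (r' + s' <= n)%N -> a' * b' = c * (a' + b') ->
    a' ^+ r'.+1 * b' ^+ s'.+1 = F r' s' a' b' by apply: (H (r + s)%N).
elim: n r' s' a' b' => [|n IH] [|r'] [|s'] a' b' // le abc'.
- by rewrite /F big_ord1 /= !expr1 bin0 !mulr1n abc' addrC.
- by rewrite /F big_ord1 /= !expr1 bin0 !mulr1n abc' addrC.
- rewrite F0 -IH // expr1 [b' ^+ s'.+2]exprS mulrA abc' -mulrA mulrDl.
  by rewrite -exprS.
- rewrite Fsym F0 -IH ?add0n //; last 2 first.
  + by rewrite addn0 in le.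
  + by rewrite mulrC abc' addrC.
  rewrite expr1 [a' ^+ r'.+2]exprS mulrAC abc' -mulrA addrC mulrDl.
  by rewrite -exprS.
rewrite FS -!IH //; last by lia.
rewrite [a' ^+ r'.+2]exprS [b' ^+ s'.+2]exprS mulrACA abc' !exprS; ring.
Qed.

Lemma partial_fraction_nat (a b c : K) r s : (0 < r)%N -> (0 < s)%N ->
  a * b = c * (a + b) ->
  a ^+ r * b ^+ s =
  \sum_(1 <= i < r + s)
    (c ^+ i * b ^+ (r + s - i) *+ 'C(i - 1, r - 1)
     + c ^+ i * a ^+ (r + s - i) *+ 'C(i - 1, s - 1)).
Proof.
case: r s => [//|r] [//|s] _ _ abc.
rewrite (partial_fraction _ _ abc) addSn addnS big_add1 /= big_mkord.
by apply: eq_bigr => i _; rewrite mulrDr !mulrnAr !subSS !subn0.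
Qed.

End PartialFractions.

Section Polylogarithms.
Variable R : realType.
Local Notation C := R[i].
Implicit Types (x y : C).

Lemma climMn (u : nat -> C) l k : clim u l -> clim (fun M => u M *+ k) (l *+ k).
Proof. by move=> /(climMl k%:R); rewrite mulr_natl; under eq_fun do rewrite mulr_natl. Qed.

Lemma clim_sum_nat A B (F : nat -> nat -> C) (L : nat -> C) :
  (forall i, (A <= i < B)%N -> clim (F i) (L i)) ->
  clim (fun M => \sum_(A <= i < B) F i M) (\sum_(A <= i < B) L i).
Proof.
move=> FL; rewrite big_nat; under eq_fun do rewrite big_nat.
exact: clim_sum.
Qed.

Lemma csumP (F : nat -> C) :
  (exists l, clim (fun M => \sum_(1 <= m < M) F m) l) ->
  clim (fun M => \sum_(1 <= m < M) F m) (csum F).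
Proof. by case=> l Fl; rewrite /csum (clim_lim Fl). Qed.

Lemma csum_lim (F : nat -> C) l :
  clim (fun M => \sum_(1 <= m < M) F m) l -> csum F = l.
Proof. exact: clim_lim. Qed.

Lemma tail_bounded_unit_or x r : (0 < r)%N -> normc x = 1 -> (r == 1%N -> x != 1) ->
  exists K, tail_bounded (fun m => x ^+ m / m%:R ^+ r) K.
Proof.
case: r => [//|[|r]] _ x1 nx1; last by exists (2 * 1); exact: tail_bounded_unit.
exists (2 / normc (x - 1)).
by have := tail_bounded_geom x1 (nx1 isT); under eq_fun do rewrite -[_%:R]expr1.
Qed.

Lemma Li_clim x r : (0 < r)%N -> normc x = 1 -> (r == 1%N -> x != 1) ->
  clim (fun M => \sum_(1 <= m < M) x ^+ m / m%:R ^+ r) (Li r x).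
Proof.
move=> r0 x1 nx1; apply: csumP; have [K hK] := tail_bounded_unit_or r0 x1 nx1.
exact: tail_bounded_cvg hK.
Qed.

Lemma normc_unit_le x s l : (0 < s)%N -> (0 < l)%N -> normc x = 1 ->
  normc (x ^+ l / l%:R ^+ s) <= l%:R^-1.
Proof.
move=> s0 l0 x1; rewrite normcM normcV !normcX x1 expr1n normc_nat mul1r.
by rewrite lef_pV2 ?posrE ?exprn_gt0 ?ltr0n // -{1}[l%:R]expr1 ler_weXn2l // ler1n.
Qed.

Lemma Li2_clim x y r s : (0 < r)%N -> (0 < s)%N -> normc x = 1 -> normc y = 1 ->
  (r == 1%N -> x != 1) ->
  clim (fun M => \sum_(1 <= m < M) x ^+ m / m%:R ^+ r *
    \sum_(1 <= l < m) y ^+ l / l%:R ^+ s) (Li2 r s x y).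
Proof.
move=> r0 s0 x1 y1 nx1; apply: csumP; have [K hK] := tail_bounded_unit_or r0 x1 nx1.
by apply: clim_nested hK _ => l l0; exact: normc_unit_le.
Qed.

Lemma sum_nat_diag (V : zmodType) (F : nat -> nat -> V) M :
  \sum_(1 <= l < M) \sum_(1 <= m < M - l) F m l =
  \sum_(1 <= p < M) \sum_(1 <= l < p) F (p - l)%N l.
Proof.
rewrite -sum_nat_triangle; apply: eq_big_nat => l /andP[l0 lM].
rewrite -[l.+1]addn1 addnC big_addn.
by apply: eq_big_nat => m _; rewrite addnK.
Qed.

(** The product is the limit of sums over m + l < M. With p = m + l, partial fractions leave the
    denominators p and l, or p and m, and x^m y^l is rewritten accordingly as x^p (y/x)^l or y^p
    (x/y)^m. *)
Lemma Li_shuffle x y r s : (0 < r)%N -> (0 < s)%N -> normc x = 1 -> normc y = 1 ->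
  (r == 1%N -> x != 1) -> (s == 1%N -> y != 1) ->
  Li r x * Li s y =
  \sum_(1 <= i < r + s)
    (Li2 i (r + s - i) x (y / x) *+ 'C(i - 1, r - 1)
     + Li2 i (r + s - i) y (x / y) *+ 'C(i - 1, s - 1)).
Proof.
move=> r0 s0 x1 y1 nx1 ny1; have [K hK] := tail_bounded_unit_or r0 x1 nx1.
have n0 (z : C) : normc z = 1 -> z != 0.
  by move=> z1; apply/eqP => z0; move: z1; rewrite z0 normc0 => /esym/eqP; rewrite oner_eq0.
have nd (z w : C) : normc z = 1 -> normc w = 1 -> normc (z / w) = 1.
  by move=> z1 w1; rewrite normcM normcV z1 w1 invr1 mulr1.
apply: clim_unique.
  apply: clim_triangle hK _ (Li_clim r0 x1 nx1) (Li_clim s0 y1 ny1).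
  by move=> l l0; exact: normc_unit_le.
have binlim (z w : C) i t : normc z = 1 -> normc w = 1 -> (0 < t)%N -> (t == 1%N -> z != 1) ->
   (1 <= i < r + s)%N -> 
   clim (fun M => (\sum_(1 <= m < M) z ^+ m / m%:R ^+ i *
    \sum_(1 <= l < m) (w / z) ^+ l / l%:R ^+ (r + s - i)) *+ 'C(i - 1, t - 1))
   (Li2 i (r + s - i) z (w / z) *+ 'C(i - 1, t - 1)).
  (* The possibly divergent [Li2] with [i = 1] and [z = 1] is harmless: for [i < t] the binomial
     coefficient is 0, and otherwise [i = 1] forces [t = 1], where [z != 1] is assumed. *)
  move=> z1 w1 t0 nz1 /andP[i0 irs]; case: (ltnP i t) => it.
    rewrite bin_small ?mulr0n; last by rewrite ltn_sub2r // (leq_ltn_trans i0).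
    by under eq_fun do rewrite mulr0n; exact: clim_cst.
  apply: climMn; apply: Li2_clim; rewrite ?subn_gt0 ?nd // => /eqP i1.
  by apply: nz1; rewrite eqn_leq t0 andbT -i1.
have := clim_sum_nat (fun i hi => climD (binlim x y i r x1 y1 r0 nx1 hi)
                                        (binlim y x i s y1 x1 s0 ny1 hi)).
apply: (@clim_near _ _ _ _ 0) => M _.
under [RHS]eq_bigr do rewrite mulr_sumr.
rewrite sum_nat_diag.
transitivity (\sum_(1 <= p < M) \sum_(1 <= l < p) \sum_(1 <= i < r + s)
  (x ^+ p / p%:R ^+ i * ((y / x) ^+ l / l%:R ^+ (r + s - i)) *+ 'C(i - 1, r - 1) +
   y ^+ p / p%:R ^+ i * ((x / y) ^+ (p - l)
      / (p - l)%:R ^+ (r + s - i)) *+ 'C(i - 1, s - 1))).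
  under eq_bigr do rewrite -!sumrMnl -big_split /=.
  rewrite exchange_big_nat /=; apply: eq_bigr => p _.
  rewrite [RHS]exchange_big_nat /=; apply: eq_bigr => i _.
  rewrite !mulr_sumr -!sumrMnl big_split /=; congr (_ + _).
  rewrite big_nat_rev /=; apply: eq_big_nat => l /andP[l0 lp].
  by rewrite add1n subSS.
apply: eq_big_nat => p /andP[p0 pM]; apply: eq_big_nat => l /andP[l0 lp].
have x0 := n0 _ x1; have y0 := n0 _ y1.
have nz k : (0 < k)%N -> (k%:R : C) != 0 by rewrite lt0n => k0; rewrite pnatr_eq0.
have pl : (p%:R : C) = (p - l)%:R + l%:R by rewrite -natrD subnK // ltnW.
have pl0 : ((p - l)%:R : C) != 0 by rewrite nz // subn_gt0.
have frac : ((p - l)%:R)^-1 * (l%:R)^-1 = (p%:R)^-1 * ((p - l)%:R^-1 + (l%:R)^-1) :> C.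
  have := nz p p0; have := nz l l0; rewrite pl => l0' p0'.
  by field; rewrite pl0 l0' p0'.
have ppl : p = ((p - l) + l)%N by rewrite subnK // ltnW.
transitivity (x ^+ (p - l) * y ^+ l * ((p - l)%:R^-1 ^+ r * l%:R^-1 ^+ s)); last first.
  by rewrite !exprVn mulrACA [RHS]mulrC.
rewrite (partial_fraction_nat r0 s0 frac) mulr_sumr; apply: eq_bigr => i _.
rewrite mulrDr !mulrnAr !exprVn; congr (_ *+ _ + _ *+ _).
  rewrite {1}ppl exprD expr_div_n.
  rewrite mulrACA; congr (_ * _).
  by move: (x ^+ l) (expf_neq0 l x0) => xl xl0; field.
rewrite {1}ppl exprD expr_div_n.
rewrite mulrACA; congr (_ * _).
by move: (y ^+ (p - l)) (expf_neq0 (p - l) y0) => yl yl0; field.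
Qed.

End Polylogarithms.

(** * The exponential on the imaginary axis *)

Section ComplexExponential.
Variable R : realType.
Local Notation C := R[i].
Implicit Types (t : R).

Definition cexp t : C := cos t +i* sin t.

Lemma cexp0 : cexp 0 = 1.
Proof. by rewrite /cexp cos0 sin0. Qed.

Lemma cexpD t u : cexp (t + u) = cexp t * cexp u.
Proof.
rewrite /cexp cosD sinD; apply/eqP; rewrite eq_complex /= eqxx /=.
by rewrite addrC [X in _ == X]addrC [cos t * sin u + _]addrC eqxx.
Qed.

Lemma cexpMn t k : cexp t ^+ k = cexp (t *+ k).
Proof.
elim: k => [|k IH]; first by rewrite mulr0n cexp0.
by rewrite exprS IH -cexpD mulrS.
Qed.

Lemma normc_cexp t : normc (cexp t) = 1.
Proof. by rewrite /= cos2Dsin2 sqrtr1. Qed.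

Lemma cexp_2pi : cexp (2 * pi) = 1.
Proof. by rewrite mulr2n mulrDl mul1r cexpD /cexp cospi sinpi /=; simpc. Qed.

Lemma cexp_neq1 t : 0 < t < 2 * pi -> cexp t != 1.
Proof.
move=> /andP[t0 t2]; apply/eqP => /(congr1 (@complex.Re R)) /=.
have -> : t = t / 2 + t / 2 by field.
rewrite cosD -!expr2 cos2sin2 => /eqP.
have : 0 < sin (t / 2) by apply: sin_gt0_pi; apply/andP; split; lra.
by move=> /(exprn_gt0 2) h /eqP; lra.
Qed.

End ComplexExponential.

(** * Double shuffle relations for the constant terms *)

Section RootsOfUnity.
Variables (R : realType) (n : nat).
Local Notation C := R[i].
Local Notation N := n.+1.
Local Notation eta := (Defs.eta R n).

Lemma eta_cexp k : eta ^+ k = cexp (2 * pi * k%:R / N%:R) :> C.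
Proof. by rewrite -[eta]/(cexp _) cexpMn -[in RHS]mulr_natr; congr cexp; ring. Qed.

Lemma normc_etaX k : normc (eta ^+ k) = 1.
Proof. by rewrite eta_cexp normc_cexp. Qed.

Lemma eta_prim : N.-primitive_root eta.
Proof.
have pi0 := pi_gt0 R.
apply/andP; split=> //; apply/forallP => i; apply/eqP.
rewrite unity_rootE eta_cexp; have [iN|] := eqVneq i.+1 N.
  by rewrite iN mulfK ?pnatr_eq0 // cexp_2pi eqxx.
move=> iN; have {iN} iN : (i.+1 < N)%N by rewrite ltn_neqAle iN ltn_ord.
apply/negbTE/cexp_neq1; apply/andP; split.
  by rewrite !mulr_gt0 ?invr_gt0 ?ltr0n.
rewrite ltr_pdivrMr ?ltr0n // ltr_pM2l ?ltr_nat //.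
by rewrite mulr_gt0.
Qed.

Lemma eta_neq0 k : eta ^+ k != 0 :> C.
Proof.
apply/eqP => h; have := normc_etaX k; rewrite h normc0 => /esym/eqP.
by rewrite oner_eq0.
Qed.

Lemma eta_eq i j : (eta ^+ i == eta ^+ j :> C) = (i == j %[mod N]).
Proof. exact: eq_prim_root_expr eta_prim i j. Qed.

Lemma eta_mod k : eta ^+ (k %% N) = eta ^+ k :> C.
Proof. exact: prim_expr_mod eta_prim k. Qed.

Lemma eta_eq1 k : (eta ^+ k == 1 :> C) = (N %| k)%N.
Proof. by rewrite (prim_order_dvd eta_prim). Qed.

Lemma etaXN : eta ^+ N = 1 :> C.
Proof. exact: prim_expr_order eta_prim. Qed.

Lemma eta_addZ (a b : 'I_N) k : eta ^+ ((a + b)%R * k) = eta ^+ (a * k) * eta ^+ (b * k) :> C.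
Proof. by rewrite exprM eta_mod exprD exprMn -!exprM. Qed.

Lemma eta_subZ (a b : 'I_N) k : eta ^+ ((a - b)%R * k) = eta ^+ (a * k) / eta ^+ (b * k) :> C.
Proof. by have := eta_addZ (a - b) b k; rewrite subrK => ->; rewrite mulfK // eta_neq0. Qed.

Lemma eta_oppZ (a : 'I_N) k : eta ^+ ((- a)%R * k) = (eta ^+ (a * k))^-1 :> C.
Proof. by rewrite -sub0r eta_subZ mul0n expr0 mul1r. Qed.

Lemma sum_unity (z : C) : z ^+ N = 1 ->
  \sum_(1 <= k < N.+1) z ^+ k = N%:R *+ (z == 1).
Proof.
move=> zN; have [->|z1] := eqVneq z 1.
  rewrite mulr1n; under eq_bigr do rewrite expr1n.
  by rewrite sumr_const_nat subSS subn0.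
rewrite mulr0n; apply/eqP; rewrite -(mulIr_eq0 _ (mulIf (_ : z - 1 != 0))) ?subr_eq0 //.
rewrite mulr_suml.
under eq_bigr do rewrite mulrBr mulr1 -exprSr.
by rewrite telescope_sumr // exprSr zN mul1r expr1 subrr.
Qed.

Lemma sum_eta (a m : nat) :
  \sum_(1 <= k < N.+1) (eta ^+ (a * k))^-1 * eta ^+ k ^+ m =
  N%:R *+ (m == a %[mod N]) :> C.
Proof.
pose z := eta ^+ m / eta ^+ a.
have zN : z ^+ N = 1.
  by rewrite expr_div_n -!exprM !(mulnC _ N) !exprM etaXN !expr1n divr1.
have -> : (m == a %[mod N]) = (z == 1).
  by rewrite -eta_eq -[RHS](inj_eq (mulIf (eta_neq0 a))) mul1r divfK ?eta_neq0.
rewrite -sum_unity //; apply: eq_bigr => k _.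
by rewrite expr_div_n -!exprM mulrC ![(_ * k)%N]mulnC.
Qed.

End RootsOfUnity.

Section Constants.
Variables (R : realType) (n : nat).
Local Notation C := R[i].
Local Notation N := n.+1.
Local Notation eta := (Defs.eta R n).
Implicit Types (a b : 'I_N) (sharp : regularization).

Local Opaque csum Li Li2 zetaN zetaN2.

Let N0 : (N%:R : C) != 0. Proof. by rewrite pnatr_eq0. Qed.

Lemma indicatorE (a m : nat) : (m == a %[mod N])%:R =
  N%:R^-1 * \sum_(1 <= k < N.+1) (eta ^+ (a * k))^-1 * eta ^+ k ^+ m :> C.
Proof. by rewrite sum_eta mulrnAr mulVf. Qed.

Lemma zetaN_Li a r : (1 < r)%N ->
  clim (fun M => \sum_(1 <= m < M) (m == a %[mod N])%:R / m%:R ^+ r)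
    (N%:R^-1 * \sum_(1 <= k < N.+1) (eta ^+ (a * k))^-1 * Li r (eta ^+ k)).
Proof.
move=> r1; have h k : clim (fun M => (eta ^+ (a * k))^-1 *
    \sum_(1 <= m < M) eta ^+ k ^+ m / m%:R ^+ r)
    ((eta ^+ (a * k))^-1 * Li r (eta ^+ k)).
  apply/climMl/Li_clim; [exact: ltnW|exact: normc_etaX|].
  by move=> /eqP r1'; rewrite r1' in r1.
have := climMl N%:R^-1 (clim_sum_nat (fun k (_ : (1 <= k < N.+1)%N) => h k)).
apply: (@clim_near _ _ _ _ 0) => M _.
under eq_bigr do rewrite mulr_sumr.
rewrite exchange_big_nat /= mulr_sumr; apply: eq_bigr => m _.
rewrite indicatorE mulrAC -mulrA; congr (_ * _); rewrite mulrC mulr_suml.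
by apply: eq_bigr => k _; rewrite mulrA.
Qed.

Lemma zetaN_clim a r : (1 < r)%N ->
  clim (fun M => \sum_(1 <= m < M) (m == a %[mod N])%:R / m%:R ^+ r) (zetaN R a r).
Proof. by move=> r1; apply: csumP; eexists; exact: zetaN_Li r1. Qed.

Lemma normc_bool (c : bool) : normc (c%:R : C) <= 1.
Proof. by case: c; rewrite ?normc1 ?normc0. Qed.

Lemma zetaN2_clim a b r s : (1 < r)%N -> (0 < s)%N ->
  clim (fun M => \sum_(1 <= m < M) (m == a %[mod N])%:R / m%:R ^+ r *
    \sum_(1 <= l < m | (l == b %[mod N])%N) (l%:R ^+ s)^-1) (zetaN2 R a b r s).
Proof.
move=> r1 s0; apply: csumP.
have tb : tail_bounded (fun m => (m == a %[mod N])%:R / m%:R ^+ r : C) (2 * 1).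
  apply: tail_bounded_sqr => // m m0; rewrite normcM normcV normcX normc_nat.
  apply: ler_pM; rewrite ?normc_bool ?normc_ge0 ?invr_ge0 ?exprn_ge0 ?normc_ge0 //.
    by case: (_ == _).
  rewrite normc_nat.
  by rewrite lef_pV2 ?posrE ?exprn_gt0 ?ltr0n // ler_weXn2l // ler1n.
have hz l : (0 < l)%N ->
    normc (if (l == b %[mod N])%N then (l%:R ^+ s)^-1 else 0 : C) <= l%:R^-1.
  move=> l0; case: ifP => _; last by rewrite normc0 invr_ge0.
  have := @normc_unit_le R 1 s l s0 l0; rewrite expr1n mul1r; apply.
  exact: normc1.
have [l hl] := clim_nested tb hz; exists l; move: hl.
apply: (@clim_near _ _ _ _ 0) => M _; apply: eq_bigr => m _.
by rewrite -big_mkcond.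
Qed.

Lemma fourier_exchange (K : comNzRingType) (c : K) (e f : nat -> nat -> K)
    (g : nat -> nat -> nat -> K) A M :
  c * (\sum_(1 <= k < A) \sum_(1 <= l < A) e k l *
    \sum_(1 <= m < M) f k m * \sum_(1 <= j < m) g k l j) =
  \sum_(1 <= m < M) \sum_(1 <= j < m) c *
    \sum_(1 <= k < A) \sum_(1 <= l < A) e k l * (f k m * g k l j).
Proof.
under [RHS]eq_bigr do rewrite -mulr_sumr.
rewrite -mulr_sumr; congr (_ * _).
under [RHS]eq_bigr do rewrite exchange_big_nat /=.
rewrite [RHS]exchange_big_nat /=; apply: eq_bigr => k _.
under [RHS]eq_bigr do rewrite exchange_big_nat /=.
rewrite [RHS]exchange_big_nat /=; apply: eq_bigr => l _.
by rewrite mulr_sumr; apply: eq_bigr => m _; rewrite !mulr_sumr.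
Qed.

Lemma sum_swap_scale (K : comNzRingType) (V : lmodType K) (e e' : nat -> nat -> K)
    (F : nat -> nat -> V) A c d : (forall k l, e' k l = e l k) ->
  \sum_(1 <= k < A) \sum_(1 <= l < A) e k l *: (F k l *+ c + F l k *+ d) =
  (\sum_(1 <= k < A) \sum_(1 <= l < A) e k l *: F k l) *+ c +
  (\sum_(1 <= k < A) \sum_(1 <= l < A) e' k l *: F k l) *+ d.
Proof.
move=> ee; rewrite [X in _ = _ + X *+ d]exchange_big_nat /= -!sumrMnl -big_split /=.
apply: eq_bigr => k _; rewrite -!sumrMnl -big_split /=; apply: eq_bigr => l _.
by rewrite ee scalerDr !scalerMnr.
Qed.

(** The characters combine to eta^(k(m - j)) eta^(l j). Hence the sum over [l] selects j = b modulo
    N, and the sum over [k] selects m - j = a - b. *)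
Lemma zetaN2_Li a b r s : (1 < r)%N -> (0 < s)%N ->
  zetaN2 R a b r s = (N%:R ^+ 2)^-1 *
    \sum_(1 <= k < N.+1) \sum_(1 <= l < N.+1)
      (eta ^+ (k * (a - b)%R + l * b))^-1 * Li2 r s (eta ^+ k) (eta ^+ l / eta ^+ k).
Proof.
move=> r1 s0; apply: clim_unique; first exact: zetaN2_clim.
have nd k l : normc (eta ^+ l / eta ^+ k) = 1.
  by rewrite normcM normcV !normc_etaX invr1 mulr1.
have h k l := climMl (eta ^+ (k * (a - b)%R + l * b))^-1
   (@Li2_clim R (eta ^+ k) (eta ^+ l / eta ^+ k) r s (ltnW r1) s0 (normc_etaX _ _ _) (nd k l)
      (fun e => False_ind _ (elimF eqP (gtn_eqF r1) (elimT eqP e)))).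
have := climMl (N%:R ^+ 2)^-1 (clim_sum_nat (fun k (_ : (1 <= k < N.+1)%N) =>
  clim_sum_nat (fun l (_ : (1 <= l < N.+1)%N) => h k l))).
apply: (@clim_near _ _ _ _ 0) => M _.
rewrite fourier_exchange; apply: eq_bigr => m _.
rewrite [X in _ = _ * X]big_mkcond mulr_sumr; apply: eq_bigr => j _.
have -> : (if (j == b %[mod N])%N then j%:R ^- s else 0) =
   (j == b %[mod N])%N%:R / j%:R ^+ s :> C by case: ifP; rewrite ?mul1r ?mul0r.
have Nsum (m' a' : nat) : \sum_(1 <= k < N.+1) (eta ^+ (a' * k))^-1 * eta ^+ k ^+ m' =
  N%:R * (m' == a' %[mod N])%:R :> C by rewrite sum_eta mulr_natr.
transitivity ((N%:R ^+ 2)^-1 * ((m%:R ^+ r)^-1 * (j%:R ^+ s)^-1) *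
   ((\sum_(1 <= k < N.+1) (eta ^+ m / eta ^+ j / (eta ^+ a / eta ^+ b)) ^+ k) *
    \sum_(1 <= l < N.+1) (eta ^+ (b * l))^-1 * eta ^+ l ^+ j)).
  rewrite -mulrA; congr (_ * _); rewrite mulr_suml mulr_sumr; apply: eq_bigr => k _.
  rewrite mulr_sumr mulr_sumr; apply: eq_bigr => l _.
  rewrite exprD invfM [(k * _)%N]mulnC eta_subZ !expr_div_n -!exprM.
  rewrite ![(k * _)%N]mulnC ![(l * _)%N]mulnC.
  move: (eta_neq0 R n (a * k)) (eta_neq0 R n (b * k)) (eta_neq0 R n (b * l))
    (eta_neq0 R n (j * k)).
  move: (eta ^+ (a * k)) (eta ^+ (b * k)) (eta ^+ (b * l)) (eta ^+ (j * k)).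
  move: (eta ^+ (m * k)) (eta ^+ (j * l)) (m%:R ^- r) (j%:R ^- s).
  move=> x1 x2 x3 x4 y1 y2 y3 y4 h1 h2 h3 h4; field.
  by rewrite h1 h2 h3 h4.
rewrite Nsum sum_unity; last first.
  by rewrite !expr_div_n -!exprM !(mulnC _ N) !exprM etaXN !expr1n !divr1.
case: (eqVneq (j %% N)%N (b %% N)%N) => jb; last by rewrite !(mulr0, mul0r).
have <- : eta ^+ j = eta ^+ b by apply/eqP; rewrite eta_eq jb.
have -> : (eta ^+ m / eta ^+ j / (eta ^+ a / eta ^+ j) == 1) = (m == a %[mod N])%N.
  rewrite -(eta_eq R) invf_div mulrA divfK ?eta_neq0 //.
  by rewrite -[LHS](inj_eq (mulIf (eta_neq0 R n a))) mul1r divfK ?eta_neq0.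
rewrite -[N%:R *+ _]mulr_natr mul1r mulr1.
move: (N%:R : C) (m%:R ^- r) (j%:R ^- s) N0 => x y z x0; move: (_ == _)%:R => t.
by field.
Qed.

(* Regularized [Li_r(eta^k)], and [Li_{r,s}(eta^k, eta^(l - k))]. *)
Definition Lreg r (k : nat) : {poly C} :=
  if (r == 1%N) && (N %| k)%N then 'X else (Li r (eta ^+ k))%:P.

Definition Lreg2 r s (k l : nat) : {poly C} :=
  if r == 1%N then Li_sh R n s k l
  else (Li2 r s (eta ^+ k) (eta ^+ l / eta ^+ k))%:P.

Lemma zeta_regE sharp a r : (0 < r)%N -> zeta_reg R sharp a r =
  N%:R^-1 *: \sum_(1 <= k < N.+1) (eta ^+ (a * k))^-1 *: Lreg r k.
Proof.
move=> r0; rewrite /zeta_reg /Lreg; case: eqVneq => [->|r1] /=.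
  rewrite [in RHS]big_nat_recr //= dvdnn [(a * _)%N]mulnC exprM etaXN expr1n invr1 scale1r addrC.
  congr (_ *: (_ + _)); rewrite rmorph_sum /=; apply: eq_big_nat => k /andP[k0 kN].
  by rewrite gtnNdvd // polyCM mul_polyC.
have {r0 r1} r1 : (1 < r)%N by rewrite ltn_neqAle eq_sym r1.
rewrite [zetaN R a r](clim_unique (zetaN_clim a r1) (zetaN_Li a r1)).
rewrite polyCM mul_polyC rmorph_sum /=; congr (_ *: _); apply: eq_bigr => k _.
by rewrite polyCM mul_polyC.
Qed.

Lemma zeta_reg2E a b r s : (0 < r)%N -> (0 < s)%N -> zeta_reg2 R Sh a b r s =
  (N%:R ^+ 2)^-1 *: \sum_(1 <= k < N.+1) \sum_(1 <= l < N.+1)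
    (eta ^+ (k * (a - b)%R + l * b))^-1 *: Lreg2 r s k l.
Proof.
move=> r0 s0; rewrite /zeta_reg2 /Lreg2; case: eqVneq => [//|r1] /=.
rewrite zetaN2_Li //; last by rewrite ltn_neqAle eq_sym r1.
rewrite polyCM mul_polyC rmorph_sum /=; congr (_ *: _); apply: eq_bigr => k _.
rewrite rmorph_sum /=; apply: eq_bigr => l _.
by rewrite polyCM mul_polyC.
Qed.

Lemma eta_neq1 k : ~~ (N %| k)%N -> eta ^+ k != 1.
Proof. by rewrite eta_eq1. Qed.

Lemma Lreg_shuffle_regular r s (k l : nat) : (0 < r)%N -> (0 < s)%N ->
  ~~ ((r == 1%N) && (N %| k)%N) -> ~~ ((s == 1%N) && (N %| l)%N) ->
  Lreg r k * Lreg s l = \sum_(1 <= i < r + s)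
    (Lreg2 i (r + s - i) k l *+ 'C(i - 1, r - 1)
     + Lreg2 i (r + s - i) l k *+ 'C(i - 1, s - 1)).
Proof.
move=> r0 s0 rk sl; rewrite /Lreg (negbTE rk) (negbTE sl) -polyCM.
rewrite Li_shuffle ?normc_etaX //; last 2 first.
- by move=> r1; move: rk; rewrite r1 /= => /eta_neq1.
- by move=> s1; move: sl; rewrite s1 /= => /eta_neq1.
rewrite rmorph_sum /=; apply: eq_big_nat => i /andP[i0 irs].
rewrite polyCD.
have aux r' (k' l' : nat) : (0 < r')%N -> ~~ ((r' == 1%N) && (N %| k')%N) ->
  (Li2 i (r + s - i) (eta ^+ k') (eta ^+ l' / eta ^+ k'))%:P *+ 'C(i - 1, r' - 1) =
  Lreg2 i (r + s - i) k' l' *+ 'C(i - 1, r' - 1).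
  (* Only [i = 1] needs an argument. If [r' = 1], then [k'] is not divisible by [N] and [Li_sh] is
     the convergent [Li2]; if [r' > 1], the binomial coefficient is 0. *)
  move=> r0' h; rewrite /Lreg2; case: eqVneq => // i1.
  case: (eqVneq r' 1%N) h => [-> /= h|r1 _].
    by rewrite /Li_sh h i1.
  by rewrite bin_small ?mulr0n // i1; lia.
by congr (_ + _); rewrite polyCMn; apply: aux.
Qed.

Lemma sum_bin_singular (V : zmodType) (f g : nat -> V) s : (0 < s)%N ->
  \sum_(1 <= i < 1 + s) (f i *+ 'C(i - 1, 1 - 1) + g i *+ 'C(i - 1, s - 1)) =
  f 1%N + \sum_(2 <= i < 1 + s) f i + g s.
Proof.
move=> s0; rewrite big_split /=; congr (_ + _).
  under eq_bigr do rewrite bin0 mulr1n.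
  by rewrite big_ltn //; lia.
rewrite add1n big_nat_recr //= binn mulr1n big_nat_cond big1 ?add0r // => i.
by move=> /andP[/andP[i0 is_] _]; rewrite bin_small ?mulr0n //; lia.
Qed.

(** The value of [Li_sh] at [alpha] divisible by [N] is this identity solved for its term with i =
    1. *)
Lemma Lreg_shuffle_singular s (k l : nat) : (0 < s)%N -> (N %| k)%N ->
  ~~ ((s == 1%N) && (N %| l)%N) ->
  Lreg 1 k * Lreg s l = \sum_(1 <= i < 1 + s)
    (Lreg2 i (1 + s - i) k l *+ 'C(i - 1, 1 - 1)
     + Lreg2 i (1 + s - i) l k *+ 'C(i - 1, s - 1)).
Proof.
move=> s0 Nk sl; have k1 : eta ^+ k = 1 by apply/eqP; rewrite eta_eq1.
rewrite (@sum_bin_singular _ (fun i => Lreg2 i (1 + s - i) k l)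
  (fun i => Lreg2 i (1 + s - i) l k) s s0) addnK.
rewrite /Lreg Nk (negbTE sl) /= {1}/Lreg2 /= addKn {1}/Li_sh Nk /= (negbTE sl).
have L2 i : (1 < i)%N -> Lreg2 i (1 + s - i) k l =
    (Li2 i (1 + s - i) (eta ^+ k) (eta ^+ l / eta ^+ k))%:P.
  by move=> i1; rewrite /Lreg2 gtn_eqF.
have -> : \sum_(2 <= i < 1 + s) Lreg2 i (1 + s - i) k l =
   (\sum_(2 <= t < s.+1) Li2 t (s.+1 - t) 1 (eta ^+ l))%:P.
  rewrite rmorph_sum /=; apply: eq_big_nat => i /andP[i0 _].
  by rewrite (L2 _ i0) k1 divr1.
have -> : Lreg2 s 1 l k =
   (Li2 s 1 (eta ^+ l) (eta ^- l))%:P.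
  case: (eqVneq s 1%N) sl => [-> /= h|s1 _]; rewrite /Lreg2 ?(negbTE s1) /=.
    by rewrite /Li_sh h k1 div1r.
  by rewrite k1 div1r.
by rewrite mulrC mul_polyC [_ - _ + (\sum_(_ <= _ < _) _)%:P]addrAC !subrK.
Qed.

Lemma Lreg_shuffle r s (k l : nat) : (0 < r)%N -> (0 < s)%N ->
  Lreg r k * Lreg s l = \sum_(1 <= i < r + s)
    (Lreg2 i (r + s - i) k l *+ 'C(i - 1, r - 1)
     + Lreg2 i (r + s - i) l k *+ 'C(i - 1, s - 1)).
Proof.
move=> r0 s0; case: (boolP ((r == 1%N) && (N %| k)%N)) => [/andP[/eqP-> Nk]|rk].
  case: (boolP ((s == 1%N) && (N %| l)%N)) => [/andP[/eqP-> Nl]|sl].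
    have e k' l' : (N %| k')%N -> (N %| l')%N -> Lreg2 1 (1 + 1 - 1) k' l' = 2^-1 *: 'X^2.
      by move=> Nk' Nl'; rewrite /Lreg2 /Li_sh Nk' Nl'.
    rewrite /Lreg Nk Nl big_nat1 /= !e // bin0 mulr1n -mulr2n scalerMnl.
    by rewrite -[_ *+ 2]mulr_natr mulVf ?pnatr_eq0 // scale1r.
  exact: Lreg_shuffle_singular.
case: (boolP ((s == 1%N) && (N %| l)%N)) => [/andP[/eqP-> Nl]|sl].
  rewrite mulrC Lreg_shuffle_singular // [(r + 1)%N]addnC.
  by apply: eq_bigr => i _; exact: addrC.
exact: Lreg_shuffle_regular.
Qed.

(** The class [a + b] in the first place appears because the Fourier kernel of [zeta_reg2] at the
    classes (a + b, b) is eta^-(k a + l b), the kernel of the product. Exchanging [k] and [l] gives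
    the kernel at (a + b, a), which accounts for the second family of terms. *)
Lemma zeta_reg_shuffle sharp a b r s : (0 < r)%N -> (0 < s)%N ->
  zeta_reg R sharp a r * zeta_reg R sharp b s = \sum_(1 <= i < r + s)
    (zeta_reg2 R Sh (a + b) b i (r + s - i) *+ 'C(i - 1, r - 1)
     + zeta_reg2 R Sh (a + b) a i (r + s - i) *+ 'C(i - 1, s - 1)).
Proof.
move=> r0 s0; rewrite !zeta_regE // -scalerAl -scalerAr scalerA -invfM -expr2.
have h i (a' b' : 'I_N) : (1 <= i < r + s)%N -> zeta_reg2 R Sh (a' + b') b' i (r + s - i) =
  (N%:R ^+ 2)^-1 *: \sum_(1 <= k < N.+1) \sum_(1 <= l < N.+1)
    (eta ^+ (k * a' + l * b'))^-1 *: Lreg2 i (r + s - i) k l.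
  by case/andP=> i0 irs; rewrite zeta_reg2E ?subn_gt0 // addrK.
transitivity ((N%:R ^+ 2)^-1 *: \sum_(1 <= i < r + s)
    \sum_(1 <= k < N.+1) \sum_(1 <= l < N.+1) (eta ^+ (k * a + l * b))^-1 *:
      (Lreg2 i (r + s - i) k l *+ 'C(i - 1, r - 1)
     + Lreg2 i (r + s - i) l k *+ 'C(i - 1, s - 1))).
  congr (_ *: _); rewrite exchange_big_nat /= mulr_suml; apply: eq_bigr => k _.
  rewrite exchange_big_nat /= mulr_sumr; apply: eq_bigr => l _.
  rewrite -scalerAl -scalerAr scalerA Lreg_shuffle // -scaler_sumr; congr (_ *: _).
  by rewrite exprD invfM ![(k * _)%N]mulnC ![(l * _)%N]mulnC.
rewrite scaler_sumr; apply: eq_big_nat => i hi; rewrite h // [a + b]addrC h //.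
rewrite ![(_ *: _) *+ _]scalerMnr -scalerDr; congr (_ *: _).
by apply: sum_swap_scale => k l; rewrite addnC.
Qed.

Lemma zetaN_stuffle a b r s : (1 < r)%N -> (1 < s)%N ->
  zetaN R a r * zetaN R b s =
  zetaN2 R a b r s + zetaN2 R b a s r + zetaN R a (r + s) *+ (a == b).
Proof.
move=> r1 s1; apply: clim_unique; first exact: climM (zetaN_clim a r1) (zetaN_clim b s1).
have rs1 : (1 < r + s)%N by rewrite (leq_trans r1) // leq_addr.
have := climD (climD (zetaN2_clim a b r1 (ltnW s1)) (zetaN2_clim b a s1 (ltnW r1)))
  (climMn (a == b) (zetaN_clim a rs1)).
apply: (@clim_near _ _ _ _ 0) => M _.
elim: M => [|[|M] IH]; [by rewrite !big_geq // !add0r mul0r mul0rn|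
   by rewrite !big_geq // !add0r mul0r mul0rn|].
rewrite !(@big_nat_recr _ _ _ M.+1 1) //=.
rewrite mulrDl !mulrDr -IH mulrnDl.
have cond (c : 'I_N) t : \sum_(1 <= l < M.+1 | (l == c %[mod N])%N) (l%:R ^+ t)^-1 =
   \sum_(1 <= l < M.+1) (l == c %[mod N])%:R / l%:R ^+ t :> C.
  by rewrite big_mkcond /=; apply: eq_bigr => l _; case: ifP; rewrite ?mul1r ?mul0r.
rewrite !cond.
have -> : (M.+1 == a %[mod N])%:R / M.+1%:R ^+ (r + s) *+ (a == b) =
  (M.+1 == a %[mod N])%:R / M.+1%:R ^+ r * ((M.+1 == b %[mod N])%:R / M.+1%:R ^+ s) :> C.
  rewrite mulrACA -invfM -exprD -mulrnAl; congr (_ / _).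
  rewrite -natrM mulnb -[in LHS]mulr_natr -natrM mulnb; congr (_%:R).
  case: (eqVneq (M.+1 %% N)%N (a %% N)%N) => //= ->.
  by rewrite !modn_small ?ltn_ord.
ring.
Qed.

(** If one index is 1, this is the definition of [zeta_reg2] at [Ast] rearranged; otherwise all the
    series converge and [zetaN_stuffle] applies. *)
Lemma zeta_reg_stuffle sharp a b r s : (0 < r)%N -> (0 < s)%N -> (r, s) <> (1, 1)%N ->
  zeta_reg R sharp a r * zeta_reg R sharp b s =
  zeta_reg2 R Ast a b r s + zeta_reg2 R Ast b a s r
  + zeta_reg R sharp a (r + s) *+ (a == b).
Proof.
move=> r0 s0 rs; rewrite /zeta_reg2 /zeta_reg.
have -> : (r + s == 1)%N = false by apply/eqP; lia.
case: eqVneq => [r1|r1]; case: eqVneq => [s1|s1].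
- by case: rs; rewrite r1 s1.
- by rewrite r1 add1n /=; ring.
- rewrite s1 addn1 /= [b == a]eq_sym; case: eqVneq => [->|_] /=; rewrite ?mulr1n ?mulr0n; ring.
rewrite -polyCM zetaN_stuffle; [|by rewrite ltn_neqAle eq_sym r1|by rewrite ltn_neqAle eq_sym s1].
by rewrite !polyCD polyCMn.
Qed.

End Constants.

(** * Values of [zeta(c; p) + (-1)^p zeta(-c; p)] *)

Section Tannery.
Variable R : realType.
Local Notation C := R[i].

(** A form of dominated convergence in which the summable majorant is replaced by a bound on the
    tails, uniform in [J]. This admits series that converge only conditionally, as needed for
    exponent 1. *)
Lemma tannery (u : nat -> nat -> C) (v : nat -> C) (K : R) (L : nat -> nat) (l : C) :
  (forall m, (0 < m)%N -> clim (u^~ m) (v m)) ->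
  (forall J A, (0 < J)%N -> (0 < A)%N -> (A <= L J)%N ->
     normc (\sum_(A <= m < L J) u J m) <= K / A%:R) ->
  (forall J, (J <= L J)%N) ->
  clim (fun M => \sum_(1 <= m < M) v m) l ->
  clim (fun J => \sum_(1 <= m < L J) u J m) l.
Proof.
move=> uv ub LJ vl.
apply/cvgrPdist_le => eps eps0.
have e3 : 0 < eps / 3 by rewrite divr_gt0.
move/cvgrPdist_le: (vl) => /(_ _ e3) [A1 _ hA1].
have /cvgrPdist_le /(_ _ e3) [A2 _ hA2] := @cst_div_cvg R K.
pose A := maxn 1 (maxn A1 A2).
have A0 : (0 < A)%N by rewrite leq_max.
have {}hA1 : normc (\sum_(1 <= m < A) v m - l) <= eps / 3.
  have := hA1 A; rewrite /= sub0r normrN ger0_norm ?normc_ge0 //; apply.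
  by rewrite /= !leq_max leqnn orbT.
have {}hA2 : K / A%:R <= eps / 3.
  have := hA2 A; rewrite /= sub0r normrN => h; apply: le_trans (ler_norm _) (h _).
  by rewrite !leq_max leqnn !orbT.
clearbody A.
have ct : clim (fun J => \sum_(1 <= m < A) u J m) (\sum_(1 <= m < A) v m).
  by apply: clim_sum_nat => m /andP[m0 _]; exact: uv.
move/cvgrPdist_le: ct => /(_ _ e3) [J1 _ hJ1].
exists (maxn 1 (maxn J1 A)) => // J /=; rewrite !geq_max => /and3P[J0 JJ1 JA].
have AL : (A <= L J)%N := leq_trans JA (LJ J).
rewrite sub0r normrN ger0_norm ?normc_ge0 //.
have -> : \sum_(1 <= m < L J) u J m - l =
   (\sum_(1 <= m < A) u J m - \sum_(1 <= m < A) v m) + (\sum_(1 <= m < A) v m - l)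
   + \sum_(A <= m < L J) u J m.
  by rewrite (big_cat_nat (n := A)) //= addrA subrK addrAC.
have h1 : normc (\sum_(1 <= m < A) u J m - \sum_(1 <= m < A) v m) <= eps / 3.
  by have := hJ1 J JJ1; rewrite /= sub0r normrN ger0_norm ?normc_ge0.
have h3 := ub J A J0 A0 AL.
apply: le_trans (le_normcD _ _) _.
apply: le_trans (lerD (le_normcD _ _) (lexx _)) _.
lra.
Qed.

Lemma clim_cst_div (c : C) : clim (fun M => c / M%:R) 0.
Proof.
apply: (@clim_le _ _ _ (fun M => normc c / M%:R)); last exact: cst_div_cvg.
by move=> M M0; rewrite subr0 normcM normcV normc_nat.
Qed.

End Tannery.

(** * Elementary estimates for sine, cosine and the exponential *)

Section TrigBounds.
Variable R : realType.
Local Open Scope classical_set_scope.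
Local Notation C := R[i].
Implicit Types (x y : R).

(** The mean value theorem gives slope cos(pi/4) on [0, pi/4]. Halving it covers [pi/4, pi/2] too,
    where sin x >= sin(pi/4) and x is at most twice pi/4. *)
Definition sin_slope : R := cos (pi / 4) / 2.

Lemma sin_slope_gt0 : 0 < sin_slope.
Proof.
have pi0 := pi_gt0 R; rewrite divr_gt0 //; apply: cos_gt0_pihalf.
by apply/andP; split; lra.
Qed.

Lemma sin_lower x : 0 <= x <= pi / 2 -> sin_slope * x <= sin x.
Proof.
move=> /andP[x0 x1]; have pi0 := pi_gt0 R; have s0 := sin_slope_gt0.
have small y : 0 <= y <= pi / 4 -> cos (pi / 4) * y <= sin y.
  move=> /andP[]; rewrite le_eqVlt => /predU1P[<- _|y0 y1].
    by rewrite mulr0 sin0.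
  have [|c /andP[c0 cy]] := @MVT R sin cos 0 y y0 (fun z _ => is_derive_sin z).
    by apply: continuous_subspaceT => z; exact: continuous_sin.
  rewrite sin0 !subr0 => ->; rewrite ler_pM2r //; apply: ltW.
  move: c0 cy; rewrite !bnd_simp => c0 cy.
  by rewrite ltr_cos ?in_itv /=; lra.
have [x4|x4] := leP x (pi / 4).
  apply: le_trans (small x _); last by rewrite x0.
  by apply: ler_wpM2r => //; rewrite /sin_slope in s0 *; lra.
apply: (@le_trans _ _ (sin (pi / 4))).
  apply: le_trans (small (pi / 4) _); last by rewrite lexx andbT; lra.
  rewrite /sin_slope -mulrA ler_pM2l; last by rewrite /sin_slope in s0; lra.
  lra.
apply: ltW.
by rewrite ltr_sin ?in_itv /=; lra.
Qed.

Lemma one_sub_cexp x : 1 - cexp (x *+ 2) = (2 * sin x)%:C * (sin x -i* cos x).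
Proof.
rewrite mulr2n /cexp cosD sinD; apply/eqP; rewrite eq_complex /=.
have := cos2Dsin2 x => h.
apply/andP; split; apply/eqP; last by ring.
by apply: (@etrans _ _ (cos x ^+ 2 + sin x ^+ 2 - (cos x * cos x - sin x * sin x))); [rewrite h|ring].
Qed.

Lemma normc_one_sub_cexp x : normc (1 - cexp (x *+ 2)) = 2 * `|sin x|.
Proof.
rewrite one_sub_cexp normcM normc_real normrM ger0_norm //.
by rewrite /= sqrrN sin2cos2 subrK sqrtr1 mulr1.
Qed.

(** The real part is 1/2 whatever [x] is, and the imaginary part is half a cotangent. This splitting
    drives the limit for exponent 1. *)
Lemma inv_one_sub_cexp x : sin x != 0 ->
  (1 - cexp (x *+ 2))^-1 = 2^-1 + 0 +i* (cos x / sin x / 2).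
Proof.
move=> s0; apply: (mulfI (x := 1 - cexp (x *+ 2))).
  rewrite one_sub_cexp mulf_eq0 negb_or eq_complex /= eqxx andbT mulf_neq0 //=.
  by rewrite eq_complex /= negb_and s0.
rewrite mulfV; last first.
  rewrite one_sub_cexp mulf_eq0 negb_or eq_complex /= eqxx andbT mulf_neq0 //=.
  by rewrite eq_complex /= negb_and s0.
have -> : 2^-1 + 0 +i* (cos x / sin x / 2) = (2^-1 : R) +i* (cos x / sin x / 2).
  have -> : (2^-1 : C) = (2^-1 : R)%:C by rewrite fmorphV rmorph_nat.
  by apply/eqP; rewrite eq_complex /= addr0 add0r !eqxx.
rewrite one_sub_cexp; apply/eqP; rewrite eq_complex /=.
have h := cos2Dsin2 x; apply/andP; split; apply/eqP; last by field.
by rewrite -[LHS]h; field.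
Qed.

Lemma one_sub_cos x : 1 - cos (x *+ 2) = 2 * sin x ^+ 2.
Proof. by rewrite cos_mulr2n cos2sin2; ring. Qed.

Lemma sin_near_id x : 0 <= x -> `|sin x - x| <= x ^+ 3 / 2 /\ 1 - cos x <= x ^+ 2 / 2.
Proof.
have mvt y : 0 < y -> exists2 c, 0 <= c <= y & sin y = cos c * y.
  move=> y0; have [|c cy] := @MVT R sin cos 0 y y0 (fun z _ => is_derive_sin z).
    by apply: continuous_subspaceT => z; exact: continuous_sin.
  rewrite sin0 !subr0 => e; exists c => //.
  by move: cy; rewrite in_itv /= => /andP[/ltW-> /ltW->].
have sin_le y : 0 <= y -> `|sin y| <= y.
  rewrite le_eqVlt => /predU1P[<-|y0]; first by rewrite sin0 normr0.
  have [c _ ->] := mvt y y0; rewrite normrM (gtr0_norm y0).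
  by rewrite ler_piMl ?cos_max // ltW.
have cos_ge y : 0 <= y -> 1 - cos y <= y ^+ 2 / 2.
  move=> y0; have -> : y = (y / 2) *+ 2 by rewrite -mulr_natr; field.
  rewrite one_sub_cos; have := sin_le (y / 2) (divr_ge0 y0 (ler0n _ _)).
  move=> h; have : `|sin (y / 2)| ^+ 2 <= (y / 2) ^+ 2.
    by rewrite lerXn2r // ?nnegrE // divr_ge0.
  rewrite real_normK ?num_real // -mulr_natr; nra.
move=> x0; split; last exact: cos_ge.
move: x0; rewrite le_eqVlt => /predU1P[<-|x0].
  by rewrite sin0 subrr normr0 expr0n mul0r.
have [c /andP[c0 cx] ->] := mvt x x0.
have -> : cos c * x - x = - ((1 - cos c) * x) by ring.
have h := cos_ge c c0; have h1 := cos_le1 c.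
rewrite normrN normrM (gtr0_norm x0) ger0_norm ?subr_ge0 //.
have -> : x ^+ 3 / 2 = x ^+ 2 / 2 * x by rewrite exprSr; ring.
rewrite ler_pM2r //; apply: le_trans h _; rewrite ler_pM2r ?invr_gt0 //.
by rewrite lerXn2r // nnegrE // ltW.
Qed.

Lemma normc_le_add (a b : R) : normc (a +i* b) <= `|a| + `|b|.
Proof.
have -> : a +i* b = a%:C + (0 +i* b) by apply/eqP; rewrite eq_complex /= addr0 add0r !eqxx.
apply: le_trans (le_normcD _ _) _; rewrite normc_real lerD2l.
by rewrite /= expr0n add0r sqrtr_sqr.
Qed.

Lemma cexp_deriv x : 0 <= x -> clim (fun J => J%:R * (cexp (x / J%:R) - 1)) (0 +i* x).
Proof.
move=> x0; apply: (@clim_le _ _ _ (fun J => (x ^+ 2 / 2 + x ^+ 3 / 2) / J%:R)); last exact: cst_div_cvg.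
move=> J J0; have J0' : (0 : R) < J%:R by rewrite ltr0n.
have t0 : 0 <= x / J%:R by rewrite divr_ge0.
have [hs hc] := sin_near_id t0.
have -> : J%:R * (cexp (x / J%:R) - 1) - (0 +i* x) =
  (J%:R * (cos (x / J%:R) - 1)) +i* (J%:R * (sin (x / J%:R) - x / J%:R)).
  rewrite -(rmorph_nat (real_complex R)); apply/eqP; rewrite eq_complex /=.
  apply/andP; split; apply/eqP; first by ring.
  by field; rewrite gt_eqF.
apply: le_trans (normc_le_add _ _) _; rewrite mulrDl lerD //.
  rewrite normrM gtr0_norm // distrC ger0_norm ?subr_ge0 ?cos_le1 //.
  apply: le_trans (ler_wpM2l (ltW J0') hc) _.
  by rewrite le_eqVlt; apply/orP; left; apply/eqP; field; rewrite gt_eqF.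
rewrite normrM gtr0_norm //.
apply: le_trans (ler_wpM2l (ltW J0') hs) _.
have -> : J%:R * ((x / J%:R) ^+ 3 / 2) = x ^+ 3 / 2 / J%:R * (J%:R^-1).
  by field; rewrite gt_eqF.
rewrite ler_piMr ?divr_ge0 ?exprn_ge0 // invf_le1 //.
by rewrite ler1n.
Qed.

End TrigBounds.

(** * Power sums of the inverses of M(1 - y) over the M-th roots y of w *)

Section PowerSums.
Variables (K : fieldType) (M : nat) (y : nat -> K) (w : K).
Hypotheses (M0 : (M%:R : K) != 0) (yM : forall j, (j < M)%N -> y j ^+ M = w).
Hypothesis y0 : forall i, (0 < i < M)%N -> \sum_(j < M) y j ^+ i = 0.

Let Z : {poly K} := 1 + M%:R^-1 *: 'X.

Let coefZX m k : (Z ^+ m)`_k = 'C(m, k)%:R / M%:R ^+ k.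
Proof.
rewrite exprDn coef_sum.
under eq_bigr do rewrite expr1n mul1r exprZn coefMn coefZ coefXn.
have [km|mk] := ltnP k m.+1.
  rewrite (bigD1 (Ordinal km)) //= eqxx mulr1 big1 ?addr0; last first.
    move=> i /eqP ik; rewrite eq_sym; case: eqP => [e|_]; last by rewrite mulr0 mul0rn.
    by case: ik; apply: val_inj.
  by rewrite exprVn mulr_natl.
rewrite bin_small // mul0r big1 // => i _.
by rewrite gtn_eqF ?mulr0 ?mul0rn // (leq_trans (ltn_ord i)).
Qed.

Let P k := 'C(M, k)%:R / M%:R ^+ k - w *+ (k == 0%N).
(* [G j = (Z ^ M - w) / (Z - y_j)]; by [y0] the sum of the [G j] is
   [M Z ^ (M - 1)], whose coefficients are compared with those of the [G j]. *)
Let G j : {poly K} := \sum_(i < M) Z ^+ (M.-1 - i) * (y j)%:P ^+ i.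
Let b j := (M%:R * (1 - y j))^-1.

Let G_rec j k : (j < M)%N ->
  (1 - y j) * (G j)`_k + M%:R^-1 * (if k is k'.+1 then (G j)`_k' else 0) = P k.
Proof.
move=> jM; have : Z ^+ M - w%:P = (Z - (y j)%:P) * G j.
  by rewrite -(yM jM) polyC_exp subrXX.
move=> /(congr1 (fun p : {poly K} => p`_k)) /=.
rewrite coefB coefC coefZX.
have -> : Z - (y j)%:P = (1 - y j)%:P + M%:R^-1%:P * 'X.
  by rewrite /Z polyCB polyC1 mul_polyC addrAC.
rewrite mulrDl coefD coefCM -mulrA coefCM coefXM => h.
by rewrite /P; case: k h => [|k] /= <-.
Qed.

Let G_coef j k : (j < M)%N -> (G j)`_k / M%:R =
  P k.+1 *+ (y j == 1) + \sum_(i < k.+1) (-1) ^+ i * b j ^+ i.+1 * P (k - i).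
Proof.
move=> jM; case: eqVneq => [yj|yj].
  (* The root [y j = 1] produces the pole 1/t, hence [P] shifted by one. It is absent from the sum
     over [i], because [b j = 0] by the convention that the inverse of 0 is 0. *)
  have := G_rec k.+1 jM; rewrite yj subrr mul0r add0r mulrC => ->.
  rewrite big1 ?addr0 ?mulr1n // => i _.
  by rewrite /b yj subrr mulr0 invr0 exprS mul0r mulr0 mul0r.
rewrite mulr0n add0r; have y1 : 1 - y j != 0 by rewrite subr_eq0 eq_sym.
elim: k => [|k IH].
  rewrite big_ord1 expr0 mul1r expr1 -(G_rec 0 jM) mulr0 addr0 /b.
  by field; rewrite M0 y1.
rewrite big_ord_recl /= expr0 mul1r expr1 subn0.
transitivity (b j * (P k.+1 - (G j)`_k / M%:R)).
  by rewrite -(G_rec k.+1 jM) /b; field; rewrite M0 y1.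
rewrite mulrBr IH; congr (_ + _); rewrite mulr_sumr -sumrN.
apply: eq_bigr => i _; rewrite /bump leq0n add1n subSS !exprS; ring.
Qed.

(** The coefficient of t^k in Z^(M-1) = (Z^M - w) sum_j 1/(M(Z - y_j)) with Z = 1 + t/M. Each 1/(M(Z
    - y_j)) expands as b - b^2 t + b^3 t^2 - ..., where b = 1/(M(1 - y_j)), or is 1/t if y_j = 1. *)
Lemma root_power_sums k : (0 < M)%N ->
  'C(M.-1, k)%:R / M%:R ^+ k =
  'C(M, k.+1)%:R / M%:R ^+ k.+1 * (\sum_(j < M) (y j == 1)%:R) +
  \sum_(i < k.+1) (-1) ^+ i * (\sum_(j < M) (M%:R * (1 - y j))^-1 ^+ i.+1) *
    ('C(M, k - i)%:R / M%:R ^+ (k - i) - w *+ (k - i == 0)%N).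
Proof.
move=> Mpos; transitivity ((\sum_(j < M) G j)`_k / M%:R).
  rewrite /G exchange_big /=.
  under eq_bigr do rewrite -mulr_sumr.
  rewrite (bigD1 (Ordinal Mpos)) //= subn0 [X in _ + X]big1 ?addr0; last first.
    move=> i i0; under eq_bigr do rewrite -polyC_exp.
    by rewrite -rmorph_sum /= y0 ?mulr0 // ltn_ord andbT lt0n.
  under eq_bigr do rewrite expr0.
  rewrite sumr_const card_ord mulr_natr coefMn coefZX.
  by rewrite -[X in _ = X / _]mulr_natr mulfK.
rewrite coef_sum mulr_suml.
under eq_bigr => j _ do rewrite (G_coef _ (ltn_ord j)).
rewrite big_split /=; congr (_ + _).
  rewrite mulr_sumr; apply: eq_bigr => j _.
  by rewrite /P subr0 mulr_natr.
rewrite exchange_big /=; apply: eq_bigr => i _.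
by rewrite mulr_sumr mulr_suml.
Qed.

End PowerSums.

(** * Folding sums over a residue class *)

Section Fold.
Variable n : nat.
Local Notation N := n.+1.

Lemma sum_progression (V : zmodType) (F : nat -> V) (c : 'I_N) M :
  \sum_(0 <= k < N * M | (k == c %[mod N])%N) F k = \sum_(j < M) F (c + N * j)%N.
Proof.
elim: M => [|M IH]; first by rewrite muln0 big_geq // big_ord0.
rewrite big_ord_recr /= -IH mulnS addnC (@big_cat_nat _ _ _ (N * M)%N) ?leq_addr //=.
congr (_ + _); rewrite -{1}[(N * M)%N]add0n big_addn addKn.
have mD i : (i + N * M = i %[mod N])%N by rewrite addnC mulnC modnMDl.
rewrite big_mkord (bigD1 c) /= ?mD // big1 ?addr0 // => i /andP[].
rewrite mD !modn_small // => /eqP ic /eqP nic.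
by case: nic; apply: val_inj.
Qed.

Lemma modn_opp (c : 'I_N) J m : (m <= 2 * (N * J))%N ->
  (2 * (N * J) - m == c %[mod N])%N = (m == (- c)%R %[mod N])%N.
Proof.
move=> mL; apply/eqP/eqP => h.
  have : (m + c = 0 %[mod N])%N.
    by rewrite -modnDmr -h modnDmr subnKC // mulnCA modnMr mod0n.
  rewrite mod0n => e; rewrite [((- c)%R : nat)]/= modn_mod.
  have := @modnDml m c N; rewrite e => e'.
  rewrite -[m]addn0 -(modnn N) modnDmr -{1}(subnKC (ltnW (ltn_ord c))) addnA.
  by rewrite -modnDml e add0n.
have : (m + c = 0 %[mod N])%N.
  by rewrite -modnDml h modnDml /= modnDml subnK ?modnn ?mod0n // ltnW.
rewrite mod0n => e.
have h2 : ((2 * (N * J) - m) + (m + c) = c %[mod N])%N.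
  have -> : ((2 * (N * J) - m) + (m + c) = (2 * J) * N + c)%N by lia.
  by rewrite modnMDl.
by rewrite -h2 -modnDmr e addn0.
Qed.

(** Reflection in the midpoint [N * J] sends the class c to -c, which is how -c enters the parity
    combinations. The even length [2 * (N * J)] makes the midpoint an integer; it lies in the class
    0. *)
Lemma sum_fold (K : comNzRingType) (F : nat -> K) (c : 'I_N) J : (0 < J)%N ->
  \sum_(1 <= k < 2 * (N * J) | (k == c %[mod N])%N) F k =
  \sum_(1 <= m < N * J) ((m == c %[mod N])%:R * F m
     + (m == (- c)%R %[mod N])%:R * F (2 * (N * J) - m)%N)
  + (c == 0)%:R * F (N * J)%N.
Proof.
move=> J0; have L0 : (0 < N * J)%N by rewrite muln_gt0.
have ifE (b : bool) (x : K) : (if b then x else 0) = b%:R * x.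
  by case: b; rewrite ?mul1r ?mul0r.
rewrite big_mkcond /= (@big_cat_nat _ _ _ (N * J)%N) //=; last by lia.
rewrite big_split /= -addrA; congr (_ + _).
  by apply: eq_bigr => m _; rewrite ifE.
rewrite big_ltn; last by lia.
rewrite addrC; congr (_ + _); last first.
  rewrite ifE; congr (_%:R * _); congr nat_of_bool.
  by rewrite mulnC modnMl modn_small // eq_sym.
rewrite -[(N * J).+1]addn1 addnC big_addn.
have -> : (2 * (N * J) - N * J = N * J)%N by lia.
rewrite big_nat_rev /=; apply: eq_big_nat => m /andP[m0 mL].
have e : ((1 + N * J - m.+1) + N * J = 2 * (N * J) - m)%N by lia.
by rewrite e modn_opp ?ifE //; lia.
Qed.

End Fold.

(** * Parity combinations of zeta values as limits of sums over roots *)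

Section Parity.
Variables (R : realType) (n : nat) (c : 'I_n.+1).
Local Open Scope classical_set_scope.
Local Notation C := R[i].
Local Notation N := n.+1.
Local Notation eta := (Defs.eta R n).
Local Notation kappa := (- N%:R / twopii R).

Let N0 : (N%:R : R) != 0. Proof. by rewrite pnatr_eq0. Qed.
Let N0' : (N%:R : C) != 0. Proof. by rewrite pnatr_eq0. Qed.
Let pi0 : 0 < pi :> R. Proof. exact: pi_gt0. Qed.
Local Opaque pi csum Li zetaN.

Definition parity_coef p (m : nat) : C :=
  (m == c %[mod N])%:R + (-1) ^+ p * (m == (- c)%R %[mod N])%:R.

(** The two residue classes are combined inside the sum, so that the series converges for p = 1 as
    well, where each class alone diverges. *)
Definition zeta_parity p : C := csum (fun m => parity_coef p m / m%:R ^+ p).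

Lemma zeta_reg_parity sharp p : (0 < p)%N ->
  zeta_reg R sharp c p + (-1) ^+ p *: zeta_reg R sharp (- c) p = (zeta_parity p)%:P /\
  clim (fun M => \sum_(1 <= m < M) parity_coef p m / m%:R ^+ p) (zeta_parity p).
Proof.
move=> p0.
suff [l hl cl] : exists2 l, zeta_reg R sharp c p + (-1) ^+ p *: zeta_reg R sharp (- c) p = l%:P &
    clim (fun M => \sum_(1 <= m < M) parity_coef p m / m%:R ^+ p) l.
  by rewrite hl /zeta_parity (csum_lim cl).
case: (ltnP 1 p) => [p1|p1].
  exists (zetaN R c p + (-1) ^+ p * zetaN R (- c) p).
    by rewrite /zeta_reg gtn_eqF // polyCD polyCM mul_polyC.
  have := climD (@zetaN_clim R n c p p1) (climMl ((-1) ^+ p) (@zetaN_clim R n (- c) p p1)).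
  apply: (@clim_near _ _ _ _ 0) => M _; rewrite mulr_sumr -big_split /=.
  by apply: eq_bigr => m _; rewrite /parity_coef mulrDl mulrA.
have {p0 p1} -> : p = 1%N by lia.
pose d k := (eta ^+ (c * k))^-1 - eta ^+ (c * k).
exists (N%:R^-1 * \sum_(1 <= k < N) d k * Li 1 (eta ^+ k)).
  rewrite !zeta_regE // expr1 scaleN1r -scalerBr -sumrB polyCM mul_polyC; congr (_ *: _).
  transitivity (\sum_(1 <= k < N.+1) d k *: Lreg R n 1 k).
    by apply: eq_bigr => k _; rewrite eta_oppZ invrK; exact/esym/scalerBl.
  (* The formal variable sits only in the term [k = N], the trivial character, and its coefficient
     [d N] is 0. *)
  rewrite big_nat_recr //= {2}/d.
  rewrite [(c * N)%N]mulnC exprM etaXN expr1n invr1 subrr scale0r addr0.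
  rewrite rmorph_sum /=; apply: eq_big_nat => k /andP[k0 kN].
  by rewrite /Lreg /= gtnNdvd // polyCM mul_polyC.
have h k : (1 <= k < N)%N -> clim (fun M => d k * \sum_(1 <= m < M) eta ^+ k ^+ m / m%:R ^+ 1)
    (d k * Li 1 (eta ^+ k)).
  move=> /andP[k0 kN]; apply/climMl/Li_clim => //; first exact: normc_etaX.
  by move=> _; rewrite eta_eq1 gtnNdvd.
have := climMl N%:R^-1 (clim_sum_nat h).
apply: (@clim_near _ _ _ _ 0) => M _.
under eq_bigr do rewrite mulr_sumr.
rewrite exchange_big_nat /= mulr_sumr; apply: eq_bigr => m _.
rewrite /parity_coef expr1 mulN1r !indicatorE -mulrBr -mulrA; congr (_ * _).
rewrite -sumrB mulr_suml [RHS]big_nat_recr //=.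
rewrite eta_oppZ invrK [(c * N)%N]mulnC exprM etaXN expr1n invr1 subrr mul0r addr0.
apply: eq_bigr => k _; rewrite eta_oppZ invrK /d; ring.
Qed.

(** The difference of the indicators of c and -c has no trivial Fourier component, so its sums are
    combinations of geometric sums of roots of unity other than 1. *)
Lemma parity_coef1_bounded :
  exists K, forall A B, normc (\sum_(A <= m < B) parity_coef 1 m) <= K.
Proof.
pose d k := (eta ^+ (c * k))^-1 - eta ^+ (c * k).
exists (normc (N%:R^-1 : C) * \sum_(1 <= k < N) normc (d k) * (2 / normc (eta ^+ k - 1))).
move=> A B.
have -> : \sum_(A <= m < B) parity_coef 1 m =
   N%:R^-1 * \sum_(1 <= k < N) d k * \sum_(A <= m < B) eta ^+ k ^+ m.
  under [in RHS]eq_bigr do rewrite mulr_sumr.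
  rewrite exchange_big_nat /= mulr_sumr; apply: eq_bigr => m _.
  rewrite /parity_coef expr1 mulN1r !indicatorE -mulrBr; congr (_ * _).
  rewrite -sumrB [LHS]big_nat_recr //=.
  rewrite eta_oppZ invrK [(c * N)%N]mulnC exprM etaXN expr1n invr1 subrr addr0.
  apply: eq_bigr => k _; rewrite eta_oppZ invrK /d; ring.
rewrite normcM ler_wpM2l ?normc_ge0 //; apply: le_trans (normc_sum _ _ _) _.
apply: ler_sum_nat => k /andP[k0 kN]; rewrite normcM ler_wpM2l ?normc_ge0 //.
apply: geom_sum_bounded; first exact: normc_etaX.
by rewrite eta_eq1 gtnNdvd.
Qed.

Definition half_angle J m : R := pi * m%:R / (2 * (N * J))%:R.

(* When [m] ranges over a class [c] modulo [N], [cexp (half_angle J m *+ 2)]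
   ranges over the [2 J]-th roots of [eta ^ c]. *)
Definition root_term J m : C := ((2 * J)%:R * (1 - cexp (half_angle J m *+ 2)))^-1.

Lemma half_angle_fold J m : (0 < J)%N -> (m <= 2 * (N * J))%N ->
  half_angle J (2 * (N * J) - m)%N = pi - half_angle J m.
Proof.
move=> J0 mL; rewrite /half_angle natrB // mulrBr mulrBl mulfK // pnatr_eq0; lia.
Qed.

Lemma sin_pi_sub (x : R) : sin (pi - x) = sin x.
Proof. by rewrite sinB sinpi cospi mul0r sub0r mulN1r opprK. Qed.

Lemma cos_pi_sub (x : R) : cos (pi - x) = - cos x.
Proof. by rewrite cosB sinpi cospi mul0r addr0 mulN1r. Qed.

Lemma half_angle_gt0 J m : (0 < J)%N -> (0 < m)%N -> 0 < half_angle J m.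
Proof. by move=> J0 m0; rewrite /half_angle divr_gt0 ?mulr_gt0 ?ltr0n // !muln_gt0. Qed.

Lemma half_angle_le J m : (0 < J)%N -> (m <= N * J)%N -> half_angle J m <= pi / 2.
Proof.
move=> J0 mL; rewrite /half_angle natrM invfM mulrA [_ * 2^-1]mulrC -mulrA mulrC.
rewrite ler_pM2r ?invr_gt0 // ler_pdivrMr ?ltr0n ?muln_gt0 //.
by rewrite ler_pM2l // ler_nat.
Qed.

Lemma sin_half_angle_gt0 J m : (0 < J)%N -> (0 < m < 2 * (N * J))%N -> 0 < sin (half_angle J m).
Proof.
move=> J0 /andP[m0 mL]; apply: sin_gt0_pi; rewrite half_angle_gt0 //=.
rewrite /half_angle ltr_pdivrMr; last by rewrite ltr0n; lia.
by rewrite ltr_pM2l // ltr_nat.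
Qed.

Lemma root_termE J m : (0 < J)%N -> (0 < m < 2 * (N * J))%N ->
  root_term J m = (4 * J)%:R^-1 + 0 +i* (cos (half_angle J m) / sin (half_angle J m) / (4 * J)%:R).
Proof.
move=> J0 mL; have s0 := sin_half_angle_gt0 J0 mL.
rewrite /root_term invfM inv_one_sub_cexp ?gt_eqF // mulrDr.
have -> : (4 * J)%:R^-1 = (2 * J)%:R^-1 * 2^-1 :> C.
  by rewrite -invfM -natrM; congr (_%:R^-1); lia.
congr (_ + _); rewrite -(rmorph_nat (real_complex R)) -fmorphV.
apply/eqP; rewrite eq_complex /= !mulr0 !mul0r subr0 addr0 eqxx /=.
apply/eqP; have -> : ((4 * J)%:R : R) = (2 * J)%:R * 2 by rewrite -natrM; congr (_%:R); lia.
by rewrite invfM mulrCA mulrA.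
Qed.

(** Reflection replaces the root y by 1/y, and 1/(1 - y) + 1/(1 - 1/y) = 1. *)
Lemma root_term_fold J m : (0 < J)%N -> (0 < m < 2 * (N * J))%N ->
  root_term J (2 * (N * J) - m) = (2 * J)%:R^-1 - root_term J m.
Proof.
move=> J0 mL; rewrite !root_termE //; last by lia.
rewrite half_angle_fold //; last by lia.
rewrite cos_pi_sub sin_pi_sub.
have -> : (2 * J)%:R^-1 = (4 * J)%:R^-1 + (4 * J)%:R^-1 :> C.
  have -> : ((4 * J)%:R : C) = 2 * (2 * J)%:R by rewrite -natrM; congr (_%:R); lia.
  have : ((2 * J)%:R : C) != 0 by rewrite pnatr_eq0; lia.
  by move: (2 * J)%:R => z h; field.
rewrite opprD addrA addrK; congr (_ + _).
by apply/eqP; rewrite eq_complex /= oppr0 eqxx /= !mulNr.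
Qed.

(** From sin x >= [sin_slope] x at x = pi m/(2 N J): the modulus 4 J sin x of 2J(1 - y) is at least
    2 [sin_slope] pi m/N. *)
Definition root_term_bound : R := N%:R / (2 * sin_slope R * pi).

Lemma root_term_bound_ge0 : 0 <= root_term_bound.
Proof.
have s0 := ltW (sin_slope_gt0 R); have p0 := ltW pi0.
by apply: divr_ge0; [exact: ler0n|apply: mulr_ge0 => //; exact: mulr_ge0].
Qed.

Lemma inv_sin_half_angle J m : (0 < J)%N -> (0 < m <= N * J)%N ->
  ((4 * J)%:R * sin (half_angle J m))^-1 <= root_term_bound / m%:R.
Proof.
move=> J0 /andP[m0 mL]; have s0 := sin_slope_gt0 R.
have m0' : (0 : R) < m%:R by rewrite ltr0n.
have J0' : (0 : R) < J%:R by rewrite ltr0n.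
have Np : (0 : R) < N%:R by rewrite ltr0n.
have ha := half_angle_gt0 J0 m0.
have hs : sin_slope R * half_angle J m <= sin (half_angle J m).
  by apply: sin_lower; rewrite ltW //= half_angle_le.
have hp : 0 < sin_slope R * half_angle J m by rewrite mulr_gt0.
have -> : root_term_bound / m%:R = ((4 * J)%:R * (sin_slope R * half_angle J m))^-1.
  rewrite /root_term_bound /half_angle !natrM.
  move: s0 pi0 m0' J0' Np; move: (sin_slope R) (pi : R) (m%:R : R) (J%:R : R) (N%:R : R).
  by move=> t u v x z t0 u0 v0 x0 z0; field; rewrite !gt_eqF.
have hq := lt_le_trans hp hs.
have J4 : (0 : R) < (4 * J)%:R by rewrite ltr0n muln_gt0.
rewrite lef_pV2 ?posrE; [|exact: mulr_gt0|exact: mulr_gt0].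
by rewrite ler_pM2l.
Qed.

Lemma normc_root_term J m : (0 < J)%N -> (0 < m <= N * J)%N ->
  normc (root_term J m) <= root_term_bound / m%:R /\ normc (root_term J (2 * (N * J) - m)) <= root_term_bound / m%:R.
Proof.
move=> J0 mL; have h : normc (root_term J m) = ((4 * J)%:R * sin (half_angle J m))^-1.
  rewrite normcV normcM normc_nat normc_one_sub_cexp ger0_norm; last first.
    by apply/ltW/sin_half_angle_gt0 => //; lia.
  by rewrite mulrA -natrM; congr ((_%:R * _)^-1); lia.
split; first by rewrite h inv_sin_half_angle.
rewrite normcV normcM normc_nat normc_one_sub_cexp half_angle_fold //; last by lia.
rewrite sin_pi_sub -normc_one_sub_cexp.
rewrite normc_one_sub_cexp -[X in X * _](normc_nat R) -normc_one_sub_cexp -normcM.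
by rewrite -normcV h inv_sin_half_angle.
Qed.

Lemma twopii_neq0 : twopii R != 0.
Proof.
by rewrite eq_complex /= eqxx /= mulf_neq0 // ?gt_eqF // pnatr_eq0.
Qed.

(** To first order 1 - y is -2 pi i m/(2 N J), so 2J(1 - y) tends to -2 pi i m/N; this is the origin
    of [kappa]. *)
Lemma root_term_lim m : (0 < m)%N -> clim (root_term^~ m) (kappa / m%:R).
Proof.
move=> m0; pose x : R := pi * m%:R / N%:R.
have x0 : 0 < x by rewrite divr_gt0 ?mulr_gt0 ?ltr0n.
have := climMl (-2) (cexp_deriv (ltW x0)).
have e : -2 * (0 +i* x) = (kappa / m%:R)^-1 :> C.
  rewrite !invfM !invrK.
  have -> : twopii R = 2 * pi%:C * (0 +i* 1).
    apply/eqP; rewrite eq_complex -(rmorph_nat (real_complex R)) /=.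
    by apply/andP; split; apply/eqP; ring.
  have -> : (0 +i* x) = pi%:C * m%:R / N%:R * (0 +i* 1).
    apply/eqP; rewrite eq_complex -!(rmorph_nat (real_complex R)) -fmorphV /=.
    by apply/andP; split; apply/eqP; rewrite /x; ring.
  rewrite invrN !mulNr.
  by move: (m%:R : C) (pi%:C) (0 +i* 1 : C) (N%:R : C) N0' => t u v z z0; field.
have nz : -2 * (0 +i* x) != 0 :> C.
  by rewrite mulf_neq0 ?oppr_eq0 ?pnatr_eq0 // eq_complex /= eqxx /= gt_eqF.
move=> /(climV nz); rewrite e invrK.
apply: (@clim_near _ _ _ _ 1) => J J0.
rewrite /root_term; congr (_^-1); rewrite natrM.
have -> : half_angle J m *+ 2 = x / J%:R.
  rewrite /half_angle /x !natrM -mulr_natr.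
  have : (J%:R : R) != 0 by rewrite pnatr_eq0 -lt0n.
  by move: (pi : R) (m%:R : R) (J%:R : R) (N%:R : R) N0 => t u v z z0 v0; field; rewrite v0 z0.
ring.
Qed.

Lemma root_term_fold_lim m : (0 < m)%N ->
  clim (fun J => root_term J (2 * (N * J) - m)) (- (kappa / m%:R)).
Proof.
move=> m0; have := climB (clim_cst_div (2^-1 : C)) (root_term_lim m0); rewrite sub0r.
apply: (@clim_near _ _ _ _ m) => J mJ.
have J0 := leq_trans m0 mJ.
rewrite root_term_fold ?natrM ?invfM //.
rewrite m0 /= mulnA; apply: leq_ltn_trans mJ _.
by rewrite -[X in (X < _)%N]mul1n ltn_pmul2r // mul2n.
Qed.

End Parity.

Section ParityLimit.
Variables (R : realType) (n : nat) (c : 'I_n.+1).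
Local Open Scope classical_set_scope.
Local Notation C := R[i].
Local Notation N := n.+1.
Local Notation eta := (Defs.eta R n).
Local Notation kappa := (- N%:R / twopii R).
Local Notation coef := (parity_coef R c).
Local Notation b := (root_term R n).

Local Opaque pi csum.

Definition root_sum p J : C := \sum_(0 <= k < 2 * (N * J) | (k == c %[mod N])%N) b J k ^+ p.

(** Index 0 is the root y = 1, met only in the class c = 0; the inverse of 0 being 0, it drops out
    of the power sums. *)
Lemma root_term0 J : b J 0 = 0.
Proof. by rewrite /root_term /half_angle mulr0 mul0r mul0rn cexp0 subrr mulr0 invr0. Qed.

Lemma drop_index0 (V : zmodType) (F : nat -> V) (P : pred nat) L : F 0%N = 0 ->
  \sum_(0 <= k < L | P k) F k = \sum_(1 <= k < L | P k) F k.
Proof.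
move=> F0; case: L => [|L]; first by rewrite !big_geq.
by rewrite big_mkcond big_ltn //= F0 if_same add0r -big_mkcond.
Qed.

Lemma root_term_mid_lim p : (0 < p)%N -> clim (fun J => b J (N * J) ^+ p) 0.
Proof.
move=> p0; have -> : 0 = 0 ^+ p :> C by rewrite expr0n gtn_eqF.
apply: climX; apply: (@clim_le _ _ _ (fun J => root_term_bound R n / J%:R)); last exact: cst_div_cvg.
move=> J J0; have L0 : (0 < N * J <= N * J)%N by rewrite muln_gt0 J0 leqnn.
rewrite subr0; apply: le_trans (normc_root_term R J0 L0).1 _.
apply: ler_wpM2l; first exact: root_term_bound_ge0.
rewrite lef_pV2 ?posrE ?ltr0n ?muln_gt0 // ler_nat.
by rewrite -[X in (X <= _)%N]mul1n leq_mul2r orbT.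
Qed.

Lemma root_sum_lim_gt1 p : (1 < p)%N ->
  clim (root_sum p) (kappa ^+ p * zeta_parity R c p).
Proof.
move=> p1; have p0 := ltnW p1; have bb := root_term_bound_ge0 R n.
pose u J m := (m == c %[mod N])%:R * b J m ^+ p
   + (m == (- c)%R %[mod N])%:R * b J (2 * (N * J) - m)%N ^+ p.
pose K := 2 * root_term_bound R n ^+ p.
have ub J m : (0 < J)%N -> (0 < m <= N * J)%N -> normc (u J m) <= K / m%:R ^+ 2.
  move=> J0 mL; have [h1 h2] := normc_root_term R J0 mL.
  have m0 : (0 < m)%N by case/andP: mL.
  have aux (t : bool) (x : C) : normc x <= root_term_bound R n / m%:R ->
      normc (t%:R * x ^+ p) <= root_term_bound R n ^+ p / m%:R ^+ 2.
    move=> hx; rewrite normcM normcX.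
    apply: (@le_trans _ _ ((root_term_bound R n / m%:R) ^+ p)).
      rewrite -[leRHS]mul1r; apply: ler_pM => //.
      - exact: normc_ge0.
      - by rewrite exprn_ge0 // normc_ge0.
      - exact: normc_bool.
      by rewrite lerXn2r // ?nnegrE ?normc_ge0 // divr_ge0.
    rewrite expr_div_n ler_wpM2l ?exprn_ge0 //.
    by rewrite lef_pV2 ?posrE ?exprn_gt0 ?ltr0n // ler_weXn2l // ler1n.
  apply: le_trans (le_normcD _ _) _.
  by rewrite /K mulr2n mulrDl mul1r mulrDl; apply: lerD; apply: aux.
have cv := @tannery R u (fun m => coef p m * (kappa / m%:R) ^+ p) (2 * K) (fun J => N * J)%N
  (kappa ^+ p * zeta_parity R c p).
have {cv} : clim (fun J => \sum_(1 <= m < N * J) u J m) (kappa ^+ p * zeta_parity R c p).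
  apply: cv.
  - move=> m m0; have := climD (climMl (m == c %[mod N])%:R (climX p (@root_term_lim R n m m0)))
      (climMl (m == (- c)%R %[mod N])%:R (climX p (@root_term_fold_lim R n m m0))).
    by rewrite [(- _) ^+ p]exprNn mulrA [_ * (-1) ^+ p]mulrC -mulrDl.
  - move=> J A J0 A0 AL.
    (* Extension by 0: [tail_bounded_sqr] asks for a bound at every index, whereas [u J m] is
       controlled only up to the midpoint. *)
    pose e m := if (m < N * J)%N then u J m else 0.
    have -> : \sum_(A <= m < N * J) u J m = \sum_(A <= m < N * J) e m.
      by apply: eq_big_nat => m /andP[_ mL]; rewrite /e mL.
    apply: (@tail_bounded_sqr R e K) => //; first by rewrite mulr_ge0 // exprn_ge0.
    move=> m m0; rewrite /e; case: ifP => [mL|_].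
      by apply: ub => //; rewrite m0 ltnW.
    by rewrite normc0 divr_ge0 // ?exprn_ge0 // mulr_ge0 // exprn_ge0.
  - by move=> J; rewrite -[X in (X <= _)%N]mul1n leq_mul2r orbT.
  have [_ h] := zeta_reg_parity R c Sh p0.
  have := climMl (kappa ^+ p) h.
  apply: (@clim_near _ _ _ _ 0) => M _; rewrite mulr_sumr; apply: eq_bigr => m _.
  by rewrite [(_ / m%:R) ^+ p]expr_div_n mulrCA.
move=> cv; have := climD cv (climMl (c == 0)%:R (root_term_mid_lim p0)).
rewrite mulr0 addr0; apply: (@clim_near _ _ _ _ 1) => J J0.
rewrite /root_sum drop_index0; last by rewrite root_term0 expr0n gtn_eqF.
by rewrite sum_fold.
Qed.

(** The imaginary part of [root_term]. Up to the midpoint it is nonnegative and decreasing in [m],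
    as the Dirichlet test requires. *)
Definition cot_term J m : R := cos (half_angle R n J m) / sin (half_angle R n J m) / (4 * J)%:R.

Lemma cot_term_ge0 J m : (0 < J)%N -> (0 < m <= N * J)%N -> 0 <= cot_term J m.
Proof.
move=> J0 /andP[m0 mL]; rewrite /cot_term !mulr_ge0 ?invr_ge0 //.
  apply: cos_ge0_pihalf; rewrite half_angle_le // andbT.
  have := half_angle_gt0 R n J0 m0; have := pi_gt0 R; lra.
by apply/ltW/sin_half_angle_gt0 => //; lia.
Qed.

Lemma cot_term_le J m : (0 < J)%N -> (0 < m <= N * J)%N -> cot_term J m <= root_term_bound R n / m%:R.
Proof.
move=> J0 mL; have s0 : 0 < sin (half_angle R n J m) by apply: sin_half_angle_gt0 => //; lia.
apply: le_trans (inv_sin_half_angle R J0 mL).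
rewrite /cot_term -mulrA -invfM [sin _ * _]mulrC ler_piMl ?cos_le1 //.
by rewrite invr_ge0 mulr_ge0 // ltW.
Qed.

Lemma cot_term_dec J m : (0 < J)%N -> (0 < m)%N -> (m.+1 <= N * J)%N -> cot_term J m.+1 <= cot_term J m.
Proof.
move=> J0 m0 mL; have p0 := pi_gt0 R.
have a0 := half_angle_gt0 R n J0 m0; have a1 := half_angle_le R J0 mL.
have am : half_angle R n J m < half_angle R n J m.+1.
  rewrite /half_angle ltr_pM2r ?ltr_pM2l ?ltr_nat // invr_gt0 ltr0n; lia.
have s0 : 0 < sin (half_angle R n J m) by apply: sin_half_angle_gt0 => //; lia.
have s1 : 0 < sin (half_angle R n J m.+1) by apply: sin_half_angle_gt0 => //; lia.
rewrite /cot_term ler_wpM2r ?invr_ge0 //; apply: ler_pM.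
- by apply: cos_ge0_pihalf; lra.
- by rewrite invr_ge0 ltW.
- by rewrite ltW // ltr_cos ?in_itv /=; lra.
by rewrite lef_pV2 ?posrE // ltW // ltr_sin ?in_itv /=; lra.
Qed.

(** The real parts 1/(4J), taken over the 2J members of the class, add up to 1/2. What remains, [g],
    is odd under reflection, so folding it produces the coefficients [parity_coef] at exponent 1;
    their bounded sums against the monotone cotangents give the uniform tail bound. *)
Lemma root_sum_lim1 : clim (root_sum 1) (2^-1 + kappa * zeta_parity R c 1).
Proof.
pose g J m := b J m - (4 * J)%:R^-1.
have gE J m : (0 < J)%N -> (0 < m < 2 * (N * J))%N -> g J m = (0 +i* 1) * (cot_term J m)%:C.
  move=> J0 mL; rewrite /g root_termE // [_ + _ - _]addrAC subrr add0r.
  by apply/eqP; rewrite eq_complex /=; apply/andP; split; apply/eqP; rewrite /cot_term; ring.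
have gfold J m : (0 < J)%N -> (0 < m < 2 * (N * J))%N -> g J (2 * (N * J) - m)%N = - g J m.
  move=> J0 mL; rewrite /g root_term_fold //.
  have -> : (2 * J)%:R^-1 = (4 * J)%:R^-1 + (4 * J)%:R^-1 :> C.
    have -> : ((4 * J)%:R : C) = 2 * (2 * J)%:R by rewrite -natrM; congr (_%:R); lia.
    have : ((2 * J)%:R : C) != 0 by rewrite pnatr_eq0; lia.
    by move: (2 * J)%:R => z h; field.
  by rewrite opprB addrAC addrK.
have [K hK] := parity_coef1_bounded R c.
have cv : clim (fun J => \sum_(1 <= m < N * J) coef 1 m * g J m) (kappa * zeta_parity R c 1).
  apply: (@tannery R (fun J m => coef 1 m * g J m) (fun m => coef 1 m * (kappa / m%:R))
     (K * root_term_bound R n) (fun J => N * J)%N).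
  - move=> m m0; have := climMl (coef 1 m) (climB (@root_term_lim R n m m0) (clim_cst_div (4^-1 : C))).
    rewrite subr0; apply: (@clim_near _ _ _ _ 0) => J _.
    by rewrite /g natrM invfM.
  - move=> J A J0 A0; rewrite leq_eqVlt => /predU1P[->|AL].
      rewrite big_geq // normc0 divr_ge0 // mulr_ge0 ?root_term_bound_ge0 //.
      exact: le_trans (normc_ge0 _) (hK 0%N 0%N).
    have -> : \sum_(A <= m < N * J) coef 1 m * g J m =
       (0 +i* 1) * \sum_(A <= m < N * J) coef 1 m * (cot_term J m)%:C.
      rewrite mulr_sumr; apply: eq_big_nat => m /andP[Am mL].
      by rewrite gE //; [exact: mulrCA|lia].
    rewrite normcM [normc (0 +i* 1)]/= expr0n expr1n add0r sqrtr1 mul1r.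
    apply: le_trans (dirichlet_test _ _ _ AL) _.
    + by move=> k _; exact: hK.
    + by move=> m /andP[Am mL]; apply: cot_term_ge0 => //; lia.
    + by move=> m Am mL; apply: cot_term_dec => //; lia.
    rewrite -mulrA ler_wpM2l //; first exact: le_trans (normc_ge0 _) (hK 0%N 0%N).
    by apply: cot_term_le => //; lia.
  - by move=> J; rewrite -[X in (X <= _)%N]mul1n leq_mul2r orbT.
  have [_ h] := zeta_reg_parity R c Sh (ltn0Sn 0).
  have := climMl kappa h.
  apply: (@clim_near _ _ _ _ 0) => M _; rewrite mulr_sumr; apply: eq_bigr => m _.
  by rewrite expr1 mulrCA.
have cvL : clim (fun J => g J (N * J)%N) 0.
  have := climB (root_term_mid_lim (ltn0Sn 0)) (clim_cst_div (4^-1 : C)); rewrite subr0.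
  by apply: (@clim_near _ _ _ _ 0) => J _; rewrite /g expr1 natrM invfM.
(* For [c = 0] the class contains the index 0, which the sum from 1 leaves out; hence the correction
   by 1/(4J). *)
have cvc : clim (fun J => 2^-1 - ((c == 0)%:R / 4) / J%:R) (2^-1 : C).
  rewrite -[X in clim _ X]subr0; apply: climB; [exact: clim_cst|exact: clim_cst_div].
have := climD cvc (climD cv (climMl (c == 0)%:R cvL)).
rewrite mulr0 addr0; apply: (@clim_near _ _ _ _ 1) => J J0.
rewrite /root_sum drop_index0; last by rewrite root_term0 expr1.
have -> : \sum_(1 <= k < 2 * (N * J) | k == c %[mod N]) b J k ^+ 1 =
   \sum_(1 <= k < 2 * (N * J) | (k == c %[mod N])%N) (4 * J)%:R^-1
   + \sum_(1 <= k < 2 * (N * J) | (k == c %[mod N])%N) g J k.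
  by rewrite -big_split /=; apply: eq_bigr => k _; rewrite expr1 /g addrC subrK.
congr (_ + _).
  have e : \sum_(0 <= k < 2 * (N * J) | (k == c %[mod N])%N) (4 * J)%:R^-1 = 2^-1 :> C.
    rewrite mulnCA sum_progression sumr_const card_ord -[LHS]mulr_natl natrM.
    have -> : ((4 * J)%:R : C) = 2 * (2 * J%:R) by rewrite !natrM; ring.
    have : (J%:R : C) != 0 by rewrite pnatr_eq0 -lt0n.
    by move: (J%:R : C) => z z0; field.
  rewrite -e big_mkcond big_ltn; last by rewrite muln_gt0 /= muln_gt0.
  rewrite -big_mkcond /= mod0n modn_small // eq_sym.
  rewrite addrAC -[RHS]add0r; congr (_ + _).
  have -> : ((4 * J)%:R : C) = 4 * J%:R by rewrite natrM.
  rewrite (_ : (nat_of_ord c == 0%N) = (c == 0)) // invfM.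
  by case: (c == 0); rewrite ?mul1r ?mul0r subrr.
rewrite sum_fold //; congr (_ + _); apply: eq_big_nat => m /andP[m0 mL].
rewrite gfold; [|by []|by lia].
by rewrite /parity_coef expr1 mulN1r mulrN mulrBl.
Qed.

Definition parity_limit p : C := (p == 1%N)%:R / 2 + kappa ^+ p * zeta_parity R c p.

Lemma root_sum_lim p : (0 < p)%N -> clim (root_sum p) (parity_limit p).
Proof.
case: p => [//|[|p]] _; rewrite /parity_limit /=.
  by rewrite mul1r expr1; exact: root_sum_lim1.
by rewrite mul0r add0r; exact: root_sum_lim_gt1.
Qed.

Lemma binomial_lim d k :
  clim (fun J => 'C(2 * J - d, k)%:R / (2 * J)%:R ^+ k) (k`!%:R^-1 : C).
Proof.
elim: k => [|k IH].
  apply: (@clim_near _ (fun=> 1) _ _ 0) => [M _|]; first by rewrite bin0 expr0 divr1.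
  by rewrite fact0 invr1; exact: clim_cst.
have h : clim (fun J => k.+1%:R^-1 * (1 - ((d + k)%:R / 2) / J%:R)) (k.+1%:R^-1 * (1 - 0) : C).
  by apply/climMl/climB; [exact: clim_cst|exact: clim_cst_div].
have := climM h IH; rewrite subr0 mulr1 -invfM -natrM -factS.
apply: (@clim_near _ _ _ _ (d + k).+1) => J hJ.
have J0 : (J%:R : C) != 0 by rewrite pnatr_eq0; lia.
have k0 : (k.+1%:R : C) != 0 by rewrite pnatr_eq0.
have e : k.+1%:R * 'C(2 * J - d, k.+1)%:R = (2 * J%:R - (d + k)%:R) * 'C(2 * J - d, k)%:R :> C.
  rewrite -[2 * J%:R]natrM -natrB; last by lia.
  by rewrite -!natrM mul_bin_left; congr (_ * _)%:R; lia.
apply: (mulfI k0); rewrite !mulrA e mulfV // mul1r exprS natrM.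
have z0 : (2 * J%:R : C) ^+ k != 0 by rewrite expf_neq0 // mulf_neq0 // pnatr_eq0.
move: ('C(_, _)%:R) ((2 * J%:R) ^+ k) z0 => x z z0.
by field; rewrite J0 z0.
Qed.

Lemma half_angle_mod J m k : (0 < J)%N -> (m = k %[mod N])%N ->
  cexp (half_angle R n J m *+ 2) ^+ (2 * J) = eta ^+ k.
Proof.
move=> J0 mk; have -> : eta ^+ k = eta ^+ m :> C by apply/eqP; rewrite eta_eq mk.
rewrite cexpMn eta_cexp; congr cexp.
rewrite -!mulrnA -[_ *+ (_ * _)]mulr_natr /half_angle !natrM.
have : (J%:R : R) != 0 by rewrite pnatr_eq0 -lt0n.
have : (N%:R : R) != 0 by rewrite pnatr_eq0.
by move: (J%:R : R) (N%:R : R) (pi : R) => x y z hx hy; field; rewrite hx hy.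
Qed.

(** The limit of [root_power_sums] for M = 2J. It says that the Laurent series with polar part 1/t
    (if c = 0) and coefficients [(-1) ^+ i * parity_limit i.+1] of t^i is e^t/(e^t - eta^c). *)
Lemma parity_relation k :
  k`!%:R^-1 = (c == 0)%:R * (k.+1)`!%:R^-1 + \sum_(i < k.+1)
    (-1) ^+ i * parity_limit i.+1 * ((k - i)`!%:R^-1 - eta ^+ c *+ (k - i == 0)%N) :> C.
Proof.
apply: clim_unique; first exact: (binomial_lim 1 k).
have h2 i : (i < k.+1)%N -> clim (fun J => (-1) ^+ i * root_sum i.+1 J *
    ('C(2 * J - 0, k - i)%:R / (2 * J)%:R ^+ (k - i) - eta ^+ c *+ (k - i == 0)%N))
   ((-1) ^+ i * parity_limit i.+1 * ((k - i)`!%:R^-1 - eta ^+ c *+ (k - i == 0)%N)).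
  move=> ik; apply: climM; first by apply/climMl/root_sum_lim.
  by apply: climB (binomial_lim 0 _) (clim_cst _).
have := climD (climMl (c == 0)%:R (binomial_lim 0 k.+1))
  (@clim_sum R 'I_k.+1 (index_enum _) predT _ _ (fun i _ => h2 i (ltn_ord i))).
apply: (@clim_near _ _ _ _ 1) => J J0; rewrite !subn0 subn1.
have M0 : (0 < 2 * J)%N by rewrite muln_gt0.
rewrite (@root_power_sums _ (2 * J) (fun j => cexp (half_angle R n J (c + N * j) *+ 2)) (eta ^+ c)) //.
- congr (_ + _).
    rewrite mulrC; congr (_ * _).
    (* Counting the roots equal to 1: a positive index has its half angle strictly between 0 and pi,
       so only index 0 qualifies. *)
    rewrite -(sum_progression (fun k => (cexp (half_angle R n J k *+ 2) == 1)%:R)) mulnCA.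
    rewrite big_mkcond big_ltn ?muln_gt0 //= big_nat_cond big1 ?addr0; last first.
      move=> m /andP[/andP[m0 mL] _]; rewrite (negbTE (cexp_neq1 _)) ?if_same //.
      have := half_angle_gt0 R n J0 m0; have : half_angle R n J m < pi.
        rewrite /half_angle ltr_pdivrMr; last by rewrite ltr0n; lia.
        by rewrite ltr_pM2l ?pi_gt0 // ltr_nat.
      by rewrite mulr2n; lra.
    have -> : (0 == c %[mod N])%N = (c == 0) by rewrite mod0n modn_small // eq_sym.
    by rewrite /half_angle mulr0 mul0r mul0rn cexp0 eqxx; case: (c == 0).
  apply: eq_bigr => i _; congr (_ * _ * _).
  rewrite /root_sum mulnCA sum_progression; apply: eq_bigr => j _.
  by [].
- by rewrite pnatr_eq0 -lt0n.
- by move=> j _; apply: half_angle_mod => //; rewrite mulnC addnC modnMDl.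
move=> i /andP[i0 iM].
(* Consecutive roots of the class differ by the factor [eta] of level 2J, whose i-th power [z] is
   not 1 for 0 < i < 2J. The sum of the i-th powers is thus a vanishing geometric sum. *)
pose z := Defs.eta R (2 * J).-1 ^+ i.
have M1 : ((2 * J).-1.+1 = 2 * J)%N by rewrite prednK.
have zn1 : z != 1 by rewrite eta_eq1 M1 gtnNdvd.
have zM : z ^+ (2 * J) = 1 by rewrite /z -exprM [(i * _)%N]mulnC exprM -[X in _ ^+ X ^+ i]M1 etaXN expr1n.
have -> : \sum_(j < 2 * J) cexp (half_angle R n J (c + N * j) *+ 2) ^+ i =
   cexp (half_angle R n J c *+ 2) ^+ i * \sum_(j < 2 * J) z ^+ j.
  rewrite mulr_sumr; apply: eq_bigr => j _.
  rewrite -[z ^+ j]exprM [(i * j)%N]mulnC exprM eta_cexp -exprMn -cexpD; congr (cexp _ ^+ i).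
  rewrite M1 /half_angle -[(pi * _ / _) *+ 2]mulr_natl -[(pi * c%:R / _) *+ 2]mulr_natl !natrM natrD natrM.
  have : (J%:R : R) != 0 by rewrite pnatr_eq0 -lt0n.
  have : (N%:R : R) != 0 by rewrite pnatr_eq0.
  by move: (J%:R : R) (N%:R : R) (pi : R) => x y w hx hy; field; rewrite hx hy.
have /eqP : (z - 1) * \sum_(j < 2 * J) z ^+ j = 0 by rewrite -subrX1 zM subrr.
by rewrite mulf_eq0 subr_eq0 (negbTE zn1) /= => /eqP ->; rewrite mulr0.
Qed.

End ParityLimit.

(** * Twisted Bernoulli summation *)

Section Summation.
Variables (K : numFieldType) (a : nat -> K) (omega : K).
(* In generating series: [(\sum_p a_p t ^ p) (e^t - omega) = t e^t]. *)
Hypothesis a_rel : forall p, \sum_(i < p.+1) a i / (p - i)`!%:R - omega * a p =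
  if p is p'.+1 then p'`!%:R^-1 else 0.

Definition bernoulli_sum d (P : {poly K}) v := \sum_(p < d) a p * P^`(p).[v].

Let fact0' m : (m`!%:R : K) != 0.
Proof. by rewrite pnatr_eq0 -lt0n fact_gt0. Qed.

Lemma derivn_taylor d (P : {poly K}) i v : (size P <= d + i)%N ->
  P^`(i).[v + 1] = \sum_(j < d) P^`(i + j).[v] / j`!%:R.
Proof.
move=> sP; rewrite nderiv_taylor; last exact: mulrC.
have sd : (size P^`(i) <= d)%N.
  apply/leq_sizeP => m dm; rewrite coef_derivn nth_default ?mul0rn //.
  by rewrite (leq_trans sP) // addnC leq_add2l.
rewrite (big_ord_widen d (fun j => P^`(i)^`N(j).[v] * 1 ^+ j) sd) big_mkcond.
apply: eq_bigr => j _; rewrite expr1n mulr1.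
have -> : P^`(i + j) = P^`(i)^`N(j) *+ j`!.
  by rewrite -nderivn_def /derivn addnC iterD.
rewrite hornerMn -[_ *+ _]mulr_natr mulfK //.
case: ltnP => // sj; rewrite nderivn_poly0 ?horner0 //.
Qed.

(** With D the derivation and a(D) the sum of the a_p D^p, this is a(D)(e^D - omega) = D e^D applied
    to [P]: Taylor's formula makes e^D the shift by 1, and [a_rel] is the identity of power
    series. *)
Lemma bernoulli_sum_step d (P : {poly K}) v : (size P <= d)%N ->
  bernoulli_sum d P (v + 1) - omega * bernoulli_sum d P v = P^`().[v + 1].
Proof.
move=> sP; rewrite /bernoulli_sum.
have P0 p x : (d <= p)%N -> P^`(p).[x] = 0.
  by move=> dp; rewrite derivn_poly0 ?horner0 // (leq_trans sP).
transitivity (\sum_(p < d) (\sum_(i < p.+1) a i / (p - i)`!%:R - omega * a p) * P^`(p).[v]).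
  under [RHS]eq_bigr do rewrite mulrBl.
  rewrite sumrB mulr_sumr; congr (_ - _); last by apply: eq_bigr => p _; rewrite mulrA.
  transitivity (\sum_(i < d) \sum_(p < d | (i <= p)%N) a i / (p - i)`!%:R * P^`(p).[v]).
    apply: eq_bigr => i _.
    rewrite (@derivn_taylor d) ?(leq_trans sP) ?leq_addr // mulr_sumr.
    rewrite -(big_mkord xpredT (fun j => a i * (P^`(i + j).[v] / j`!%:R))).
    rewrite -(big_mkord (fun p => (i <= p)%N) (fun p => a i / (p - i)`!%:R * P^`(p).[v])).
    transitivity (\sum_(i <= p < d) a i / (p - i)`!%:R * P^`(p).[v]); last first.
      by rewrite [LHS](big_nat_widenl _ 0).
    rewrite (@big_cat_nat _ _ _ (d - i)%N) //=; last exact: leq_subr.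
    rewrite [X in _ + X]big_nat_cond [X in _ + X]big1 ?addr0; last first.
      by move=> j /andP[/andP[jd _] _]; rewrite P0 ?mul0r ?mulr0 //; lia.
    rewrite -[in RHS](add0n i) big_addn; apply: eq_bigr => j _.
    by rewrite addnK addnC; ring.
  rewrite (exchange_big_dep predT) //=; apply: eq_bigr => p _.
  rewrite mulr_suml -(big_mkord (fun i => (i <= p)%N) (fun i => a i / (p - i)`!%:R * P^`(p).[v])).
  rewrite -(big_mkord xpredT (fun i => a i / (p - i)`!%:R * P^`(p).[v])).
  by rewrite [RHS](big_nat_widen _ _ d) //; apply: eq_bigl => i; rewrite ltnS.
under eq_bigr do rewrite a_rel.
case: d sP P0 => [|d] sP P0; last first.
  rewrite big_ord_recl mul0r add0r -derivn1 (@derivn_taylor d) ?addn1 //.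
  by apply: eq_bigr => i _; rewrite /= mulrC.
rewrite big_ord0; move: sP; rewrite leqn0 size_poly_eq0 => /eqP ->.
by rewrite deriv0 horner0.
Qed.

Lemma bernoulli_summation d (P : {poly K}) w : omega != 0 -> (size P <= d)%N ->
  \sum_(1 <= v < w.+1) omega ^- v * P^`().[v%:R] =
  omega ^- w * bernoulli_sum d P w%:R - bernoulli_sum d P 0.
Proof.
move=> o0 sP; have -> : bernoulli_sum d P 0 = omega ^- 0 * bernoulli_sum d P 0%:R.
  by rewrite expr0 invr1 mul1r.
rewrite -(telescope_sumr (fun v => omega ^- v * bernoulli_sum d P v%:R)) // big_add1 /=.
apply: eq_bigr => v _; rewrite -[v.+1]addn1 natrD -(bernoulli_sum_step _ sP).
rewrite mulrBr mulrA; congr (_ - _ * _).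
by rewrite addn1 exprS invfM mulrAC mulVf // mul1r.
Qed.

Definition beta_poly (w : K) s r : {poly K} :=
  (s`!%:R * r`!%:R)^-1 *: ('X^s * (w%:P - 'X) ^+ r).

(** The antiderivative obtained by repeated integration by parts. It vanishes at 0, and at [w] only
    the last term is left, which gives the Beta integral in closed form. *)
Definition beta_primitive (w : K) s r : {poly K} :=
  \sum_(j < r.+1) beta_poly w (s.+1 + j) (r - j).

Lemma size_beta_poly w s r : (size (beta_poly w s r) <= (s + r).+1)%N.
Proof.
apply: leq_trans (size_scale_leq _ _) _; apply: leq_trans (size_polyMleq _ _) _.
rewrite size_polyXn /=; apply: leq_trans (leq_add (leqnn s) (size_poly_exp_leq _ _)) _.
have : (size (w%:P - 'X)%R <= 2)%N.
  by apply: leq_trans (size_polyD _ _) _; rewrite size_polyN size_polyX geq_max size_polyC; case: eqP.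
by case: (size _) => [|[|[|]]] //= _; lia.
Qed.

Lemma size_beta_primitive w s r : (size (beta_primitive w s r) <= (s + r).+2)%N.
Proof.
apply: leq_trans (size_sum _ _ _) _; apply/bigmax_leqP => j _.
apply: leq_trans (size_beta_poly _ _ _) _; have := ltn_ord j; lia.
Qed.

Lemma deriv_beta_primitive w s r : (beta_primitive w s r)^`() = beta_poly w s r.
Proof.
rewrite /beta_primitive; elim: r s => [|r IH] s.
  rewrite big_ord1 addn0 /beta_poly !expr0 !mulr1 derivZ derivXn /=.
  rewrite -[X in _ *: X]scaler_nat scalerA factS natrM; congr (_ *: _).
  by rewrite invfM mulrAC mulVf ?mul1r // pnatr_eq0.
rewrite big_ord_recl derivD.
have -> : \sum_(i < r.+1) beta_poly w (s.+1 + lift ord0 i) (r.+1 - lift ord0 i) =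
    \sum_(i < r.+1) beta_poly w (s.+2 + i) (r - i).
  by apply: eq_bigr => i _; rewrite /= /bump leq0n add1n subSS addnS addSn.
rewrite IH addn0 subn0 /beta_poly derivZ derivM derivXn deriv_exp derivB derivC derivX sub0r.
set Y := w%:P - 'X.
transitivity (((s.+1)`!%:R * (r.+1)`!%:R)^-1 *:
    (s.+1%:R *: ('X^s * Y ^+ r.+1) - r.+1%:R *: ('X^(s.+1) * Y ^+ r))
  + ((s.+1)`!%:R * r`!%:R)^-1 *: ('X^(s.+1) * Y ^+ r)).
  congr (_ *: _ + _); rewrite /= !scaler_nat mulN1r mulNrn mulrN.
  by rewrite mulrnAl mulrnAr.
have -> : (s.+1)`!%:R = s.+1%:R * s`!%:R :> K by rewrite factS natrM.
have -> : (r.+1)`!%:R = r.+1%:R * r`!%:R :> K by rewrite factS natrM.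
move: ('X^s * _) ('X^(s.+1) * _) => A B.
rewrite scalerBr !scalerA.
have s0 : (s.+1%:R : K) != 0 by rewrite pnatr_eq0.
have r0 : (r.+1%:R : K) != 0 by rewrite pnatr_eq0.
move: (s.+1%:R) (r.+1%:R) s0 r0 => x y x0 y0.
have -> : (x * s`!%:R * (y * r`!%:R))^-1 * y = (x * s`!%:R * r`!%:R)^-1.
  by field; rewrite !fact0' x0 y0.
have -> : (x * s`!%:R * (y * r`!%:R))^-1 * x = (s`!%:R * (y * r`!%:R))^-1.
  by field; rewrite !fact0' x0 y0.
by rewrite subrK.
Qed.

Lemma beta_primitive_at0 w s r : (beta_primitive w s r).[0] = 0.
Proof.
rewrite /beta_primitive horner_sum big1 // => j _.
by rewrite /beta_poly hornerZ hornerM hornerXn expr0n addSn /= mul0r mulr0.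
Qed.

Lemma beta_primitive_at_end w s r :
  (beta_primitive w s r).[w] = w ^+ (s + r).+1 / (s + r).+1`!%:R.
Proof.
rewrite /beta_primitive horner_sum big_ord_recr /= big1 ?add0r; last first.
  move=> j _; rewrite /beta_poly hornerZ hornerM horner_exp !hornerE subrr.
  by rewrite expr0n subn_eq0 leqNgt ltn_ord /= !mulr0.
by rewrite subnn /beta_poly hornerZ hornerM expr0 hornerXn hornerC fact0 !mulr1 addSn mulrC.
Qed.

Lemma coef_sub_exp (w : K) r m :
  ((w%:P - 'X) ^+ r)`_m = (-1) ^+ m * 'C(r, m)%:R * w ^+ (r - m).
Proof.
rewrite exprDn coef_sum.
have cf i : (w%:P ^+ (r - i) * (- 'X) ^+ i *+ 'C(r, i))`_m =
    ((-1) ^+ i * 'C(r, i)%:R * w ^+ (r - i)) *+ (m == i).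
  rewrite coefMn -polyC_exp -scaleN1r exprZn coefCM coefZ coefXn.
  by case: (m == i); rewrite ?mulr0 ?mul0rn // mulr1 mulr1n -mulr_natr; ring.
under eq_bigr do rewrite cf.
have [mr|rm] := leqP m r.
  rewrite (bigD1 (Ordinal (mr : m < r.+1)%N)) //= eqxx mulr1n big1 ?addr0 // => i.
  by move=> im; rewrite (_ : m == i = false) //; apply/eqP => e; case/eqP: im; apply: val_inj.
rewrite bin_small // mulr0 mul0r big1 // => i _.
by rewrite gtn_eqF ?mulr0n // (leq_trans (ltn_ord i)).
Qed.

Lemma coef_beta_poly w s r i : (i <= s + r)%N ->
  (beta_poly w s r)`_i *+ i`! =
  (-1) ^+ (i + s) * 'C(i, s)%:R * w ^+ (s + r - i) / (s + r - i)`!%:R.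
Proof.
move=> ir; rewrite /beta_poly coefZ coefXnM; case: ltnP => [is_|si].
  by rewrite mulr0 mul0rn bin_small // mulr0 !mul0r.
have [m mE] : exists m, i = (m + s)%N by exists (i - s)%N; rewrite subnK.
have mr : (m <= r)%N by lia.
rewrite coef_sub_exp {}mE addnK.
have -> : (s + r - (m + s) = r - m)%N by lia.
have -> : (-1) ^+ (m + s + s) = (-1) ^+ m :> K by rewrite -addnA exprD addnn -mul2n exprM sqrrN !expr1n mulr1.
rewrite -[_ *+ (m + s)`!]mulr_natr !mulrA.
have h1 : ('C(m + s, s)%:R : K) * (s`!%:R * m`!%:R) = (m + s)`!%:R.
  by rewrite -!natrM -(bin_fact (leq_addl m s)) addnK.
have h2 : ('C(r, m)%:R : K) * (m`!%:R * (r - m)`!%:R) = r`!%:R.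
  by rewrite -!natrM bin_fact.
rewrite -h1 -h2; have := fact0' r; rewrite -{1}h2 mulf_eq0 negb_or => /andP[c0 _].
by field; rewrite !fact0' c0.
Qed.

Lemma derivn_at0 (p : {poly K}) i : p^`(i).[0] = p`_i *+ i`!.
Proof. by rewrite horner_coef0 coef_derivn addn0 ffactnn. Qed.

Lemma derivn_beta_at0 w s r i : (i <= s + r)%N ->
  (beta_poly w s r)^`(i).[0] =
  (-1) ^+ (i + s) * 'C(i, s)%:R * w ^+ (s + r - i) / (s + r - i)`!%:R.
Proof. by move=> ir; rewrite derivn_at0 coef_beta_poly. Qed.

Lemma beta_poly_reflect w s r : beta_poly w s r = beta_poly w r s \Po (w%:P - 'X).
Proof.
rewrite /beta_poly linearZ /= rmorphM /= !rmorphXn /= rmorphB /= comp_polyC comp_polyX.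
rewrite opprB addrCA subrr addr0 ['X^s * _]mulrC; congr (_ *: _).
by rewrite mulrC.
Qed.

Lemma derivn_reflect (p : {poly K}) w i :
  (p \Po (w%:P - 'X))^`(i) = (-1) ^+ i *: (p^`(i) \Po (w%:P - 'X)).
Proof.
elim: i => [|i IH]; first by rewrite expr0 scale1r.
rewrite derivnS IH derivZ deriv_comp -derivnS derivB derivC derivX sub0r.
by rewrite mulrN1 scalerN exprS mulN1r scaleNr.
Qed.

Lemma derivn_beta_at_end w s r i : (i <= s + r)%N ->
  (beta_poly w s r)^`(i).[w] =
  (-1) ^+ r * 'C(i, r)%:R * w ^+ (s + r - i) / (s + r - i)`!%:R.
Proof.
move=> ir; rewrite beta_poly_reflect derivn_reflect hornerZ horner_comp !hornerE subrr.
rewrite derivn_beta_at0; last by rewrite addnC.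
rewrite [(r + s)%N]addnC !mulrA -exprD addnA addnn -mul2n exprD exprM sqrrN.
by rewrite !expr1n mul1r.
Qed.

(** The term with [a 0] is the Beta integral. In the others the derivatives at the two ends appear:
    [beta_poly] vanishes to order r at [w] and to order s at 0, whence the binomial coefficients
    'C(i, r) and 'C(i, s). *)
Lemma twisted_beta_sum w s r : omega != 0 ->
  \sum_(1 <= v < w.+1) omega ^- v * (beta_poly w%:R s r).[v%:R] =
  omega ^- w * a 0%N * w%:R ^+ (s + r).+1 / (s + r).+1`!%:R +
  \sum_(i < (s + r).+1) a i.+1 * (w%:R ^+ (s + r - i) / (s + r - i)`!%:R) *
     (omega ^- w * (-1) ^+ r * 'C(i, r)%:R - (-1) ^+ (i + s) * 'C(i, s)%:R).
Proof.
move=> o0; have := bernoulli_summation w o0 (size_beta_primitive w%:R s r).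
rewrite deriv_beta_primitive => ->.
rewrite /bernoulli_sum [in X in X - _]big_ord_recl [in X in _ - X]big_ord_recl.
rewrite !derivn0 beta_primitive_at0 beta_primitive_at_end.
rewrite mulr0 add0r mulrDr -addrA !mulrA; congr (_ + _).
rewrite mulr_sumr -sumrB; apply: eq_bigr => i _.
have ir : (i <= s + r)%N by rewrite -ltnS.
have -> : (lift ord0 i : nat) = i.+1 by [].
rewrite derivSn deriv_beta_primitive derivn_beta_at_end // derivn_beta_at0 //.
ring.
Qed.

End Summation.

(** * The finite sums on the diagonal u1 = u2 *)

Section DiagonalCoefficient.
Variables (R : realType) (n : nat).
Local Notation C := R[i].
Local Notation N := n.+1.
Local Notation eta := (Defs.eta R n).
Implicit Types a b c : 'I_N.

Local Opaque csum.

Let N0 : (N%:R : C) != 0. Proof. by rewrite pnatr_eq0. Qed.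
Let fact0' m : (m`!%:R : C) != 0.
Proof. by rewrite pnatr_eq0 -lt0n fact_gt0. Qed.

(* The coefficients of [t ^ (p - 1)] in [e^t / (e^t - eta^c)]. *)
Definition bernoulli_coef c p : C :=
  if p is i.+1 then (-1) ^+ i * parity_limit R c p else (c == 0)%:R.

Lemma bernoulli_coef_rel c p :
  \sum_(i < p.+1) bernoulli_coef c i / (p - i)`!%:R - eta ^+ c * bernoulli_coef c p =
  if p is p'.+1 then p'`!%:R^-1 else 0.
Proof.
case: p => [|k].
  rewrite big_ord1 fact0 divr1 /=; case: eqVneq => [->|_].
    by rewrite expr0 mul1r subrr.
  by rewrite mulr0 subrr.
rewrite big_ord_recl subn0 (parity_relation R c k) -addrA; congr (_ + _).
under [RHS]eq_bigr do rewrite mulrBr.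
rewrite sumrB; congr (_ - _).
rewrite big_ord_recr /= big1 ?add0r; last first.
  by move=> i _; rewrite subn_eq0 leqNgt ltn_ord mulr0n mulr0.
by rewrite subnn eqxx mulr1n mulrC.
Qed.

(** The summand of [tg a h] at (u, w), which does not depend on u. Identities for the q-series thus
    become identities between these summands, combined with rearrangements of the index set. *)
Definition gcoef a h w : C :=
  (-1) ^+ h / (N%:R ^+ h * (h.-1)`!%:R) * (eta ^+ (a * w) * w%:R ^+ h.-1).

(** After the factor eta^(a w) is taken out, the characters leave omega^(-v) with omega = eta^(a -
    b), and the powers of v and w - v form a [beta_poly]. In [twisted_beta_sum] the coefficient of
    index 0 yields the diagonal term for a = b, and the others yield the zeta values. *)
Lemma diagonal_coef a b r s w : (0 < r)%N -> (0 < s)%N -> (0 < w)%N ->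
  \sum_(1 <= v < w) gcoef a r (w - v) * gcoef b s v =
  gcoef a (r + s) w *+ (a == b)
  + (2 * N%:R)^-1 * (gcoef a r w *+ (s == 1%N) + gcoef b s w *+ (r == 1%N))
  + \sum_(1 <= p < r + s) twopii R ^- p * zeta_parity R (a - b) p *
      ((-1) ^+ s * 'C(p - 1, s - 1)%:R * gcoef a (r + s - p) w
       + (-1) ^+ (p + r) * 'C(p - 1, r - 1)%:R * gcoef b (r + s - p) w).
Proof.
case: r s => [//|r] [//|s] _ _ w0.
have o0 : eta ^+ (a - b)%R != 0 := eta_neq0 R n (a - b)%R.
have ok v : (v <= w)%N -> eta ^+ (a * w) * (eta ^+ (a - b)%R) ^- v =
    eta ^+ (a * (w - v)) * eta ^+ (b * v).
  move=> vw; rewrite -exprM eta_subZ invf_div.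
  have -> : eta ^+ (a * w) = eta ^+ (a * (w - v)) * eta ^+ (a * v) :> C.
    by rewrite -exprD -mulnDr subnK.
  by rewrite -mulrA; congr (_ * _); rewrite mulrC divfK // eta_neq0.
pose K0 : C := (-1) ^+ (r + s) / N%:R ^+ (r.+1 + s.+1).
pose Q := beta_poly (w%:R : C) s r.
have QE v : (v <= w)%N -> Q.[v%:R] = v%:R ^+ s * (w - v)%:R ^+ r / (s`!%:R * r`!%:R).
  move=> vw; rewrite /Q /beta_poly hornerZ hornerM hornerXn horner_exp hornerD hornerN.
  by rewrite hornerC hornerX natrB // mulrC.
have sgnE m : (-1) ^+ m.+1 = - (-1) ^+ m :> C by rewrite exprS mulN1r.
have assoc4 (x y z t : C) : x * y * (z * t) = x * ((y * z) * t) by rewrite !mulrA.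
have assoc5 (x y z t u f : C) : x * y * (z * t * u * f) = x * ((y * z) * t * u * f).
  by rewrite !mulrA.
have term v : (v <= w)%N -> gcoef a r.+1 (w - v) * gcoef b s.+1 v =
    K0 * eta ^+ (a * w) * ((eta ^+ (a - b)%R) ^- v * Q.[v%:R]).
  move=> vw; rewrite [RHS]assoc4 ok // QE // /gcoef /K0 /= !sgnE !exprD.
  have := expf_neq0 r.+1 N0; have := expf_neq0 s.+1 N0.
  move: (N%:R ^+ s.+1) (N%:R ^+ r.+1) => x y x0 y0.
  by field; rewrite !fact0' x0 y0.
(* The summation formula includes the endpoint v = w, where [gcoef a r.+1 0] is nonzero only for
   [r = 0], being then -1/N. Removing it adds [gcoef b s.+1 w] / N; the constant 1/2 of
   [parity_limit] takes back half of that, and for [s = 0] supplies the symmetric term in [a]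
   directly. *)
have -> : \sum_(1 <= v < w) gcoef a r.+1 (w - v) * gcoef b s.+1 v =
    \sum_(1 <= v < w.+1) gcoef a r.+1 (w - v) * gcoef b s.+1 v
    - gcoef a r.+1 0 * gcoef b s.+1 w.
  by rewrite big_nat_recr //= subnn addrK.
have -> : \sum_(1 <= v < w.+1) gcoef a r.+1 (w - v) * gcoef b s.+1 v =
   K0 * eta ^+ (a * w) * \sum_(1 <= v < w.+1) (eta ^+ (a - b)%R) ^- v * Q.[v%:R].
  by rewrite mulr_sumr; apply: eq_big_nat => v /andP[_ vw]; exact: term.
rewrite (twisted_beta_sum (bernoulli_coef_rel (a - b)) w s r o0) mulrDr.
have okw : eta ^+ (a * w) * (eta ^+ (a - b)%R) ^- w = eta ^+ (b * w).
  by rewrite ok // subnn muln0 expr0 mul1r.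
have diag : K0 * eta ^+ (a * w) * ((eta ^+ (a - b)%R) ^- w * bernoulli_coef (a - b) 0 *
    w%:R ^+ (s + r).+1 / (s + r).+1`!%:R) = gcoef a (r.+1 + s.+1) w *+ (a == b).
  rewrite [LHS]assoc5 okw /= subr_eq0.
  case: eqVneq => [->|_]; last by rewrite mulr0n !(mul0r, mulr0).
  rewrite [true%:R]mulr1n mulr1 [_ *+ true]mulr1n /gcoef /K0 addSn addnS /= !sgnE opprK [(s + r)%N]addnC.
  have := expf_neq0 (r + s).+2 N0; move: (N%:R ^+ (r + s).+2) => x x0.
  by field; rewrite fact0' x0.
rewrite {}diag -!addrA; congr (_ + _).
rewrite mulr_sumr.
have parity_term i : (i < (s + r).+1)%N ->
   K0 * eta ^+ (a * w) * (bernoulli_coef (a - b) i.+1 *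
     (w%:R ^+ (s + r - i) / (s + r - i)`!%:R) *
     ((eta ^+ (a - b)%R) ^- w * (-1) ^+ r * 'C(i, r)%:R - (-1) ^+ (i + s) * 'C(i, s)%:R)) =
   K0 / 2 * (w%:R ^+ (s + r) / (s + r)`!%:R *
     (eta ^+ (b * w) * (-1) ^+ r * (r == 0%N)%:R - eta ^+ (a * w) * (-1) ^+ s * (s == 0%N)%:R))
      *+ (i == 0%N)
   + twopii R ^- i.+1 * zeta_parity R (a - b) i.+1 *
      ((-1) ^+ s.+1 * 'C(i, s)%:R * gcoef a (r.+1 + s.+1 - i.+1) w
       + (-1) ^+ (i.+1 + r.+1) * 'C(i, r)%:R * gcoef b (r.+1 + s.+1 - i.+1) w).
  move=> ir; set h := (s + r - i)%N.
  have hE : (s + r = h + i)%N by rewrite /h subnK.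
  have -> : (r.+1 + s.+1 - i.+1 = h.+1)%N by lia.
  clearbody h.
  have -> : K0 * eta ^+ (a * w) * (bernoulli_coef (a - b) i.+1 * (w%:R ^+ h / h`!%:R) *
     ((eta ^+ (a - b)%R) ^- w * (-1) ^+ r * 'C(i, r)%:R - (-1) ^+ (i + s) * 'C(i, s)%:R)) =
    K0 * bernoulli_coef (a - b) i.+1 * (w%:R ^+ h / h`!%:R) *
     (eta ^+ (b * w) * (-1) ^+ r * 'C(i, r)%:R
      - eta ^+ (a * w) * (-1) ^+ (i + s) * 'C(i, s)%:R).
    by rewrite -okw; ring.
  have split4 (x y z t u v : C) : x * (y * (z + t)) * u * v =
      x * (y * z) * u * v + x * (y * t) * u * v by ring.
  rewrite [bernoulli_coef _ _]/= /parity_limit eqSS split4; congr (_ + _).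
    case: eqVneq hE => [-> |_] hE; last by rewrite mul0r !mulr0 !mul0r mulr0n.
    rewrite hE addn0 [true%:R]mulr1n [_ *+ true]mulr1n expr0 !bin0n add0n; ring.
  have sh : (-1) ^+ h = (-1) ^+ r * (-1) ^+ s * (-1) ^+ i :> C.
    rewrite -!exprD (_ : (r + s + i = h + 2 * i)%N); last by lia.
    by rewrite exprD exprM sqrrN !expr1n mulr1.
  have Nh : N%:R ^+ (r.+1 + s.+1) = N%:R ^+ h.+1 * N%:R ^+ i.+1 :> C.
    by rewrite -exprD; congr (_ ^+ _); lia.
  rewrite /K0 /gcoef /= expr_div_n [(- N%:R) ^+ i.+1]exprNn Nh !exprD !sgnE sh.
  have t0 := expf_neq0 i.+1 (twopii_neq0 R).
  have := expf_neq0 h.+1 N0; have := expf_neq0 i.+1 N0.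
  move: (N%:R ^+ i.+1) (N%:R ^+ h.+1) (twopii R ^+ i.+1) t0 => x y t t0 x0 y0.
  have := fact0' h; move: (h`!%:R : C) => f f0.
  (* Fixing the three signs turns the claim into an identity of rational functions. *)
  have sq m : (-1 : C) ^+ m = 1 \/ (-1 : C) ^+ m = -1.
    by rewrite -signr_odd; case: (odd m); [right; rewrite expr1|left; rewrite expr0].
  move: ('C(i, r)%:R : C) ('C(i, s)%:R : C) (w%:R ^+ h : C) (zeta_parity R _ _ : C) => c1 c2 W Z.
  case: (sq i) => ->; case: (sq r) => ->; case: (sq s) => ->; field; rewrite f0 x0 y0 t0 //.
transitivity (- (gcoef a r.+1 0 * gcoef b s.+1 w) + K0 / 2 * (w%:R ^+ (s + r) / (s + r)`!%:R *
     (eta ^+ (b * w) * (-1) ^+ r * (r == 0%N)%:R - eta ^+ (a * w) * (-1) ^+ s * (s == 0%N)%:R)) +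
   \sum_(i < (s + r).+1) twopii R ^- i.+1 * zeta_parity R (a - b) i.+1 *
      ((-1) ^+ s.+1 * 'C(i, s)%:R * gcoef a (r.+1 + s.+1 - i.+1) w
       + (-1) ^+ (i.+1 + r.+1) * 'C(i, r)%:R * gcoef b (r.+1 + s.+1 - i.+1) w)).
  under eq_bigr => i _ do rewrite (parity_term _ (ltn_ord i)).
  rewrite big_split /= addrC -addrA; congr (_ + (_ + _)).
  by rewrite big_ord_recl /= mulr1n big1 ?addr0 // => i _; rewrite mulr0n.
congr (_ + _); last first.
  rewrite addSn big_add1 /= addnS big_mkord [(s + r)%N]addnC.
  by apply: eq_bigr => i _; rewrite !subSS !subn0.
rewrite /gcoef /K0 muln0 expr0 mul1r /= expr0n !eqSS [_ *+ (s == 0%N)]mulrb [_ *+ (r == 0%N)]mulrb.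
have := fact0' r; have := fact0' s; have := fact0' (s + r); have := N0.
move: (N%:R : C) => z z0; have := expf_neq0 r z0; have := expf_neq0 s z0.
case: (eqVneq r 0%N) => [->|r0]; case: (eqVneq s 0%N) => [->|s0] /=;
  rewrite ?fact0 ?add0n ?addn0 ?mulr0n ?mulr1n ?add1n ?addn1 /= !exprS ?expr0 => zs zr f1 f2 f3.
- by field; rewrite z0.
- by move: (z ^+ s) (s`!%:R : C) zs f2 => x f x0 f0; field; rewrite z0 x0 f0.
- by move: (z ^+ r) (r`!%:R : C) zr f3 => x f x0 f0; field; rewrite z0 x0 f0.
- by rewrite !(mulr0, mul0r, addr0, subr0, oppr0).
Qed.

End DiagonalCoefficient.

(** * Products of the q-series *)

Section QuadrupleSums.
Variable V : zmodType.
Implicit Types (H : nat -> V) (F G : nat -> nat -> nat -> nat -> V).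

Definition pair_sum m (f : nat -> nat -> V) : V :=
  \sum_(1 <= u < m.+1) \sum_(1 <= v < m.+1 | (u * v == m)%N) f u v.

(** All four indices run up to [m], and further conditions are put into the summand by [if];
    rearrangements then reduce to exchanging finite sums. *)
Definition quad_sum m F : V :=
  \sum_(1 <= u1 < m.+1) \sum_(1 <= u2 < m.+1) \sum_(1 <= v1 < m.+1)
    \sum_(1 <= v2 < m.+1 | (u1 * v1 + u2 * v2 == m)%N) F u1 u2 v1 v2.

Lemma eq_quad_sum m F G : (forall u1 u2 v1 v2, (0 < u1)%N -> (0 < u2)%N ->
    (0 < v1)%N -> (0 < v2)%N -> F u1 u2 v1 v2 = G u1 u2 v1 v2) ->
  quad_sum m F = quad_sum m G.
Proof.
move=> FG; apply: eq_big_nat => u1 /andP[? _]; apply: eq_big_nat => u2 /andP[? _].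
apply: eq_big_nat => v1 /andP[? _]; rewrite big_nat_cond [RHS]big_nat_cond.
by apply: eq_bigr => v2 /andP[/andP[? _] _]; exact: FG.
Qed.

Lemma quad_sumD m F G : quad_sum m (fun u1 u2 v1 v2 => F u1 u2 v1 v2 + G u1 u2 v1 v2) =
  quad_sum m F + quad_sum m G.
Proof.
rewrite /quad_sum -big_split; apply: eq_bigr => u1 _.
rewrite -big_split; apply: eq_bigr => u2 _.
by rewrite -big_split; apply: eq_bigr => v1 _; rewrite -big_split.
Qed.

Lemma quad_sum_swap m F : quad_sum m F = quad_sum m (fun u1 u2 v1 v2 => F u2 u1 v2 v1).
Proof.
rewrite /quad_sum exchange_big_nat; apply: eq_bigr => u1 _; apply: eq_bigr => u2 _.
rewrite (exchange_big_dep_nat xpredT) //; apply: eq_bigr => v1 _.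
by apply: eq_bigl => v2; rewrite addnC.
Qed.

Lemma quad_sum_lt_if m F (c : nat -> nat -> bool) :
  quad_sum m (fun u1 u2 v1 v2 => if c u1 u2 then F u1 u2 v1 v2 else 0) =
  \sum_(1 <= u1 < m.+1) \sum_(1 <= u2 < m.+1 | c u1 u2) \sum_(1 <= v1 < m.+1)
    \sum_(1 <= v2 < m.+1 | (u1 * v1 + u2 * v2 == m)%N) F u1 u2 v1 v2.
Proof.
apply: eq_bigr => u1 _; rewrite [RHS]big_mkcond; apply: eq_bigr => u2 _.
case: (c u1 u2) => //; rewrite big1 // => v1 _.
by rewrite big1.
Qed.

Lemma quad_sum_gt m F :
  quad_sum m (fun u1 u2 v1 v2 => if (u2 < u1)%N then F u1 u2 v1 v2 else 0) =
  \sum_(1 <= u1 < m.+1) \sum_(1 <= u2 < u1) \sum_(1 <= v1 < m.+1)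
    \sum_(1 <= v2 < m.+1 | (u1 * v1 + u2 * v2 == m)%N) F u1 u2 v1 v2.
Proof.
rewrite (quad_sum_lt_if m F (fun u1 u2 => (u2 < u1)%N)).
apply: eq_big_nat => u1 /andP[_ um].
by rewrite [RHS](big_nat_widen _ _ m.+1) // ltnW.
Qed.

(* Terms beyond [m] vanish, so that the summation range may be shifted. *)
Lemma sum_shift m v H : (forall x, (m < x)%N -> H x = 0) ->
  \sum_(1 <= x < m.+1 | (v < x)%N) H x = \sum_(1 <= d < m.+1) H (v + d)%N.
Proof.
move=> H0; transitivity (\sum_(v.+1 <= x < v + m.+1) H x); last first.
  rewrite -[in LHS](add1n v) big_addn addKn.
  by apply: eq_bigr => d _; rewrite addnC.
have [vm|mv] := leqP v m.
  rewrite [RHS](@big_cat_nat _ _ _ m.+1) //=; last by rewrite leq_addl.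
  rewrite [X in _ + X]big_nat_cond [X in _ + X]big1 ?addr0; last first.
    by move=> x /andP[/andP[mx _] _]; exact: H0.
  by rewrite [RHS](big_nat_widenl _ 1).
rewrite [RHS]big_nat_cond [RHS]big1; last first.
  by move=> x /andP[/andP[mx _] _]; apply: H0; exact: ltn_trans mx.
rewrite big_nat_cond big1 // => x /andP[/andP[_ xm] vx].
by move: (leq_ltn_trans (leq_trans mv (ltnW vx)) xm); rewrite ltnS ltnNge; lia.
Qed.

Lemma quad_sum_diag m F :
  quad_sum m (fun u1 u2 v1 v2 => if u1 == u2 then F u1 u2 v1 v2 else 0) =
  pair_sum m (fun u w => \sum_(1 <= v < w) F u u (w - v)%N v).
Proof.
rewrite (quad_sum_lt_if m F (fun u1 u2 => u1 == u2)).
apply: eq_big_nat => u /andP[u0 um].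
transitivity (\sum_(1 <= v1 < m.+1)
   \sum_(1 <= v2 < m.+1 | (u * v1 + u * v2 == m)%N) F u u v1 v2).
  rewrite [LHS]big_mkcond [LHS](bigD1_seq u) ?iota_uniq ?mem_index_iota ?u0 //= eqxx.
  by rewrite [X in _ + X]big1 ?addr0 // => j ju; rewrite eq_sym (negbTE ju).
rewrite (exchange_big_dep_nat xpredT) //=.
rewrite [RHS]big_mkcond.
transitivity (\sum_(1 <= w < m.+1) \sum_(1 <= v < m.+1 | (v < w)%N)
   (if (u * w == m)%N then F u u (w - v)%N v else 0)); last first.
  apply: eq_big_nat => w /andP[w0 wm].
  case: ifP => _; last by rewrite big1.
  by rewrite [RHS](big_nat_widen _ _ m.+1) // ltnW.
rewrite [RHS](exchange_big_dep_nat xpredT) //=; apply: eq_big_nat => v /andP[v0 vm].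
rewrite (@sum_shift m v (fun w => if (u * w == m)%N then F u u (w - v)%N v else 0)).
  rewrite big_mkcond; apply: eq_bigr => e _; rewrite addKn -mulnDr addnC.
  by [].
move=> x mx; case: eqP => // e; move: mx; rewrite -e => mx.
by have := leq_pmull x u0; rewrite leqNgt mx.
Qed.

(* Change of variables [(u1, u2, v1, v2) -> (u1 + u2, u2, v1, v2 - v1)]. *)
Lemma quad_sum_shuffle m F :
  quad_sum m (fun u1 u2 v1 v2 => if (v1 < v2)%N then F u1 u2 v1 v2 else 0) =
  quad_sum m (fun u1 u2 v1 v2 => if (u2 < u1)%N then F (u1 - u2)%N u2 v1 (v1 + v2)%N else 0).
Proof.
transitivity (\sum_(1 <= u1 < m.+1) \sum_(1 <= u2 < m.+1) \sum_(1 <= v1 < m.+1)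
    \sum_(1 <= d < m.+1 | (u1 * v1 + u2 * (v1 + d) == m)%N) F u1 u2 v1 (v1 + d)%N).
  apply: eq_bigr => u1 _; apply: eq_big_nat => u2 /andP[u0 _]; apply: eq_bigr => v1 _.
  rewrite [RHS]big_mkcond -(@sum_shift m v1
    (fun v2 => if (u1 * v1 + u2 * v2 == m)%N then F u1 u2 v1 v2 else 0)).
    rewrite [LHS]big_mkcond [RHS]big_mkcond; apply: eq_bigr => v2 _.
    by case: ifP; case: ifP.
  move=> x mx; case: eqP => // e; move: mx; rewrite -e => mx.
  by have := leq_pmull x u0; lia.
rewrite (quad_sum_lt_if m (fun u1 u2 v1 v2 => F (u1 - u2)%N u2 v1 (v1 + v2)%N) (fun u1 u2 => (u2 < u1)%N)).
rewrite [RHS](exchange_big_dep_nat xpredT) //= exchange_big_nat /=.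
apply: eq_big_nat => u2 /andP[u20 _].
rewrite (@sum_shift m u2 (fun u1 => \sum_(1 <= v1 < m.+1)
  \sum_(1 <= v2 < m.+1 | (u1 * v1 + u2 * v2 == m)%N) F (u1 - u2)%N u2 v1 (v1 + v2)%N)).
  apply: eq_bigr => e _; apply: eq_bigr => v1 _; rewrite addKn.
  by apply: eq_bigl => d; congr (_ == _); lia.
move=> x mx; rewrite big_nat_cond big1 // => v1 /andP[/andP[v10 _] _].
rewrite big1 // => v2 /eqP e; move: mx; rewrite -e => mx.
by have := leq_pmulr x v10; lia.
Qed.

(** By the symmetry between the u's and the v's this is [quad_sum_diag]; the multiplicity [u - 1]
    counts the ways to write u = u1 + u2 with both parts positive. *)
Lemma quad_sum_diag_v m (f : nat -> V) :
  quad_sum m (fun u1 u2 v1 v2 => if v1 == v2 then f v1 else 0) =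
  pair_sum m (fun u v => f v *+ (u - 1)).
Proof.
transitivity (quad_sum m (fun u1 u2 v1 v2 => if u1 == u2 then f u1 else 0)).
  rewrite /quad_sum.
  under eq_bigr do rewrite exchange_big_nat /=.
  rewrite exchange_big_nat /=.
  under eq_bigr do under eq_bigr do rewrite (exchange_big_dep_nat xpredT) //=.
  under eq_bigr do rewrite exchange_big_nat /=.
  apply: eq_bigr => v1 _; apply: eq_bigr => v2 _; apply: eq_bigr => u1 _.
  by apply: eq_bigl => u2; rewrite mulnC [(u2 * _)%N]mulnC.
rewrite (quad_sum_diag m (fun u1 _ _ _ => f u1)) /pair_sum.
rewrite (exchange_big_dep_nat xpredT) //=; apply: eq_bigr => v _.
apply: eq_big => [u|u _]; first by rewrite mulnC.
by rewrite sumr_const_nat.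
Qed.

End QuadrupleSums.

Section PairProduct.
Variable K : comNzRingType.

Lemma pair_sum_widen i m (f : nat -> nat -> K) : (i <= m)%N ->
  pair_sum i f = \sum_(1 <= u < m.+1) \sum_(1 <= v < m.+1 | (u * v == i)%N) f u v.
Proof.
move=> im; rewrite /pair_sum [LHS](big_nat_widen _ _ m.+1) //= big_mkcond.
apply: eq_big_nat => u /andP[u0 um]; case: ltnP => [ui|iu].
  rewrite (big_nat_widen _ _ m.+1) //= big_mkcond [RHS]big_mkcond.
  apply: eq_big_nat => v /andP[v0 vm]; case: eqP => //= e.
  by rewrite ltnS -e leq_pmull.
rewrite big_nat_cond big1 // => v /andP[/andP[v0 _] /eqP e].
by move: iu; rewrite -e ltnNge leq_pmulr.
Qed.

Lemma pair_sum_mul m (f g : nat -> nat -> K) :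
  \sum_(i < m.+1) pair_sum i f * pair_sum (m - i) g =
  quad_sum m (fun u1 u2 v1 v2 => f u1 v1 * g u2 v2).
Proof.
transitivity (\sum_(i < m.+1) \sum_(1 <= u1 < m.+1) \sum_(1 <= u2 < m.+1)
   \sum_(1 <= v1 < m.+1) \sum_(1 <= v2 < m.+1)
   (if (u1 * v1 == i)%N && (u2 * v2 == m - i)%N then f u1 v1 * g u2 v2 else 0)).
  apply: eq_bigr => i _; rewrite (@pair_sum_widen i m) -1?ltnS //.
  rewrite (@pair_sum_widen (m - i) m) ?leq_subr // mulr_suml.
  apply: eq_bigr => u1 _; rewrite mulr_sumr; apply: eq_bigr => u2 _.
  rewrite mulr_suml big_mkcond; apply: eq_bigr => v1 _.
  case: eqP => _ /=; last by rewrite big1.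
  by rewrite mulr_sumr big_mkcond.
rewrite exchange_big /=; apply: eq_bigr => u1 _; rewrite exchange_big /=.
apply: eq_bigr => u2 _; rewrite exchange_big /=; apply: eq_bigr => v1 _.
rewrite exchange_big [RHS]big_mkcond /=; apply: eq_bigr => v2 _.
rewrite -big_mkcond /=; case: eqP => e.
  have lt : (u1 * v1 < m.+1)%N by rewrite ltnS -e leq_addr.
  rewrite (bigD1 (Ordinal lt)) /=; last by rewrite eqxx -e addKn eqxx.
  rewrite big1 ?addr0 // => i /andP[/andP[/eqP e1 _]] /eqP ni.
  by case: ni; apply: val_inj.
rewrite big1 // => i /andP[/eqP e1 /eqP e2]; case: e.
by rewrite e1 e2 subnKC // -ltnS.
Qed.

End PairProduct.

(** * Binomial inversion and the linear part of the shuffle relation *)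

Section BinomialSums.
Variable K : comNzRingType.

Lemma coef_1DX_exp m k : ((1 + 'X : {poly K}) ^+ m)`_k = 'C(m, k)%:R.
Proof.
rewrite addrC exprDn coef_sum.
have cf i : ('X ^+ (m - i) * (1 : {poly K}) ^+ i *+ 'C(m, i))`_k =
    'C(m, i)%:R *+ (k == (m - i)%N) by rewrite expr1n mulr1 coefMn coefXn -mulrnA mulnC mulrnA.
under eq_bigr do rewrite cf.
have [km|mk] := leqP k m.
  have lt : (m - k < m.+1)%N by rewrite ltnS leq_subr.
  rewrite (bigD1 (Ordinal lt)) //= subKn // eqxx mulr1n bin_sub // big1 ?addr0 // => i /eqP ni.
  case: eqP => // e; case: ni; apply: val_inj; rewrite /= e subKn //.
  by rewrite -ltnS.
rewrite bin_small // big1 // => i _; rewrite gtn_eqF ?mulr0n //.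
exact: leq_ltn_trans (leq_subr _ _) mk.
Qed.

(** Compare the coefficients of X^k in (1 + X)^(M-P) ((1 + X) - 1)^P, expanded by the binomial
    theorem and simplified to (1 + X)^(M-P) X^P. *)
Lemma alternating_binomial P M k : (P <= M)%N ->
  \sum_(j < P.+1) (-1) ^+ j * 'C(P, j)%:R * 'C(M - j, k)%:R =
  'C(M - P, k - P)%:R *+ (P <= k)%N :> K.
Proof.
move=> PM; have : \sum_(j < P.+1) (1 + 'X) ^+ (M - P) * ((1 + 'X) ^+ (P - j) * (-1) ^+ j *+ 'C(P, j))
    = (1 + 'X) ^+ (M - P) * 'X^P :> {poly K}.
  by rewrite -mulr_sumr -exprDn addrAC subrr add0r.
move=> /(congr1 (fun p : {poly K} => p`_k)); rewrite coef_sum coefMXn coef_1DX_exp.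
have -> : 'C(M - P, k - P)%:R *+ (P <= k)%N = (if (k < P)%N then 0 else 'C(M - P, k - P)%:R) :> K.
  by case: leqP.
move=> <-; apply: eq_bigr => j _.
have -> : ((-1) ^+ j : {poly K}) = ((-1) ^+ j)%:P by rewrite polyC_exp polyCN polyC1.
rewrite [in RHS]mulrnAr [in RHS]mulrA -exprD coefMn coefMC coef_1DX_exp.
rewrite (_ : (M - P + (P - j) = M - j)%N); last by have := ltn_ord j; lia.
by rewrite -[in RHS]mulr_natr; ring.
Qed.

(** Pascal's triangle, as a matrix, times its inverse, which is the triangle with alternating
    signs. *)
Lemma binomial_orthogonality k p r : (0 < p < k)%N -> (0 < r)%N ->
  \sum_(1 <= i < k) 'C(i - 1, r - 1)%:R * ((-1) ^+ (p + i) * 'C(p - 1, i - 1)%:R) =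
  (p == r)%:R :> K.
Proof.
case: p r => [//|p] [//|r] /= pk _.
rewrite big_add1 /= (@big_cat_nat _ _ _ p.+1) //=; last by lia.
rewrite [X in _ + X]big_nat_cond [X in _ + X]big1 ?addr0; last first.
  by move=> i /andP[/andP[pi _] _]; rewrite [X in _ * (_ * X%:R)]bin_small ?mulr0 //; lia.
rewrite big_nat_rev /= add0n big_mkord.
have := @alternating_binomial p p r (leqnn p); rewrite subnn bin0n.
have -> : (1 *+ ((r - p)%N == 0%N) *+ (p <= r)%N : K) = (p.+1 == r.+1)%:R.
  by rewrite eqSS -mulrnA mulnb subn_eq0 eqn_leq andbC.
move=> <-; apply: eq_bigr => j _; have jp := ltn_ord j.
have -> : (p.+1 + (p.+1 - j.+1).+1 = 2 * (p - j).+1 + j)%N by lia.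
rewrite exprD exprM sqrrN !expr1n mul1r !subSS !subn0 bin_sub; last by lia.
by rewrite [_ * (_ * _)]mulrC.
Qed.

Lemma binomial_reflection k p r s : (0 < p < k)%N -> (0 < r)%N -> (0 < s)%N -> k = (r + s)%N ->
  \sum_(1 <= i < k) 'C(i - 1, r - 1)%:R * ((-1) ^+ (k - i) * 'C(p - 1, k - i - 1)%:R) =
  - 'C(k - p - 1, s - 1)%:R :> K.
Proof.
case: p r s => [//|p] [//|r] [//|s] /= pk _ _ ke.
rewrite big_nat_rev /= big_add1 /= (@big_cat_nat _ _ _ p.+1) //=; last by lia.
rewrite [X in _ + X]big_nat_cond [X in _ + X]big1 ?addr0; last first.
  move=> i /andP[/andP[pi ik] _]; rewrite [X in _ * (_ * X%:R)]bin_small ?mulr0 //; lia.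
rewrite big_mkord.
have pM : (p <= k - 2)%N by lia.
have := alternating_binomial r pM.
have -> : ('C(k - 2 - p, r - p)%:R *+ (p <= r)%N : K) = 'C(k - p.+1 - 1, s.+1 - 1)%:R.
  case: leqP => pr; last by rewrite [in RHS]bin_small ?mulr0n //; lia.
  rewrite mulr1n -bin_sub; last by lia.
  by congr ('C(_, _)%:R); lia.
move=> <-; rewrite -sumrN; apply: eq_bigr => j _; have jp := ltn_ord j.
have -> : (k - (1 + k - j.+2) = j.+1)%N by lia.
rewrite exprS mulN1r (_ : (1 + k - j.+2 - 1 = k - 2 - j)%N); last by lia.
rewrite !subSS !subn0; ring.
Qed.

(** [Z], [G], [g] stand for [tzeta a], [tg (a + b)], [tg b]. The first sum comes from the bracket of
    [tG2] at (a + b, b), the second from the product term of [tG2] at (a + b, a). In the coefficient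
    of [Z p], [binomial_reflection] makes the [G] terms of the two sums cancel, and
    [binomial_orthogonality] keeps [g] only at p = r. *)
Lemma shuffle_linear_part (V : lmodType K) (Z : nat -> K) (G g : nat -> V) r s :
  (0 < r)%N -> (0 < s)%N ->
  \sum_(1 <= i < r + s) (\sum_(1 <= p < r + s) Z p *:
     (((-1) ^+ (r + s - i) * 'C(p - 1, r + s - i - 1)%:R) *: G (r + s - p)%N
      + ((-1) ^+ (p + i) * 'C(p - 1, i - 1)%:R) *: g (r + s - p)%N)) *+ 'C(i - 1, r - 1)
  + \sum_(1 <= i < r + s) (Z (r + s - i)%N *: G i) *+ 'C(i - 1, s - 1)
  = Z r *: g s.
Proof.
move=> r0 s0.
rewrite [X in _ + X]big_nat_rev /=.
under eq_bigr do rewrite -sumrMnl.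
rewrite exchange_big_nat -big_split /=.
transitivity (\sum_(1 <= p < r + s) Z p *: (g (r + s - p)%N *+ (p == r))).
  apply: eq_big_nat => p /andP[p0 pk].
  have -> : (1 + (r + s) - p.+1 = r + s - p)%N by lia.
  rewrite (subKn (ltnW pk)).
  under eq_bigr do rewrite scalerMnr.
  rewrite -scaler_sumr scalerMnr -scalerDr; congr (_ *: _).
  under eq_bigr do rewrite mulrnDl -!scaler_nat !scalerA.
  rewrite big_split -!scaler_suml /= binomial_orthogonality ?p0 //.
  rewrite (@binomial_reflection _ _ _ s) ?p0 // scaleNr !scaler_nat.
  by rewrite addrAC addNr add0r.
rewrite (bigD1_seq r) ?iota_uniq ?mem_index_iota //=; last by lia.
rewrite eqxx mulr1n addKn big1 ?addr0 // => p pr.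
by rewrite (negbTE pr) mulr0n scaler0.
Qed.

End BinomialSums.

Section SeriesCoefficients.
Variable K : comNzRingType.
Implicit Types f g : pser K.

Lemma pcoef_sum (I : Type) (r : seq I) (P : pred I) (F : I -> pser K) m :
  (\sum_(i <- r | P i) F i) m = \sum_(i <- r | P i) F i m.
Proof. by elim/big_rec2: _ => // i y x _ <-. Qed.

Lemma pcoefMn f k m : (f *+ k) m = f m *+ k.
Proof. by elim: k => [|k IH] //; rewrite !mulrS -IH. Qed.

Lemma pcoefD f g m : (f + g) m = f m + g m. Proof. by []. Qed.

Lemma pcoefZ c f m : (c *: f) m = c * f m. Proof. by []. Qed.

Lemma pcoefM f g m : (f * g) m = \sum_(i < m.+1) f i * g (m - i)%N. Proof. by []. Qed.

End SeriesCoefficients.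

Section PairSumLinearity.
Variable K : comNzRingType.
Implicit Types f g : nat -> nat -> K.

Lemma pair_sumD m f g : pair_sum m (fun u v => f u v + g u v) = pair_sum m f + pair_sum m g.
Proof. by rewrite /pair_sum -big_split; apply: eq_bigr => u _; rewrite -big_split. Qed.

Lemma pair_sumZ m c f : pair_sum m (fun u v => c * f u v) = c * pair_sum m f.
Proof.
by rewrite /pair_sum mulr_sumr; apply: eq_bigr => u _; rewrite mulr_sumr.
Qed.

Lemma pair_sumMn m f k : pair_sum m (fun u v => f u v *+ k) = pair_sum m f *+ k.
Proof.
by rewrite /pair_sum -sumrMnl; apply: eq_bigr => u _; rewrite -sumrMnl.
Qed.

Lemma pair_sum_sum m A B (F : nat -> nat -> nat -> K) :
  pair_sum m (fun u v => \sum_(A <= p < B) F p u v) = \sum_(A <= p < B) pair_sum m (F p).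
Proof.
rewrite /pair_sum exchange_big_nat; apply: eq_bigr => u _.
by rewrite exchange_big_nat.
Qed.

Lemma eq_pair_sum m f g : (forall u v, (0 < u)%N -> (0 < v)%N -> f u v = g u v) ->
  pair_sum m f = pair_sum m g.
Proof.
move=> fg; apply: eq_big_nat => u /andP[? _]; rewrite big_nat_cond [RHS]big_nat_cond.
by apply: eq_bigr => v /andP[/andP[? _] _]; exact: fg.
Qed.

Lemma quad_sum_sum m A B (F : nat -> nat -> nat -> nat -> nat -> K) :
  quad_sum m (fun u1 u2 v1 v2 => \sum_(A <= p < B) F p u1 u2 v1 v2) =
  \sum_(A <= p < B) quad_sum m (F p).
Proof.
rewrite /quad_sum [RHS]exchange_big_nat; apply: eq_bigr => u1 _.
rewrite [RHS]exchange_big_nat; apply: eq_bigr => u2 _.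
rewrite [RHS]exchange_big_nat; apply: eq_bigr => v1 _.
by rewrite [RHS]exchange_big_nat.
Qed.

Lemma quad_sumMn m (F : nat -> nat -> nat -> nat -> K) k :
  quad_sum m (fun u1 u2 v1 v2 => F u1 u2 v1 v2 *+ k) = quad_sum m F *+ k.
Proof.
rewrite /quad_sum -sumrMnl; apply: eq_bigr => u1 _.
rewrite -sumrMnl; apply: eq_bigr => u2 _.
by rewrite -sumrMnl; apply: eq_bigr => v1 _; rewrite -sumrMnl.
Qed.

End PairSumLinearity.

(** * Stuffle and shuffle products of the series tg *)

Section QSeries.
Variables (R : realType) (n : nat).
Local Notation C := R[i].
Local Notation N := n.+1.
Local Notation eta := (Defs.eta R n).
Implicit Types a b : 'I_N.
Local Notation gc := (@gcoef R n).

Local Opaque csum.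

Let N0 : (N%:R : C) != 0. Proof. by rewrite pnatr_eq0. Qed.
Let fact0' m : (m`!%:R : C) != 0.
Proof. by rewrite pnatr_eq0 -lt0n fact_gt0. Qed.

Lemma tg_coef a s m : tg R a s m = (pair_sum m (fun _ v => gc a s v))%:P.
Proof.
rewrite /tg /= /pair_sum; congr (_%:P); rewrite mulr_sumr.
by apply: eq_bigr => u _; rewrite mulr_sumr.
Qed.

Lemma tg2_coef a b r s m : tg2 R a b r s m =
  (quad_sum m (fun u1 u2 v1 v2 => if (u2 < u1)%N then gc a r v1 * gc b s v2 else 0))%:P.
Proof.
rewrite quad_sum_gt /tg2 /=; congr (_%:P).
rewrite mulr_sumr; apply: eq_bigr => u1 _; rewrite mulr_sumr; apply: eq_bigr => u2 _.
rewrite mulr_sumr; apply: eq_bigr => v1 _; rewrite mulr_sumr; apply: eq_bigr => v2 _.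
rewrite /gcoef !exprD.
have := expf_neq0 r N0; have := expf_neq0 s N0; move: (N%:R ^+ r) (N%:R ^+ s) => x y y0 x0.
by field; rewrite !fact0' x0 y0.
Qed.

Lemma tg_mul_coef a b r s m : (tg R a r * tg R b s) m =
  (quad_sum m (fun u1 u2 v1 v2 => gc a r v1 * gc b s v2))%:P.
Proof.
rewrite pcoefM -(pair_sum_mul m (fun _ v => gc a r v) (fun _ v => gc b s v)).
under eq_bigr do rewrite !tg_coef -polyCM.
by rewrite -rmorph_sum.
Qed.

Lemma tg_stuffle a b r s : (0 < r)%N -> (0 < s)%N ->
  tg R a r * tg R b s = tg2 R a b r s + tg2 R b a s r + tg R a (r + s) *+ (a == b)
  + ((2 * N%:R)^-1 : C)%:P *: (tg R a r *+ (s == 1%N) + tg R b s *+ (r == 1%N))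
  + \sum_(1 <= p < r + s) (twopii R ^- p * zeta_parity R (a - b) p)%:P *:
      (((-1) ^+ s * 'C(p - 1, s - 1)%:R) *: tg R a (r + s - p)
       + ((-1) ^+ (p + r) * 'C(p - 1, r - 1)%:R) *: tg R b (r + s - p)).
Proof.
move=> r0 s0; apply: pserP => m.
rewrite tg_mul_coef !pcoefD !tg2_coef pcoefMn tg_coef pcoefZ pcoefD !pcoefMn !tg_coef pcoef_sum.
have sgn (k l : nat) : (-1) ^+ k * l%:R = ((-1) ^+ k * l%:R)%:P :> {poly C}.
  by rewrite polyCM polyC_exp polyCN polyC1 polyC_natr.
under eq_bigr do rewrite pcoefZ pcoefD !pcoefZ !tg_coef !sgn -!polyCM -polyCD -polyCM.
rewrite -rmorph_sum /= -!polyCMn -!polyCD -!polyCM -!polyCD; congr (_%:P).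
transitivity (quad_sum m (fun u1 u2 v1 v2 => if (u2 < u1)%N then gc a r v1 * gc b s v2 else 0)
  + quad_sum m (fun u1 u2 v1 v2 => if (u2 < u1)%N then gc b s v1 * gc a r v2 else 0)
  + quad_sum m (fun u1 u2 v1 v2 => if u1 == u2 then gc a r v1 * gc b s v2 else 0)).
  rewrite [X in _ = _ + X + _]quad_sum_swap -!quad_sumD; apply: eq_quad_sum => u1 u2 v1 v2 _ _ _ _.
  by case: ltngtP => _; rewrite ?addr0 ?add0r // mulrC.
rewrite -!addrA; congr (_ + (_ + _)).
rewrite (quad_sum_diag m (fun _ _ v1 v2 => gc a r v1 * gc b s v2)).
transitivity (pair_sum m (fun _ w => gc a (r + s) w *+ (a == b)
  + (2 * N%:R)^-1 * (gc a r w *+ (s == 1%N) + gc b s w *+ (r == 1%N))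
  + \sum_(1 <= p < r + s) twopii R ^- p * zeta_parity R (a - b) p *
      ((-1) ^+ s * 'C(p - 1, s - 1)%:R * gc a (r + s - p) w
       + (-1) ^+ (p + r) * 'C(p - 1, r - 1)%:R * gc b (r + s - p) w))).
  by apply: eq_pair_sum => u w _ w0; exact: diagonal_coef.
pose f1 (_ w : nat) := gc a (r + s) w *+ (a == b).
pose f2 (_ w : nat) := (2 * N%:R)^-1 * (gc a r w *+ (s == 1%N) + gc b s w *+ (r == 1%N)).
pose f3 (p _ w : nat) := (-1) ^+ s * 'C(p - 1, s - 1)%:R * gc a (r + s - p) w
       + (-1) ^+ (p + r) * 'C(p - 1, r - 1)%:R * gc b (r + s - p) w.
pose d p := twopii R ^- p * zeta_parity R (a - b) p.
rewrite -[LHS]/(pair_sum m (fun u w => (f1 u w + f2 u w)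
  + \sum_(1 <= p < r + s) d p * f3 p u w)).
rewrite (pair_sumD m (fun u w => f1 u w + f2 u w)) (pair_sumD m f1 f2) -addrA.
congr (_ + (_ + _)).
- exact: (pair_sumMn m (fun _ w => gc a (r + s) w)).
- rewrite (pair_sumZ m (2 * N%:R)^-1 (fun _ w => gc a r w *+ (s == 1%N) + gc b s w *+ (r == 1%N))).
  rewrite (pair_sumD m (fun _ w => gc a r w *+ (s == 1%N)) (fun _ w => gc b s w *+ (r == 1%N))).
  by rewrite (pair_sumMn m (fun _ w => gc a r w)) (pair_sumMn m (fun _ w => gc b s w)).
rewrite (pair_sum_sum m 1 (r + s) (fun p u w => d p * f3 p u w)); apply: eq_bigr => p _.
rewrite (pair_sumZ m (d p) (f3 p)); congr (_ * _).
rewrite (pair_sumD m (fun _ w => (-1) ^+ s * 'C(p - 1, s - 1)%:R * gc a (r + s - p) w)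
  (fun _ w => (-1) ^+ (p + r) * 'C(p - 1, r - 1)%:R * gc b (r + s - p) w)).
by rewrite (pair_sumZ m _ (fun _ w => gc a (r + s - p) w))
  (pair_sumZ m _ (fun _ w => gc b (r + s - p) w)).
Qed.

(** Expand (v + w)^(s-1) by the binomial theorem and note a v + b (v + w) = (a + b) v + b w.
    Regrouping the factorials turns the binomial coefficient of that expansion into 'C(i - 1, r -
    1). *)
Lemma gcoef_shuffle a b r s v w : (0 < r)%N -> (0 < s)%N ->
  gc a r v * gc b s (v + w) =
  \sum_(1 <= i < r + s) gc (a + b) i v * gc b (r + s - i) w *+ 'C(i - 1, r - 1).
Proof.
case: r s => [//|r] [//|s] _ _.
rewrite addSn big_add1 /= (@big_cat_nat _ _ _ r) //=; last by lia.
rewrite [X in X + _]big_nat_cond [X in X + _]big1 ?add0r; last first.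
  by move=> i /andP[/andP[_ ir] _]; rewrite bin_small ?mulr0n //; lia.
have shift (F : nat -> C) : \sum_(r <= i < r + s.+1) F i = \sum_(0 <= t < s.+1) F (t + r)%N.
  by rewrite -{1}[r]add0n big_addn addKn.
rewrite {}shift big_mkord /gcoef /= natrD [v%:R + _]addrC exprDn !mulr_sumr.
apply: eq_bigr => t _; have ts := ltn_ord t.
have -> : ((r + s.+1).+1 - (t + r).+1 = (s - t).+1)%N by lia.
rewrite mulnDr exprD eta_addZ !subSS !subn0 /=.
have f1 : 'C(t + r, r)%:R * (r`!%:R * t`!%:R) = (t + r)`!%:R :> C.
  by rewrite -!natrM -(bin_fact (leq_addl t r)) addnK.
have f2 : 'C(s, t)%:R * (t`!%:R * (s - t)`!%:R) = s`!%:R :> C.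
  by rewrite -!natrM bin_fact // -ltnS.
have sg : (-1) ^+ (t + r).+1 * (-1) ^+ (s - t).+1 = (-1) ^+ r.+1 * (-1) ^+ s.+1 :> C.
  by rewrite -!exprD; congr (_ ^+ _); lia.
have Ng : N%:R ^+ (t + r).+1 * N%:R ^+ (s - t).+1 = N%:R ^+ r.+1 * N%:R ^+ s.+1 :> C.
  by rewrite -!exprD; congr (_ ^+ _); lia.
have vg : v%:R ^+ (t + r) = v%:R ^+ r * v%:R ^+ t :> C by rewrite -exprD addnC.
transitivity ((-1) ^+ r.+1 * (-1) ^+ s.+1 / (N%:R ^+ r.+1 * N%:R ^+ s.+1) *
   (eta ^+ (a * v) * eta ^+ (b * v) * eta ^+ (b * w) * (v%:R ^+ r * v%:R ^+ t) * w%:R ^+ (s - t))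
   * ('C(s, t)%:R / (r`!%:R * s`!%:R))).
  rewrite -[X in _ * (_ * (_ * X)) = _]mulr_natr.
  have := expf_neq0 r.+1 N0; have := expf_neq0 s.+1 N0.
  move: (N%:R ^+ r.+1) (N%:R ^+ s.+1) => x y y0 x0.
  by field; rewrite !fact0' x0 y0.
rewrite -sg -Ng -vg.
have -> : 'C(s, t)%:R / (r`!%:R * s`!%:R) = 'C(t + r, r)%:R / ((t + r)`!%:R * (s - t)`!%:R) :> C.
  have := fact0' s; have := fact0' (t + r); rewrite -f1 -f2 !mulf_eq0 !negb_or.
  move=> /andP[c1 /andP[? ?]] /andP[c2 /andP[? ?]].
  by field; rewrite !fact0' c1 c2.
rewrite -[RHS]mulr_natr.
have := expf_neq0 (t + r).+1 N0; have := expf_neq0 (s - t).+1 N0.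
move: (N%:R ^+ (t + r).+1) (N%:R ^+ (s - t).+1) => x y y0 x0.
by field; rewrite !fact0' x0 y0.
Qed.

(** In the multiplicity u - 1 the part u gives the summand of [dtg] and the part -1 that of [tg]:
    the two carry the same denominator and opposite signs, their sign exponents being r + s - 2 and
    r + s - 1. *)
Lemma gcoef_diagonal a b r s v (u : nat) : (0 < r)%N -> (0 < s)%N -> (0 < u)%N ->
  gc a r v * gc b s v *+ (u - 1) =
  N%:R^-1 * 'C(r + s - 2, s - 1)%:R *
   ((-1) ^+ (r + s - 2) / (N%:R ^+ (r + s - 2).+1 * (r + s - 2)`!%:R) *
      (u%:R * v%:R ^+ (r + s - 2) * eta ^+ ((a + b)%R * v))
    + gc (a + b) (r + s - 1) v).
Proof.
case: r s u => [//|r] [//|s] [//|u] _ _ _.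
have -> : (r.+1 + s.+1 - 2 = r + s)%N by lia.
have -> : (r.+1 + s.+1 - 1 = (r + s).+1)%N by lia.
rewrite /gcoef eta_addZ !subSS !subn0 /= -[in LHS]mulr_natr -[u.+1]addn1 natrD !exprS !exprD.
have f : 'C(r + s, s)%:R * (s`!%:R * r`!%:R) = (r + s)`!%:R :> C.
  by rewrite -!natrM -(bin_fact (leq_addl r s)) addnK.
have := fact0' (r + s); rewrite -f !mulf_eq0 !negb_or => /andP[c0 _].
have := expf_neq0 r N0; have := expf_neq0 s N0; have := N0.
move: (N%:R : C) (N%:R ^+ r) (N%:R ^+ s) => z x y z0 y0 x0.
by field; rewrite !fact0' x0 y0 z0 c0.
Qed.

Lemma frs_coef a b r s m : frs R a b r s m =
  (pair_sum m (fun u v => N%:R^-1 * 'C(r + s - 2, s - 1)%:R *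
   ((-1) ^+ (r + s - 2) / (N%:R ^+ (r + s - 2).+1 * (r + s - 2)`!%:R) *
      (u%:R * v%:R ^+ (r + s - 2) * eta ^+ ((a + b)%R * v))
    + gc (a + b) (r + s - 1) v)))%:P.
Proof.
rewrite /frs pcoefZ pcoefD tg_coef.
set k := (r + s - 2)%N.
pose f1 (u v : nat) : C := u%:R * v%:R ^+ k * eta ^+ ((a + b)%R * v).
pose c1 : C := (-1) ^+ k / (N%:R ^+ k.+1 * k`!%:R).
have -> : dtg R (a + b) k m = (c1 * pair_sum m f1)%:P by [].
rewrite -mul_polyC -!polyCM -polyCD -polyCM; congr (_%:P).
rewrite (pair_sumZ m (N%:R^-1 * 'C(k, s - 1)%:R)
  (fun u v => c1 * f1 u v + gc (a + b) (r + s - 1) v)).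
by rewrite (pair_sumD m (fun u v => c1 * f1 u v)) (pair_sumZ m c1 f1).
Qed.

Lemma tg_shuffle a b r s : (0 < r)%N -> (0 < s)%N ->
  tg R a r * tg R b s = \sum_(1 <= i < r + s)
    (tg2 R (a + b) b i (r + s - i) *+ 'C(i - 1, r - 1)
     + tg2 R (a + b) a i (r + s - i) *+ 'C(i - 1, s - 1)) + frs R a b r s.
Proof.
move=> r0 s0; apply: pserP => m.
rewrite tg_mul_coef pcoefD pcoef_sum frs_coef.
under [X in _ = X + _]eq_bigr do rewrite pcoefD !pcoefMn !tg2_coef -!polyCMn -polyCD.
rewrite -rmorph_sum /= -polyCD; congr (_%:P).
have half (a' b' : 'I_N) r' s' : (0 < r')%N -> (0 < s')%N ->
   quad_sum m (fun u1 u2 v1 v2 => if (v1 < v2)%N then gc a' r' v1 * gc b' s' v2 else 0) =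
   \sum_(1 <= i < r' + s') quad_sum m (fun u1 u2 v1 v2 => if (u2 < u1)%N then
      gc (a' + b') i v1 * gc b' (r' + s' - i) v2 else 0) *+ 'C(i - 1, r' - 1).
  move=> r0' s0'; rewrite (quad_sum_shuffle m (fun _ _ v1 v2 => gc a' r' v1 * gc b' s' v2)).
  pose F i (u1 u2 v1 v2 : nat) : C := if (u2 < u1)%N then
      gc (a' + b') i v1 * gc b' (r' + s' - i) v2 else 0.
  transitivity (quad_sum m (fun u1 u2 v1 v2 =>
     \sum_(1 <= i < r' + s') F i u1 u2 v1 v2 *+ 'C(i - 1, r' - 1))).
    apply: eq_quad_sum => u1 u2 v1 v2 _ _ _ _; rewrite /F; case: ifP => _.
      exact: gcoef_shuffle.
    by rewrite big1 // => i _; rewrite mul0rn.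
  rewrite (quad_sum_sum m 1 (r' + s') (fun i u1 u2 v1 v2 => F i u1 u2 v1 v2 *+ 'C(i - 1, r' - 1))).
  by apply: eq_bigr => i _; rewrite (quad_sumMn m (F i)).
rewrite big_split /= -(half a b r s r0 s0).
have -> : \sum_(1 <= i < r + s) quad_sum m (fun u1 u2 v1 v2 => if (u2 < u1)%N then
      gc (a + b) i v1 * gc a (r + s - i) v2 else 0) *+ 'C(i - 1, s - 1) =
   quad_sum m (fun u1 u2 v1 v2 => if (v2 < v1)%N then gc a r v1 * gc b s v2 else 0).
  rewrite [a + b]addrC [(r + s)%N]addnC -(half b a s r s0 r0) quad_sum_swap.
  by apply: eq_quad_sum => u1 u2 v1 v2 _ _ _ _; rewrite mulrC.
transitivity (quad_sum m (fun u1 u2 v1 v2 => if (v1 < v2)%N then gc a r v1 * gc b s v2 else 0)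
  + quad_sum m (fun u1 u2 v1 v2 => if (v2 < v1)%N then gc a r v1 * gc b s v2 else 0)
  + quad_sum m (fun u1 u2 v1 v2 => if v1 == v2 then gc a r v1 * gc b s v1 else 0)).
  rewrite -!quad_sumD; apply: eq_quad_sum => u1 u2 v1 v2 _ _ _ _.
  by case: ltngtP => [_|_|->]; rewrite ?addr0 ?add0r.
congr (_ + _); rewrite (quad_sum_diag_v m (fun v => gc a r v * gc b s v)).
by apply: eq_pair_sum => u v u0 _; exact: gcoef_diagonal.
Qed.

End QSeries.

Lemma mul_const_series (K : comNzRingType) (x y : K) (f g : pser K) :
  (x%:A + f) * (y%:A + g) = (x * y)%:A + y *: f + x *: g + f * g.
Proof.
by rewrite mulrDl !mulrDr !mulr_algl scalerA [f * y%:A]mulrC mulr_algl; ring.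
Qed.

(** * Eisenstein series *)

Section EisensteinSeries.
Variables (R : realType) (n : nat).
Local Notation C := R[i].
Local Notation N := n.+1.
Implicit Types a b : 'I_N.

Local Opaque csum Li Li2 zetaN zetaN2 zeta_reg zeta_reg2 zeta_parity.

Lemma tzeta_stuffle sharp a b r s : (0 < r)%N -> (0 < s)%N -> (r, s) <> (1, 1)%N ->
  tzeta R sharp a r * tzeta R sharp b s =
  tzeta2 R Ast a b r s + tzeta2 R Ast b a s r + tzeta R sharp a (r + s) *+ (a == b).
Proof.
move=> r0 s0 rs; rewrite /tzeta /tzeta2 -scalerAl -scalerAr scalerA -invfM -exprD.
by rewrite zeta_reg_stuffle // !scalerDr scalerMnr [(s + r)%N]addnC.
Qed.

Lemma tzeta_shuffle sharp a b r s : (0 < r)%N -> (0 < s)%N ->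
  tzeta R sharp a r * tzeta R sharp b s = \sum_(1 <= i < r + s)
    (tzeta2 R Sh (a + b) b i (r + s - i) *+ 'C(i - 1, r - 1)
     + tzeta2 R Sh (a + b) a i (r + s - i) *+ 'C(i - 1, s - 1)).
Proof.
move=> r0 s0; rewrite /tzeta /tzeta2 -scalerAl -scalerAr scalerA -invfM -exprD.
rewrite zeta_reg_shuffle // scaler_sumr; apply: eq_big_nat => i /andP[_ ik].
by rewrite scalerDr !scalerMnr subnKC // ltnW.
Qed.

Lemma tzeta_sharp sharp sharp' a r : tzeta R sharp a r = tzeta R sharp' a r.
Proof. by []. Qed.

Lemma tzeta_parity (c : 'I_N) sharp p : (0 < p)%N ->
  tzeta R sharp c p + (-1) ^+ p * tzeta R sharp (- c) p =
  (twopii R ^- p * zeta_parity R c p)%:P.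
Proof.
move=> p0; rewrite /tzeta.
have -> : ((-1) ^+ p : {poly C}) = ((-1) ^+ p)%:P by rewrite polyC_exp polyCN polyC1.
rewrite mul_polyC scalerA mulrC -scalerA -scalerDr (zeta_reg_parity R c sharp p0).1.
by rewrite -mul_polyC polyCM.
Qed.

(* The binomial coefficients vanish for [p < minn r s]. *)
Lemma tG2E sharp a b r s : (0 < r)%N -> (0 < s)%N -> tG2 R sharp a b r s =
  (tzeta2 R sharp a b r s)%:A + tzeta R sharp b s *: tg R a r + tg2 R a b r s
  + \sum_(1 <= p < r + s)
      tzeta R sharp (a - b) p *:
        (((-1) ^+ s * 'C(p - 1, s - 1)%:R) *: tg R a (r + s - p)
         + ((-1) ^+ (p + r) * 'C(p - 1, r - 1)%:R) *: tg R b (r + s - p)).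
Proof.
move=> r0 s0; rewrite /tG2; congr (_ + _).
rewrite [RHS](@big_cat_nat _ _ _ (minn r s)) /=; [|lia..].
rewrite [X in _ = X + _]big_nat_cond [X in _ = X + _]big1 ?add0r // => p /andP[/andP[p1 pm] _].
rewrite (@bin_small (p - 1) (s - 1)) ?(@bin_small (p - 1) (r - 1)); [|lia..].
by rewrite !mulr0 !scale0r addr0 scaler0.
Qed.

(** Exchanging (a, r) with (b, s) turns [tzeta (a - b) p] into [tzeta (b - a) p] and changes the
    signs in the bracket by (-1)^p. The two brackets thus add up to the parity combinations that
    [tg_stuffle] produces. *)
Lemma tG_stuffle sharp a b r s : (0 < r)%N -> (0 < s)%N -> (r, s) <> (1, 1)%N ->
  tG R sharp a r * tG R sharp b s = tG2 R Ast a b r s + tG2 R Ast b a s r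
  + tG R sharp a (r + s) *+ (a == b)
  + ((2 * N%:R)^-1 : C)%:P *: (tg R a r *+ (s == 1%N) + tg R b s *+ (r == 1%N)).
Proof.
move=> r0 s0 rs.
rewrite !tG2E // /tG mul_const_series tzeta_stuffle // tg_stuffle //.
rewrite [(s + r)%N]addnC.
pose S := \sum_(1 <= p < r + s) (twopii R ^- p * zeta_parity R (a - b) p)%:P *:
      (((-1) ^+ s * 'C(p - 1, s - 1)%:R) *: tg R a (r + s - p)
       + ((-1) ^+ (p + r) * 'C(p - 1, r - 1)%:R) *: tg R b (r + s - p)).
have sumE : S = \sum_(1 <= p < r + s)
      tzeta R Ast (a - b) p *:
        (((-1) ^+ s * 'C(p - 1, s - 1)%:R) *: tg R a (r + s - p)
         + ((-1) ^+ (p + r) * 'C(p - 1, r - 1)%:R) *: tg R b (r + s - p))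
  + \sum_(1 <= p < r + s)
      tzeta R Ast (b - a) p *:
        (((-1) ^+ r * 'C(p - 1, r - 1)%:R) *: tg R b (r + s - p)
         + ((-1) ^+ (p + s) * 'C(p - 1, s - 1)%:R) *: tg R a (r + s - p)).
  rewrite -big_split; apply: eq_big_nat => p /andP[p0 _] /=.
  rewrite -(tzeta_parity (a - b) Ast p0) opprB scalerDl; congr (_ + _).
  rewrite mulrC -[(tzeta _ _ _ _ * _) *: _]scalerA; congr (_ *: _).
  rewrite scalerDr !scalerA addrC !exprD !mulrA.
  by rewrite -expr2 -exprM mulnC exprM sqrrN !expr1n mul1r.
rewrite -/S sumE.
rewrite mulrnDl !scalerDl -scalerMnl.
rewrite (tzeta_sharp sharp Ast a r) (tzeta_sharp sharp Ast b s).
move: (_%:A) (_ *: tg R a r) (_ *: tg R b s) => x1 x2 x3.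
set x4 := (_%:A); set x5 := (_%:A *+ _).
set S1 := \sum_(_ <= _ < _) _; set S2 := \sum_(_ <= _ < _) _.
move: (_ *: (_ + _)) => x6.
ring.
Qed.

Lemma tG_shuffle sharp a b r s : (0 < r)%N -> (0 < s)%N ->
  tG R sharp a r * tG R sharp b s = \sum_(1 <= i < r + s)
    (tG2 R Sh (a + b) b i (r + s - i) *+ 'C(i - 1, r - 1)
     + tG2 R Sh (a + b) a i (r + s - i) *+ 'C(i - 1, s - 1)) + frs R a b r s.
Proof.
move=> r0 s0; rewrite /tG mul_const_series tzeta_shuffle // tg_shuffle //.
rewrite (tzeta_sharp sharp Sh a r) (tzeta_sharp sharp Sh b s).
(* Used from right to left, the two instances expand both mixed products into sums over [i] that
   match the linear terms of [tG2] index by index. *)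
have := shuffle_linear_part (tzeta R Sh a) (tg R (a + b)) (tg R b) r0 s0.
have := shuffle_linear_part (tzeta R Sh b) (tg R (a + b)) (tg R a) s0 r0.
rewrite [(s + r)%N]addnC => <- <-.
rewrite addrA; congr (_ + _).
rewrite scaler_suml -!big_split; apply: eq_big_nat => i /andP[i0 ik] /=.
have ki : (0 < r + s - i)%N by rewrite subn_gt0.
rewrite !tG2E // addrK [a + b - a]addrAC subrr add0r subnKC ?(ltnW ik) //.
rewrite scalerDl -!scalerMnl !mulrnDl.
move: (_%:A *+ _) (_%:A *+ _) => x1 x2.
move: (_ *+ _) (_ *+ _) (_ *+ _) (_ *+ _) => y1 y2 y3 y4.
move: (_ *+ _) (_ *+ _) => z1 z2.
ring.
Qed.

Lemma f2E a : f2 R a = (N%:R^-1 : C)%:P *: dtg R a 0.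
Proof.
have N0 : (N%:R : C) != 0 by rewrite pnatr_eq0.
apply: pserP => m; rewrite pcoefZ /= -polyCM; congr (_%:P).
rewrite mulrA expr0 mul1r fact0 mulr1 expr1 -invfM -expr2; congr (_ * _).
apply: eq_bigr => u _; apply: eq_bigr => v _.
by rewrite expr0 mulr1 mulrC.
Qed.

(** [tG_shuffle] holds for r = s = 1 as well. By [f2E] the terms with [f2] cancel [dtg a 0] and
    [dtg b 0], and what is left is [frs] at (1, 1). *)
Lemma tG_shuffle11 sharp a b :
  tG R sharp a 1 * tG R sharp b 1
    = tG2 R Sh (a + b) b 1 1 + tG2 R Sh (a + b) a 1 1
      + (2^-1 : C)%:P *: (f2 R a + f2 R b)
      + ((2 * N%:R)^-1 : C)%:P *:
          (dtg R (a + b) 0 *+ 2 + tg R (a + b) 1 *+ 2 - dtg R a 0 - dtg R b 0).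
Proof.
rewrite tG_shuffle // big_nat1 addKn subnn bin0 !mulr1n -[RHS]addrA; congr (_ + _).
rewrite /frs addKn subnn bin0 alg_polyC invfM polyCM !f2E.
have h2 : ((2^-1 : C)%:P *+ 2)%:A = 1 :> pser {poly C}.
  by rewrite -polyCMn -[_^-1 *+ 2]mulr_natr mulVf ?pnatr_eq0 // polyC1 scale1r.
rewrite -[(1 + 1 - 2)%N]/0%N.
move: (dtg R (a + b) 0) (tg R (a + b) 1) (dtg R a 0) (dtg R b 0) => x y u v.
rewrite -!scalerDr scalerA [_%:P * _]mulrC -!scalerA -scalerDr; congr (_ *: _).
set h := (2^-1)%:P in h2 *.
rewrite -[LHS]mul1r -h2 -(mulr_algl h (u + v)) -(mulr_algl h (_ - v)).
rewrite -scalerMnl; ring.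
Qed.

End EisensteinSeries.

Theorem theorem6p5 (R : realType) (n : nat) (sharp : regularization) :
  (forall (a b : 'I_n.+1) (r s : nat),
      (1 <= r)%N -> (1 <= s)%N -> (r, s) <> (1, 1)%N ->
      tG R sharp a r * tG R sharp b s
        = tG2 R Ast a b r s + tG2 R Ast b a s r
          + tG R sharp a (r + s) *+ (a == b)
          + ((2 * n.+1%:R)^-1 : R[i])%:P *:
              (tg R a r *+ (s == 1%N) + tg R b s *+ (r == 1%N))
      /\
      tG R sharp a r * tG R sharp b s
        = \sum_(1 <= i < r + s)
            (tG2 R Sh (a + b) b i (r + s - i) *+ 'C(i - 1, r - 1)
             + tG2 R Sh (a + b) a i (r + s - i) *+ 'C(i - 1, s - 1))
          + frs R a b r s)
  /\
  (forall a b : 'I_n.+1,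
      tG R sharp a 1 * tG R sharp b 1
        = tG2 R Sh (a + b) b 1 1 + tG2 R Sh (a + b) a 1 1
          + (2^-1 : R[i])%:P *: (f2 R a + f2 R b)
          + ((2 * n.+1%:R)^-1 : R[i])%:P *:
              (dtg R (a + b) 0 *+ 2 + tg R (a + b) 1 *+ 2
               - dtg R a 0 - dtg R b 0)).
Proof.
split; first by move=> a b r s r0 s0 rs; split; [exact: tG_stuffle | exact: tG_shuffle].
exact: tG_shuffle11.
Qed.
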